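(* Let $n\geq 2$, let $1\leq p<\infty$, let $\omega$ be a nondecreasing continuous function on $[0,\infty)$ with $\omega(0)=0$, and let $D$ be a bounded domain in $\mathbb R^n$ with $\partial D\in C^{1,\omega}$. If $$ \int_0^1\frac{\delta^{n(p-1)-1}}{(\omega(\delta))^{n-p}}\,d\delta=\infty, $$ then $1_D\notin A_p(\mathbb R^n)$.
   Context: A domain is a (nonempty) open connected set. $1_D$ denotes the characteristic function of $D$. The Fourier transform is $\widehat f(\xi)=\int_{\mathbb R^n} f(t)e^{-i(\xi,t)}\,dt$ for integrable $f$, where $(\cdot,\cdot)$ is the inner product in $\mathbb R^n$, and is extended to tempered distributions as usual. For $1\leq p\leq\infty$, $A_p(\mathbb R^n)$ is the space of tempered distributions $f$ on $\mathbb R^n$ such that $\widehat f\in L^p(\mathbb R^n)$, with norm $\|f\|_{A_p(\mathbb R^n)}=\|\widehat f\|_{L^p(\mathbb R^n)}$. The boundary $\partial D$ is $C^1$-smooth if in an appropriate neighborhood of each of its points $\partial D$ is (after a suitable choice of orthonormal coordinates) the graph of a real function of class $C^1$. For $D$ with $C^1$-smooth boundary let $\nu_D(x)\in S^{n-1}$ be the outer unit normal vector to $\partial D$ at $x\in\partial D$, and let $$ \omega(\nu_D,\delta)=\sup_{x,y\in\partial D;\ |x-y|\leq\delta}|\nu_D(x)-\nu_D(y)|,\qquad \delta\geq 0. $$ The notation $\partial D\in C^{1,\omega}$ means that $\partial D$ is $C^1$-smooth and $\omega(\nu_D,\delta)=O(\omega(\delta))$ as $\delta\to+0$. In the integral the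 convention $1/0=+\infty$ is used should $\omega$ vanish at some $\delta>0$. *)

(* Defs.v *)
From HB Require Import structures.
From mathcomp Require Import all_boot all_order all_algebra.
From mathcomp Require Import complex.
From mathcomp Require Import all_classical all_reals all_analysis.
Set Implicit Arguments.
Unset Strict Implicit.
Unset Printing Implicit Defensive.
Import Order.TTheory GRing.Theory Num.Theory.
Import numFieldNormedType.Exports.
Local Open Scope classical_set_scope.
Local Open Scope ring_scope.

(* The product sigma-algebra on row vectors, generated by the coordinates; over
   R it is the Borel sigma-algebra. *)
Section measurable_rV.
Context {d} {T : sigmaRingType d}.
Variable n : nat.

Let coords : 'I_n -> 'rV[T]_n -> T := fun i x => x ord0 i.

Let rV_set0 : g_sigma_preimage coords set0.
Proof. exact: sigma_algebra0. Qed.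

Let rV_setC A : g_sigma_preimage coords A -> g_sigma_preimage coords (~` A).
Proof. exact: sigma_algebraC. Qed.

Let rV_bigcup (F : _^nat) : (forall i, g_sigma_preimage coords (F i)) ->
  g_sigma_preimage coords (\bigcup_i (F i)).
Proof. exact: sigma_algebra_bigcup. Qed.

HB.instance Definition _ := @isMeasurable.Build (measure_tuple_display d)
  'rV[T]_n (g_sigma_preimage coords) rV_set0 rV_setC rV_bigcup.

End measurable_rV.

Lemma measurable_coord d (T : sigmaRingType d) n (i : 'I_n) :
  measurable_fun [set: 'rV[T]_n] (fun x => x ord0 i).
Proof.
move=> _ Y mY; rewrite setTI; apply: sub_sigma_algebra => /=.
rewrite -bigcup_seq/=; exists i => /=; first by rewrite mem_index_enum.
by exists Y => //; rewrite setTI.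
Qed.

Lemma measurable_fun_rV d d' (S : measurableType d) (T : measurableType d') n
    (f : S -> 'rV[T]_n) :
  (forall i, measurable_fun [set: S] (fun s => f s ord0 i)) ->
  measurable_fun [set: S] f.
Proof.
move=> mf; apply: (measurability
  (\big[setU/set0]_(i < n) preimage_set_system setT
     (fun x : 'rV[T]_n => x ord0 i) measurable)) => // _ [B + <-].
rewrite -bigcup_seq => -[i _ [C mC <-]].
by rewrite setTI; exact: mf.
Qed.

Definition consrV {R : realType} n (x : measurableTypeR R * 'rV[R]_n)
    : 'rV[R]_n.+1 :=
  row_mx (x.1 : R)%:M x.2.

Definition unconsrV {R : realType} n (x : 'rV[R]_n.+1)
    : measurableTypeR R * 'rV[R]_n :=
  (x ord0 ord0, rsubmx (x : 'rV_(1 + n))).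

Lemma consrVK {R : realType} n : cancel (@consrV R n) (@unconsrV R n).
Proof.
move=> [x v]; congr pair; last exact: row_mxKr.
transitivity ((row_mx (x : R)%:M v : 'rV_(1 + n)) ord0 (lshift n ord0)).
  by congr (fun_of_matrix _ _ _); exact/val_inj.
by rewrite row_mxEl mxE.
Qed.

Lemma measurable_consrV {R : realType} n : measurable_fun setT (@consrV R n).
Proof.
apply: measurable_fun_rV => i; case: (@split_ordP 1 n i) => j ->.
  rewrite (_ : (fun _ => _) = (fst : measurableTypeR R * 'rV[R]_n -> R)).
    exact: measurable_fst.
  apply/funext => x; apply: etrans (row_mxEl _ _ _ _) _.
  by rewrite mxE (ord1 j).
rewrite (_ : (fun _ => _) = (fun v : 'rV[R]_n => v ord0 j) \o snd).
  by apply: measurableT_comp; [exact: measurable_coord|exact: measurable_snd].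
by apply/funext => x; exact: row_mxEr.
Qed.

Lemma measurable_unconsrV {R : realType} n :
  measurable_fun setT (@unconsrV R n).
Proof.
apply: measurable_fun_pair => /=; first exact: measurable_coord.
apply: measurable_fun_rV => i.
rewrite (_ : (fun _ => _) = (fun v : 'rV[R]_n.+1 => v ord0 (rshift 1 i))).
  exact: measurable_coord.
by apply/funext => x; rewrite mxE.
Qed.

Section lebesgue_cons.
Context {R : realType} (n : nat).
Variable m : {sigma_finite_measure set 'rV[R]_n -> \bar R}.

Definition lebesgue_cons : set 'rV[R]_n.+1 -> \bar R :=
  pushforward (@lebesgue_measure R \x m)%E (@consrV R n).

Let lebesgue_cons0 : lebesgue_cons set0 = 0%E.
Proof. by rewrite /lebesgue_cons /pushforward preimage_set0 measure0. Qed.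

Let lebesgue_cons_ge0 A : (0 <= lebesgue_cons A)%E.
Proof. by rewrite /lebesgue_cons /pushforward. Qed.

Let lebesgue_cons_sigma_additive : semi_sigma_additive lebesgue_cons.
Proof.
move=> F mF tF mUF; rewrite /lebesgue_cons /pushforward preimage_bigcup.
apply: measure_semi_sigma_additive.
- by move=> k; rewrite -[X in measurable X]setTI; exact: measurable_consrV.
- apply/trivIsetP => /= i j _ _ ij; rewrite -preimage_setI.
  by move/trivIsetP : tF => /(_ _ _ _ _ ij) ->//; rewrite preimage_set0.
- rewrite -preimage_bigcup -[X in measurable X]setTI.
  exact: measurable_consrV.
Qed.

HB.instance Definition _ := isMeasure.Build _ _ _ lebesgue_cons
  lebesgue_cons0 lebesgue_cons_ge0 lebesgue_cons_sigma_additive.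

Let lebesgue_cons_sigma_finite : sigma_finite setT lebesgue_cons.
Proof.
have /sigma_finiteP[F [TF ndF Foo]] := sigma_finiteT (@lebesgue_measure R).
have /sigma_finiteP[G [TG ndG Goo]] := sigma_finiteT m.
exists (fun k => @unconsrV R n @^-1` (F k `*` G k)).
  apply/seteqP; split => // x _.
  have [i _ Fi] : (\bigcup_k F k) (unconsrV x).1 by rewrite -TF.
  have [j _ Gj] : (\bigcup_k G k) (unconsrV x).2 by rewrite -TG.
  exists (maxn i j) => //; split.
    by move: Fi; exact/subsetPset/ndF/leq_maxl.
  by move: Gj; exact/subsetPset/ndG/leq_maxr.
move=> k; have [mF Fy] := Foo k; have [mG Gy] := Goo k; split.
  rewrite -[X in measurable X]setTI; apply: measurable_unconsrV => //.
  exact: measurableX.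
rewrite /lebesgue_cons /pushforward -comp_preimage.
rewrite (_ : _ \o _ = id); last exact/funext/consrVK.
by rewrite preimage_id product_measure1E// lte_mul_pinfty// ge0_fin_numE.
Qed.

HB.instance Definition _ := Measure_isSigmaFinite.Build _ _ _ lebesgue_cons
  lebesgue_cons_sigma_finite.

End lebesgue_cons.

(* n-dimensional Lebesgue measure: the n-fold product of the one-dimensional
   one, transported to row vectors. *)
Fixpoint lebesgue_rV (R : realType) (n : nat)
    : {sigma_finite_measure set 'rV[R]_n -> \bar R} :=
  match n with
  | 0%N => \d_(0 : 'rV[R]_0)
  | n.+1 => lebesgue_cons (lebesgue_rV R n)
  end.

Section euclidean.
Context {R : realType} {n : nat}.
Implicit Types (x y nu : 'rV[R]_n) (S D : set 'rV[R]_n).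

Definition inner x y : R := \sum_(i < n) x ord0 i * y ord0 i.

(* The norm `|x| of the library on row vectors is the sup norm. *)
Definition enorm x : R := Num.sqrt (inner x x).

Definition domain D := [/\ D !=set0, open D & connected D].

Definition boundary D : set 'rV[R]_n := closure D `\` interior D.

Definition C1_near k (h : 'rV[R]_k -> R) (u : 'rV[R]_k) :=
  \forall w \near u,
    differentiable h w /\ forall v, {for w, continuous ('D_v h)}.

(* The rows of U and e form an orthonormal basis of R^n; in the corresponding
   coordinates (y *m U^T, inner y e), S is near x the graph of h. *)
Definition C1_graph_at S x :=
  exists (U : 'M[R]_(n.-1, n)) (e : 'rV[R]_n) (h : 'rV[R]_n.-1 -> R),
    [/\ U *m U^T = 1%:M, enorm e = 1, U *m e^T = 0,
        C1_near h (x *m U^T) &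
        \forall y \near x, S y <-> inner y e = h (y *m U^T)].

Definition C1_boundary D := forall x, boundary D x -> C1_graph_at (boundary D) x.

Definition tangent S x (v : 'rV[R]_n) :=
  exists gamma : R -> 'rV[R]_n,
    [/\ gamma 0 = x, \forall t \near (0 : R), S (gamma t) &
        is_derive (0 : R) 1 gamma v].

Definition outer_unit_normal D x nu :=
  [/\ enorm nu = 1,
      forall v, tangent (boundary D) x v -> inner v nu = 0 &
      \forall t \near (0 : R)^'+, D (x - t *: nu) /\ ~ D (x + t *: nu)].

Definition modulus S (f : 'rV[R]_n -> 'rV[R]_n) (delta : R) : R :=
  sup [set s | exists x y,
    [/\ S x, S y, enorm (x - y) <= delta & s = enorm (f x - f y)]].

(* At each boundary point of a bounded D with C^1 boundary the outer unit
   normal exists and is unique; only the values of nu on the boundary matter. *)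
Definition C1omega_boundary (omega : R -> R) D :=
  C1_boundary D /\
  exists nu : 'rV[R]_n -> 'rV[R]_n,
    (forall x, boundary D x -> outer_unit_normal D x (nu x)) /\
    modulus (boundary D) nu =O_ ((0 : R)^'+) omega.

End euclidean.

Section fourier.
Context {R : realType} {n : nat}.
Local Notation C := R[i].
Local Notation E := 'rV[R]_n.
Local Notation mu := (lebesgue_rV R n).
Implicit Types (f phi psi : E -> C) (u : (E -> C) -> C).

Definition cintegral f : C :=
  ((\int[mu]_x complex.Re (f x))%R +i* (\int[mu]_x complex.Im (f x))%R)%C.

Definition cis (t : R) : C := (cos t +i* sin t)%C.

Definition fourier f (xi : E) : C :=
  cintegral (fun t => f t * cis (- inner xi t)).

(* Multi-indices are encoded as lists of coordinates. *)
Definition monomial (a : seq 'I_n) (x : E) : R := \prod_(i <- a) x ord0 i.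

Definition partial (b : seq 'I_n) (g : E -> R) : E -> R :=
  foldr (fun i h => 'D_(delta_mx ord0 i) h) g b.

Definition smooth (g : E -> R) := forall b : seq 'I_n,
  continuous (partial b g) /\
  forall i x, derivable (partial b g) x (delta_mx ord0 i).

Definition schwartz_bound (N : nat) (M : R) phi :=
  forall a b : seq 'I_n, (size a <= N)%N -> (size b <= N)%N -> forall x,
    `|monomial a x * partial b (fun y => complex.Re (phi y)) x| <= M /\
    `|monomial a x * partial b (fun y => complex.Im (phi y)) x| <= M.

Definition schwartz phi :=
  [/\ smooth (fun x => complex.Re (phi x)),
      smooth (fun x => complex.Im (phi x)) &
      forall N, exists M, schwartz_bound N M phi].

(* A distribution is represented by a functional on all functions, of which
   only the values on Schwartz functions are meaningful. *)
Definition tempered u :=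
  (forall (c : C) phi psi, schwartz phi -> schwartz psi ->
     u (fun x => c * phi x + psi x) = c * u phi + u psi) /\
  exists (N : nat) (K : R), forall phi, schwartz phi ->
    forall M, schwartz_bound N M phi -> Normc.normc (u phi) <= K * M.

Definition distr_of_fun f : (E -> C) -> C :=
  fun phi => cintegral (fun x => f x * phi x).

Definition fourier_distr u : (E -> C) -> C := fun phi => u (fourier phi).

Definition Lp (p : \bar R) f :=
  [/\ measurable_fun setT (fun x => complex.Re (f x)),
      measurable_fun setT (fun x => complex.Im (f x)) &
      finite_norm mu p (fun x => Normc.normc (f x))].

Definition A_space (p : \bar R) u :=
  tempered u /\
  exists2 g, Lp p g &
    forall phi, schwartz phi -> fourier_distr u phi = distr_of_fun g phi.

Definition char_fun (D : set E) : E -> C := fun x => (\1_D x)%:C%C.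

End fourier.

(* x ^ r for x >= 0, with 0 ^ r = 1/0 = +oo for r < 0, where the library's
   powR has 0 `^ r = 0. *)
Definition epow {R : realType} (x r : R) : \bar R :=
  if (x == 0) && (r < 0) then +oo%E else (x `^ r)%:E.

(* Main.v *)
(* Write n = d + 1, and let g be the Fourier transform of 1_D.  For a scale r, an
   integer q and a direction theta = (1, v) with v in {0, 1/q, ..., (q-1)/q}^d,
   the Schwartz function psi below lives on a tube of width 1/r around the line
   spanned by theta, at frequencies of order q/r; its Fourier transform has width
   r/q along theta and r across.  Let x0 be a point of the boundary where
   (., theta) is maximal on D, so that theta is normal at x0.  If the normal
   varies by at most 1/q at scale r, then D is so close to a half-space near x0
   that the sine transform of psi, centred at x0, has an integral over D bounded
   away from 0, uniformly in r and theta.  By duality and Holder this gives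
     int |g|^p |psi| >= c (r^n / q)^(p-1).
   The functions |psi|, summed over the q^d directions and over dyadic scales
   r_k with q_k nondecreasing, stay bounded, because the tubes are essentially
   disjoint.  Hence sum_k q_k^d (r_k^n / q_k)^(p-1) <= C int |g|^p < oo, and for
   q_k of order 1/omega(r_k) this is the dyadic form of the integral.  For p >= n
   the integral converges in any case. *)
Require Import Defs.
From mathcomp Require Import all_boot all_order all_algebra.
From mathcomp Require Import complex.
From mathcomp Require Import all_classical all_reals all_analysis.
From mathcomp Require Import measurable_realfun gauss_integral ring lra.
Set Implicit Arguments.
Unset Strict Implicit.
Unset Printing Implicit Defensive.
Import Order.TTheory GRing.Theory Num.Theory.
Import numFieldNormedType.Exports.
Local Open Scope classical_set_scope.
Local Open Scope ring_scope.

(** * Absolutely convergent integrals with a given value *)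

(** All tubes of one scale cross at the origin, so the profile along a tube has to vanish there to
    high order. An even profile of this kind is useless: its cosine transform is even with integral
    0, hence has integral 0 over a half-line as well, and the pairing with a half-space would
    vanish. An odd profile [f] works, because its sine transform integrates over the negative
    half-line to minus the integral of [f t / t], which is positive for the profile chosen. On the
    hyperplane where the first coordinate is [s], the axes of neighbouring tubes are [|s| / q] apart
    and the tubes have width of order [1 / r]. With [t = r |s| / q], a point thus meets about
    [(1 + 1 / t)^d] tubes, and the sum over the grid is at most of order [t / (1 + t)^2]. As [r_k]
    is halved and [q_k] does not decrease, [t] at least halves from one scale to the next, and the
    sum over all scales is bounded; this is what monotonicity of [q_k] is for. Duality is applied
    through a pointwise inequality with a free parameter in place of Holder's inequality, which
    includes [p = 1] without a separate case. *)

Section has_integral.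
Context d (T : measurableType d) (R : realType).
Variable mu : {measure set T -> \bar R}.
Implicit Types (f g : T -> R) (a b c : R).

(** Absolute integrability and a real value are kept together, so that linearity, comparison and
    iterated integration become statements about real numbers, without finiteness side
    conditions. *)
Definition has_integral f c :=
  mu.-integrable setT (EFin \o f) /\ (\int[mu]_x (f x)%:E = c%:E)%E.

Lemma has_integral_measurable f c : has_integral f c -> measurable_fun setT f.
Proof. by move=> [/measurable_int /measurable_EFinP]. Qed.

Lemma has_integral_Rintegral f :
  mu.-integrable setT (EFin \o f) -> has_integral f (\int[mu]_x f x)%R.
Proof.
move=> If; split => //; rewrite /Rintegral fineK//.
exact: integrable_fin_num.
Qed.

Lemma has_integral_RintegralE f c : has_integral f c -> (\int[mu]_x f x)%R = c.
Proof. by move=> [_ fc]; rewrite /Rintegral fc. Qed.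

Lemma has_integral_unique f a b : has_integral f a -> has_integral f b -> a = b.
Proof. by move=> /has_integral_RintegralE <- /has_integral_RintegralE. Qed.

Lemma has_integral0 : has_integral (cst 0) 0.
Proof. by split; [exact: integrable0|rewrite integral0]. Qed.

Lemma has_integralD f g a b : has_integral f a -> has_integral g b ->
  has_integral (fun x => f x + g x) (a + b).
Proof.
move=> [If fa] [Ig gb]; split.
  by rewrite (_ : _ \o _ = (EFin \o f) \+ (EFin \o g))%E//; exact: integrableD.
under eq_integral do rewrite EFinD.
by rewrite (integralD measurableT If Ig) fa gb.
Qed.

Lemma has_integralZ f a k : has_integral f a ->
  has_integral (fun x => k * f x) (k * a).
Proof.
move=> [If fa]; split.
  by rewrite (_ : _ \o _ = (fun x => k%:E * (EFin \o f) x)%E)//; exact: integrableZl.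
under eq_integral do rewrite EFinM.
by rewrite (integralZl measurableT If) fa.
Qed.

Lemma has_integralN f a : has_integral f a ->
  has_integral (fun x => - f x) (- a).
Proof.
move=> /(@has_integralZ _ _ (-1)); rewrite mulN1r.
by under eq_fun do rewrite mulN1r.
Qed.

Lemma has_integralB f g a b : has_integral f a -> has_integral g b ->
  has_integral (fun x => f x - g x) (a - b).
Proof. by move=> fa gb; apply: has_integralD => //; exact: has_integralN. Qed.

Lemma has_integral_sum I (s : seq I) (f : I -> T -> R) (c : I -> R) :
  (forall i, has_integral (f i) (c i)) ->
  has_integral (fun x => \sum_(i <- s) f i x) (\sum_(i <- s) c i).
Proof.
move=> fc; elim: s => [|i s IH].
  by rewrite big_nil; under eq_fun do rewrite big_nil; exact: has_integral0.
rewrite big_cons; under eq_fun do rewrite big_cons.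
exact: has_integralD.
Qed.

Lemma has_integral_le f g a b : has_integral f a -> has_integral g b ->
  (forall x, f x <= g x) -> a <= b.
Proof.
move=> [If fa] [Ig gb] fg; rewrite -lee_fin -fa -gb.
by apply: le_integral => // x _; rewrite lee_fin.
Qed.

Lemma has_integral_ge0 f a : has_integral f a -> (forall x, 0 <= f x) -> 0 <= a.
Proof. by move=> fa f0; apply: has_integral_le has_integral0 fa _. Qed.

Lemma has_integral_abs f a : has_integral f a ->
  exists2 b, has_integral (fun x => `|f x|) b & `|a| <= b.
Proof.
move=> fa; have [If _] := fa.
have fb : has_integral (fun x => `|f x|) (\int[mu]_x `|f x|)%R.
  apply: has_integral_Rintegral; exact: integrable_norm.
exists (\int[mu]_x `|f x|)%R => //; rewrite ler_norml; apply/andP; split.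
  by rewrite lerNl; apply: has_integral_le (has_integralN fa) fb _ => x; rewrite -normrN ler_norm.
by apply: has_integral_le fa fb _ => x; exact: ler_norm.
Qed.

Lemma has_integral_dom f g b : measurable_fun setT f -> has_integral g b ->
  (forall x, `|f x| <= g x) -> exists2 a, has_integral f a & `|a| <= b.
Proof.
move=> mf [Ig gb] fg.
have If : mu.-integrable setT (EFin \o f).
  apply: (le_integrable _ _ _ Ig) => //=; first exact/measurable_EFinP.
  by move=> x _; rewrite lee_fin (le_trans (fg x))// ler_norm.
have [c hc lc] := has_integral_abs (has_integral_Rintegral If).
exists (\int[mu]_x f x)%R; first exact: has_integral_Rintegral.
exact: le_trans lc (has_integral_le hc (conj Ig gb) fg).
Qed.

Lemma ge0_has_integral f c : measurable_fun setT f -> (forall x, 0 <= f x) ->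
  (\int[mu]_x (f x)%:E = c%:E)%E -> has_integral f c.
Proof.
move=> mf f0 fc; split => //; apply/integrableP; split; first exact/measurable_EFinP.
rewrite (_ : integral _ _ _ = c%:E) ?ltry// -fc.
by apply: eq_integral => x _ /=; rewrite ger0_norm.
Qed.

Lemma has_integral_indic (D : set T) c : measurable D -> mu D = c%:E ->
  has_integral (\1_D : T -> R) c.
Proof.
move=> mD Dc; apply: ge0_has_integral => //.
by rewrite integral_indic// setIT.
Qed.

End has_integral.

Lemma eq_has_integral d (T : measurableType d) (R : realType)
    (mu : {measure set T -> \bar R}) (f g : T -> R) (a b : R) :
  has_integral mu f a -> f =1 g -> a = b -> has_integral mu g b.
Proof. by move=> fa /funext <- <-. Qed.

(** Nonnegative functions are covered by the change of variables for image measures; a general [f]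
    is the difference of the nonnegative functions [|f|] and [|f| - f]. *)
Lemma has_integral_pushforward d1 d2 (X : measurableType d1)
    (Y : measurableType d2) (R : realType) (phi : X -> Y)
    (mu : {measure set X -> \bar R}) (nu : {measure set Y -> \bar R})
    (f : Y -> R) (c k : R) :
  measurable_fun setT phi -> 0 < k ->
  (forall A, measurable A -> mu (phi @^-1` A) = (k%:E * nu A)%E) ->
  has_integral nu f c -> has_integral mu (f \o phi) (k * c).
Proof.
move=> mphi k0 H.
have ge0 (g : Y -> R) b : (forall x, 0 <= g x) -> has_integral nu g b ->
    has_integral mu (g \o phi) (k * b).
  move=> g0 gb; have mg := has_integral_measurable gb; have [_ igb] := gb.
  apply: ge0_has_integral.
  - exact: measurableT_comp.
  - by move=> x; exact: g0.
  have : (\int[pushforward mu phi]_y (g y)%:E = (k * b)%:E)%E.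
    rewrite (eq_measure_integral (mscale (NngNum (ltW k0)) nu)).
      rewrite ge0_integral_mscale//=.
      + by rewrite igb EFinM.
      + exact/measurable_EFinP.
      + by move=> x _; rewrite lee_fin.
    by move=> A mA _; rewrite /= /pushforward H.
  rewrite ge0_integral_pushforward//=; first exact/measurable_EFinP.
  by move=> y _; rewrite lee_fin.
move=> fc; have [b fb _] := has_integral_abs fc.
have h1 := ge0 _ _ (fun x => normr_ge0 (f x)) fb.
have h2 := ge0 (fun x => `|f x| - f x) (b - c) _ (has_integralB fb fc).
apply: (eq_has_integral (has_integralB h1 (h2 _))).
- by move=> x; rewrite subr_ge0 ler_norm.
- by move=> x /=; rewrite subKr.
- by rewrite -mulrBr subKr.
Qed.

(** For positive slope this is uniqueness of the measure with given values on the intervals []u,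
    v]]. A negative slope would exchange open and closed ends, so it is reduced to a positive one by
    invariance under reflection. *)
Lemma lebesgue_measure_affine (R : realType) (a c : R) (A : set R) :
  a != 0 -> measurable A ->
  lebesgue_measure ((fun x : R => a * x + c) @^-1` A) =
    (`|a|^-1%:E * lebesgue_measure A)%E.
Proof.
have pos (k : R) B : 0 < k -> measurable B ->
    lebesgue_measure ((fun x : R => k * x + c) @^-1` B) =
      (k^-1%:E * lebesgue_measure B)%E.
  move=> k0 mB; have mphi : measurable_fun setT (fun x : R => k * x + c).
    by apply: measurable_funD => //; exact: measurable_funM.
  have kN : 0 <= k by exact: ltW.
  have key := @lebesgue_measure_unique R
    (mscale (NngNum kN) (pushforward lebesgue_measure
       (fun x : measurableTypeR R => k * x + c : measurableTypeR R))).
  rewrite [in RHS](key mphi)//= /mscale/= /pushforward.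
    by rewrite muleA -EFinM mulVf ?gt_eqF// mul1e.
  move=> _ [[u v]] _ <-; rewrite /mscale/= /pushforward/=.
  rewrite (_ : _ @^-1` _ = `](u - c) / k, (v - c) / k]%classic); last first.
    apply/seteqP; split => x /=; rewrite !in_itv/=;
      by rewrite ltr_pdivrMr// ler_pdivlMr// ltrBlDr lerBrDr mulrC.
  rewrite !lebesgue_measure_itv/= !lte_fin ltr_pM2r ?invr_gt0// ltrD2r.
  case: ifPn => _; last by rewrite mule0.
  by rewrite -!EFinD -EFinM; congr _%:E; field; rewrite gt_eqF.
move=> a0 mA; have [ap|an] := ltP 0 a; first by rewrite pos ?gtr0_norm.
rewrite ler0_norm//.
have al0 : 0 < - a by rewrite oppr_gt0 lt_neqAle a0.
have mphi : measurable_fun setT (fun x : R => - a * x + c).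
  by apply: measurable_funD => //; exact: measurable_funM.
rewrite -pos//.
have mB : measurable ((fun x : R => - a * x + c) @^-1` A).
  by rewrite -[X in measurable X]setTI; exact: mphi.
rewrite -(lebesgue_measureN mB) /pushforward; congr (lebesgue_measure _).
by apply/funext => x; rewrite /preimage/= mulrNN.
Qed.

Lemma has_integral_affine (R : realType) (f : R -> R) (a c k : R) : a != 0 ->
  has_integral lebesgue_measure f k ->
  has_integral lebesgue_measure (fun x => f (a * x + c)) (`|a|^-1 * k).
Proof.
move=> a0.
have mphi : measurable_fun setT (fun x : R => a * x + c).
  by apply: measurable_funD => //; exact: measurable_funM.
apply: (@has_integral_pushforward _ _ (measurableTypeR R) (measurableTypeR R) R
  (fun x : R => a * x + c) lebesgue_measure lebesgue_measure f k _ mphi).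
- by rewrite invr_gt0 normr_gt0.
- by move=> A mA; exact: lebesgue_measure_affine.
Qed.

(** Joint integrability, which Fubini's theorem needs for a signed [f], comes from the majorant
    [g]. *)
Lemma has_integral_prod12 d1 d2 (T1 : measurableType d1) (T2 : measurableType d2)
    (R : realType) (m1 : {sigma_finite_measure set T1 -> \bar R})
    (m2 : {sigma_finite_measure set T2 -> \bar R})
    (f g : T1 * T2 -> R) (F : T1 -> R) (b c : R) :
  measurable_fun setT f -> has_integral (m1 \x m2)%E g b ->
  (forall z, `|f z| <= g z) ->
  (forall x, has_integral m2 (fun y => f (x, y)) (F x)) -> has_integral m1 F c ->
  has_integral (m1 \x m2)%E f c.
Proof.
move=> mf gb fg fF [_ Fc]; have [a [If fa] _] := has_integral_dom mf gb fg.
split => //; rewrite -integral12_prod_meas1// -Fc.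
by apply: eq_integral => x _; have [_] := fF x.
Qed.

Lemma has_integral_prod21 d1 d2 (T1 : measurableType d1) (T2 : measurableType d2)
    (R : realType) (m1 : {sigma_finite_measure set T1 -> \bar R})
    (m2 : {sigma_finite_measure set T2 -> \bar R})
    (f g : T1 * T2 -> R) (F : T2 -> R) (b c : R) :
  measurable_fun setT f -> has_integral (m1 \x m2)%E g b ->
  (forall z, `|f z| <= g z) ->
  (forall y, has_integral m1 (fun x => f (x, y)) (F y)) -> has_integral m2 F c ->
  has_integral (m1 \x m2)%E f c.
Proof.
move=> mf gb fg fF [_ Fc]; have [a [If fa] _] := has_integral_dom mf gb fg.
split => //; rewrite -integral21_prod_meas1// -Fc.
by apply: eq_integral => x _; have [_] := fF x.
Qed.

Lemma ge0_has_integral_prod12 d1 d2 (T1 : measurableType d1) (T2 : measurableType d2)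
    (R : realType) (m1 : {sigma_finite_measure set T1 -> \bar R})
    (m2 : {sigma_finite_measure set T2 -> \bar R})
    (f : T1 * T2 -> R) (F : T1 -> R) (c : R) :
  measurable_fun setT f -> (forall z, 0 <= f z) ->
  (forall x, has_integral m2 (fun y => f (x, y)) (F x)) -> has_integral m1 F c ->
  has_integral (m1 \x m2)%E f c.
Proof.
move=> mf f0 fF [_ Fc]; apply: ge0_has_integral => //.
rewrite (fubini_tonelli1 (EFin \o f))//; last exact/measurable_EFinP.
by rewrite -Fc; apply: eq_integral => x _; have [_] := fF x.
Qed.

Lemma ge0_has_integral_prod21 d1 d2 (T1 : measurableType d1) (T2 : measurableType d2)
    (R : realType) (m1 : {sigma_finite_measure set T1 -> \bar R})
    (m2 : {sigma_finite_measure set T2 -> \bar R})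
    (f : T1 * T2 -> R) (F : T2 -> R) (c : R) :
  measurable_fun setT f -> (forall z, 0 <= f z) ->
  (forall y, has_integral m1 (fun x => f (x, y)) (F y)) -> has_integral m2 F c ->
  has_integral (m1 \x m2)%E f c.
Proof.
move=> mf f0 fF [_ Fc]; apply: ge0_has_integral => //.
rewrite (fubini_tonelli2 (EFin \o f))//; last exact/measurable_EFinP.
by rewrite -Fc; apply: eq_integral => x _; have [_] := fF x.
Qed.

(** * Integrals of products and of sheared products on row vectors *)

Section rV_integral.
Context {R : realType}.
Implicit Types (n : nat) (c : R).

Lemma unconsrVK n : cancel (@unconsrV R n) (@consrV R n).
Proof.
move=> x; apply/rowP => i; case: (@split_ordP 1 n i) => j ->.
  apply: etrans (row_mxEl _ _ _ _) _; rewrite !mxE ord1 eqxx mulr1n.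
  by congr (x _ _); exact/val_inj.
by apply: etrans (row_mxEr _ _ _ _) _; rewrite !mxE.
Qed.

Lemma consrV_head n (z : measurableTypeR R * 'rV[R]_n) : consrV z ord0 ord0 = z.1.
Proof. by rewrite -[in RHS](consrVK z). Qed.

Lemma consrV_tail n (z : measurableTypeR R * 'rV[R]_n) i :
  consrV z ord0 (lift ord0 i) = z.2 ord0 i.
Proof.
rewrite -[in RHS](consrVK z) [RHS]mxE; congr (consrV z _ _).
exact/val_inj.
Qed.

Lemma has_integral_consrV n (f : 'rV[R]_n.+1 -> R) c :
  has_integral (lebesgue_measure \x lebesgue_rV R n)%E (f \o @consrV R n) c ->
  has_integral (lebesgue_rV R n.+1) f c.
Proof.
move=> fc; have : has_integral (lebesgue_rV R n.+1) ((f \o @consrV R n) \o @unconsrV R n) (1 * c).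
  apply: has_integral_pushforward fc => //; first exact: measurable_unconsrV.
  move=> A mA; rewrite /= /lebesgue_cons /pushforward -comp_preimage mul1e.
  by rewrite (_ : _ \o _ = id)//; exact/funext/consrVK.
move/eq_has_integral; apply; last by rewrite mul1r.
by move=> x /=; rewrite unconsrVK.
Qed.

(** For a fixed tail the head variable is only translated, by [L] of the tail, so the inner integral
    does not see the shear. *)
Lemma has_integral_shear n (h : R -> R) (k : 'I_n -> R -> R) (L : 'rV[R]_n -> R)
    c (kc : 'I_n -> R) : measurable_fun setT L ->
  has_integral lebesgue_measure h c ->
  has_integral (lebesgue_rV R n) (fun x => \prod_j k j (x ord0 j)) (\prod_j kc j) ->
  has_integral (lebesgue_rV R n.+1)
    (fun x => h (x ord0 ord0 + L (rsubmx (x : 'rV_(1 + n)))) *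
       \prod_j k j (x ord0 (lift ord0 j))) (c * \prod_j kc j).
Proof.
move=> mL hc kkc; apply: has_integral_consrV => /=.
pose f (h' : R -> R) (p : 'rV[R]_n -> R) (z : measurableTypeR R * 'rV[R]_n) :=
  h' (z.1 + L z.2) * p z.2.
have mf h' p : measurable_fun setT h' -> measurable_fun setT p -> measurable_fun setT (f h' p).
  move=> mh' mp; apply: measurable_funM => /=; last first.
    by apply: measurableT_comp mp _; exact: measurable_snd.
  apply: measurableT_comp mh' _; apply: measurable_funD.
    exact: measurable_fst.
  by apply: measurableT_comp mL _; exact: measurable_snd.
have inner h' p b y : has_integral lebesgue_measure h' b ->
    has_integral lebesgue_measure (fun x => f h' p (x, y)) (p y * b).
  move=> hb; have := has_integralZ (p y) (has_integral_affine (L y) (oner_neq0 _) hb).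
  move/eq_has_integral; apply => [x|]; last by rewrite normr1 invr1 mul1r.
  by rewrite /f /= mul1r mulrC.
have mh := has_integral_measurable hc.
have mk := has_integral_measurable kkc.
have [b hb _] := has_integral_abs hc.
have [b' kb _] := has_integral_abs kkc.
apply: (eq_has_integral (f := f h (fun x => \prod_j k j (x ord0 j))) (a := c * \prod_j kc j)) => //; last first.
  move=> z; rewrite /f /= consrV_head; congr (h (_ + L _) * _).
    by have := consrVK z; case: (z) => ? ? [_].
  by apply: eq_bigr => j _; rewrite consrV_tail.
pose p (x : 'rV[R]_n) := \prod_j k j (x ord0 j).
pose h1 x := `|h x|; pose p1 (x : 'rV[R]_n) := `|p x|.
have mf1 : measurable_fun setT (f h1 p1).
  by apply: mf; rewrite ?/h1 ?/p1; exact: measurableT_comp.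
have gb : has_integral (lebesgue_measure \x lebesgue_rV R n)%E (f h1 p1) (b * b').
  apply: (ge0_has_integral_prod21 (F := fun y => p1 y * b) mf1).
  + by move=> z; rewrite /f /h1 /p1 mulr_ge0.
  + by move=> y; exact: inner.
  + by under eq_fun do rewrite mulrC; exact: has_integralZ.
apply: (has_integral_prod21 (F := fun y => p y * c) _ gb).
- exact: mf.
- by move=> z; rewrite /f normrM.
- by move=> y; exact: inner.
- by under eq_fun do rewrite mulrC; exact: has_integralZ.
Qed.

Lemma has_integral_prod n (k : 'I_n -> R -> R) (kc : 'I_n -> R) :
  (forall j, has_integral lebesgue_measure (k j) (kc j)) ->
  has_integral (lebesgue_rV R n) (fun x => \prod_j k j (x ord0 j)) (\prod_j kc j).
Proof.
elim: n k kc => [|n IH] k kc kkc.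
  rewrite big_ord0; under eq_fun do rewrite big_ord0.
  split; last by rewrite /= integral_dirac// diracT mul1e.
  by apply: finite_measure_integrable_cst.
rewrite big_ord_recl; under eq_fun do rewrite big_ord_recl.
have := @has_integral_shear n _ (fun j => k (lift ord0 j)) (cst 0) _ (fun j => kc (lift ord0 j))
  (measurable_cst _) (kkc ord0) (IH _ _ (fun j => kkc (lift ord0 j))).
by under eq_fun do rewrite addr0.
Qed.

(** The opposite shear: the transverse factor moves with the head coordinate while its integral [K]
    does not, as for a tube around a slanted line. *)
Lemma has_integral_shear_tail n (h : R -> R) (g : R -> 'rV[R]_n -> R) c K :
  has_integral lebesgue_measure h c ->
  measurable_fun setT (fun x : 'rV[R]_n.+1 =>
    g (x ord0 ord0) (rsubmx (x : 'rV_(1 + n)))) ->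
  (forall s z, 0 <= g s z) ->
  (forall s, has_integral (lebesgue_rV R n) (g s) K) ->
  has_integral (lebesgue_rV R n.+1)
    (fun x => h (x ord0 ord0) * g (x ord0 ord0) (rsubmx (x : 'rV_(1 + n)))) (c * K).
Proof.
move=> hc mg g0 gK; apply: has_integral_consrV.
have mgz : measurable_fun setT (fun z : measurableTypeR R * 'rV[R]_n => g z.1 z.2).
  rewrite (_ : (fun z => _) = (fun x : 'rV[R]_n.+1 =>
    g (x ord0 ord0) (rsubmx (x : 'rV_(1 + n)))) \o @consrV R n).
    by apply: measurableT_comp mg _; exact: measurable_consrV.
  by apply/funext => z /=; have := consrVK z; case: (z) => ? ? [-> ->].
have mf (h' : R -> R) : measurable_fun setT h' ->
    measurable_fun setT (fun z : measurableTypeR R * 'rV[R]_n => h' z.1 * g z.1 z.2).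
  move=> mh'; apply: measurable_funM mgz.
  by apply: measurableT_comp mh' _; exact: measurable_fst.
have mh := has_integral_measurable hc.
have [b hb _] := has_integral_abs hc.
apply: (eq_has_integral (f := fun z : measurableTypeR R * 'rV[R]_n => h z.1 * g z.1 z.2) (a := c * K)) => //; last first.
  by move=> z /=; have := consrVK z; case: (z) => ? ? [-> ->].
pose f (h' : R -> R) (z : measurableTypeR R * 'rV[R]_n) := h' z.1 * g z.1 z.2.
pose h1 x := `|h x|.
have mf1 : measurable_fun setT (f h1).
  by apply: mf; rewrite /h1; exact: measurableT_comp.
have gb : has_integral (lebesgue_measure \x lebesgue_rV R n)%E (f h1) (b * K).
  refine (@ge0_has_integral_prod12 _ _ _ _ R lebesgue_measure (lebesgue_rV R n) (f h1) (fun s : measurableTypeR R => h1 s * K) (b * K) mf1 _ _ _).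
  + by move=> z; rewrite /f /h1 mulr_ge0.
  + by move=> s; exact: (has_integralZ (h1 s) (gK s)).
  + by under eq_fun do rewrite mulrC; rewrite mulrC; exact: has_integralZ.
refine (has_integral_prod12 (F := fun s : measurableTypeR R => h s * K) _ gb _ _ _).
- exact: mf.
- by move=> z; rewrite /f normrM (ger0_norm (g0 _ _)).
- by move=> s; exact: (has_integralZ (h s) (gK s)).
- by under eq_fun do rewrite mulrC; rewrite mulrC; exact: has_integralZ.
Qed.

End rV_integral.

(** * The one-dimensional profile and its sine transform *)

Section gaussian_1d.
Context {R : realType}.
Local Notation mu := (@lebesgue_measure R).
Local Notation G := (@gauss_fun R).

(** The fundamental theorem of calculus on [[0, n]], followed by dominated convergence along the
    integers with majorant [|f|]. *)
Lemma has_integral_ray (F f : R -> R) (c : R) :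
  has_integral mu f c -> continuous f -> (forall x : R, is_derive x 1 F (f x)) ->
  F n%:R @[n --> \oo] --> (0 : R) ->
  has_integral mu (fun x => \1_`[0, +oo[ x * f x) (- F 0).
Proof.
move=> fc cf dF F0; have [If _] := fc; have mf := has_integral_measurable fc.
have [b bf _] := has_integral_abs fc.
have m1 (D : set R) : measurable D -> measurable_fun [set: measurableTypeR R] (fun x : R => \1_D x * f x).
  by move=> mD; apply: measurable_funM.
have l1 (D : set R) x : `|\1_D x * f x| <= `|f x|.
  by rewrite normrM ler_piMl// indicE; case: (_ \in _); rewrite ?normr1 ?normr0.
have [a fa _] := has_integral_dom (m1 `[0, +oo[%classic (measurable_itv _)) bf (l1 _).
apply: (eq_has_integral fa) => //.
pose f_ (n : nat) (x : R) := (\1_`[0, n%:R] x * f x)%:E.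
have H1 : (fun n => \int[mu]_x f_ n x)%E @ \oo --> a%:E.
  have [_ <-] := fa; apply: (@dominated_cvg _ _ _ mu setT measurableT f_ _ (fun x => `|f x|%:E)).
  - by move=> n; apply/measurable_EFinP; exact: m1.
  - move=> x _; apply: cvg_near_cst; near=> n; rewrite /f_; congr (_ * _)%:E.
    rewrite !indicE; congr (_%:R); congr nat_of_bool.
    apply/idP/idP => /set_mem; rewrite /= !in_itv/= ?andbT => x0; apply/mem_set; rewrite /= in_itv/= ?andbT.
      by case/andP: x0.
    rewrite x0/=; near: n; exact: nbhs_infty_ger.
  - by [].
  - by have [] := bf.
  - by move=> n x _; rewrite lee_fin.
have H2 : (fun n => \int[mu]_x f_ n x)%E @ \oo --> (- F 0)%:E.
  apply: (@cvg_trans _ ((F n%:R - F 0)%:E @[n --> \oo])); last first.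
    apply: cvg_EFin; first by near=> n.
    by rewrite -[X in _ --> X]add0r; apply: cvgB => //; exact: cvg_cst.
  apply: near_eq_cvg; near=> n.
  have n0 : 0 < n%:R :> R by rewrite ltr0n; near: n; exact: nbhs_infty_gt.
  have dF' (x : R) : derivable F x 1 by case: (dF x).
  have cF : continuous F by move=> x; apply/differentiable_continuous/derivable1_diffP/dF'.
  rewrite /f_ EFinB -(@continuous_FTC2 _ f F 0 n%:R n0).
  - rewrite [LHS]integral_mkcond; apply: eq_integral => x _.
    by rewrite patchE indicE; case: ifPn => _; rewrite ?mul1r ?mul0r.
  - exact: continuous_subspaceT.
  - split.
    + by move=> x _; exact: dF'.
    + by apply: cvg_at_right_filter; exact: cF.
    + by apply: cvg_at_left_filter; exact: cF.
  - by move=> x _; rewrite derive1E; case: (dF x).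
by apply: EFin_inj; exact: (cvg_unique (@ereal_hausdorff R) H1 H2).
Unshelve. all: by end_near. Qed.

Lemma has_integral_line (F f : R -> R) (c : R) :
  has_integral mu f c -> continuous f -> (forall x : R, is_derive x 1 F (f x)) ->
  F n%:R @[n --> \oo] --> (0 : R) -> F (- n%:R) @[n --> \oo] --> (0 : R) -> c = 0.
Proof.
move=> fc cf dF Fp Fn.
have h1 := has_integral_ray fc cf dF Fp.
have fcN : has_integral mu (fun x => - f (- x)) (- c).
  have n1 : (-1 : R) != 0 by rewrite oppr_eq0 oner_eq0.
  have := has_integralN (has_integral_affine 0 n1 fc).
  move/eq_has_integral; apply => [x|]; first by rewrite mulN1r addr0.
  by rewrite normrN1 invr1 mul1r.
have h2 := has_integral_ray (F := fun x => F (- x)) fcN.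
have {}h2 : has_integral mu (fun x => \1_`[0, +oo[ x * - f (- x)) (- F 0).
  have -> : - F 0 = - F (- 0) by rewrite oppr0.
  apply: h2 => //.
    move=> x; apply: cvgN; apply: (@continuous_comp _ _ _ -%R f).
      exact: oppr_continuous.
    exact: cf.
  move=> x; have dN : is_derive x 1 (-%R : R -> R) (-1) by exact: is_deriveNid.
  by have := is_derive1_comp (dF (- x)) dN; rewrite mulrN1.
have n1 : (-1 : R) != 0 by rewrite oppr_eq0 oner_eq0.
have h3 := has_integral_affine 0 n1 h2.
have h4 : has_integral mu (fun x => \1_`[0, +oo[ x * f x + - (\1_`[0, +oo[ (- x) * - f x)) 0.
  apply: (eq_has_integral (has_integralB h1 h3)).
    by move=> x; rewrite mulN1r addr0 opprK.
  by rewrite normrN1 invr1 mul1r subrr.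
(* The two closed rays overlap at 0; the value counted twice there is removed on a null set. *)
have h0 : has_integral mu (\1_[set 0]) 0.
  by apply: has_integral_indic; [exact: measurable_set1|exact: lebesgue_measure_set1].
apply: (has_integral_unique fc).
apply: (eq_has_integral (has_integralB h4 (has_integralZ (f 0) h0))).
  move=> x /=.
  have I1 (y : R) : \1_`[0, +oo[ y = (0 <= y)%R%:R :> R by rewrite indicE mem_setE in_itv/= andbT.
  have -> : \1_[set 0] x = (x == 0)%R%:R :> R.
    by rewrite indicE; congr (_%:R); congr nat_of_bool; apply/idP/eqP; rewrite inE.
  by rewrite !I1 oppr_ge0; case: (ltgtP x 0) => [x0|x0|->]; rewrite ?oppr0/=; ring.
by rewrite mulr0 subr0.
Qed.

Lemma has_integral_gauss : has_integral mu G (Num.sqrt pi).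
Proof. by split; [exact: integrableT_gauss|exact: integralT_gauss]. Qed.

(** Half of the exponent absorbs [|t|], since [|t| <= 1 + t^2 / 2 <= exp(t^2 / 2)]. *)
Lemma gauss_moment_bound (t : R) : `|t * G t| <= G (Num.sqrt 2^-1 * t).
Proof.
rewrite normrM (ger0_norm (gauss_fun_ge0 _)) /gauss_fun exprMn sqr_sqrtr ?invr_ge0//.
have -> : - t ^+ 2 = - (2^-1 * t ^+ 2) - 2^-1 * t ^+ 2 by field.
rewrite expRD mulrA ler_piMl ?expR_ge0//.
rewrite expRN ler_pdivrMr ?expR_gt0// mul1r.
apply: (le_trans _ (expR_ge1Dx _)).
have := sqr_ge0 (`|t| - 1); rewrite sqrrB1 real_normK ?num_real//; lra.
Qed.

Lemma has_integral_gauss_moment : exists2 b,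
  has_integral mu (fun t : R => `|t * G t|) b & 0 <= b.
Proof.
have s2 : Num.sqrt 2^-1 != 0 :> R by rewrite sqrtr_eq0 -ltNge invr_gt0.
have mf : measurable_fun [set: measurableTypeR R] (fun t : R => `|t * G t|).
  apply: measurableT_comp => //; apply: measurable_funM => //.
  exact: measurable_gauss_fun.
have [|a ah _] := has_integral_dom mf (has_integral_affine 0 s2 has_integral_gauss).
  by move=> x; rewrite normr_id addr0; exact: gauss_moment_bound.
by exists a => //; apply: has_integral_ge0 ah _.
Qed.

Lemma is_derive_gauss (t : R) : is_derive t 1 G (- (t * 2) * G t).
Proof.
have d1 : is_derive t 1 (fun t : R => - t ^+ 2) (- (t * 2)).
  by apply: is_derive_eq; rewrite /GRing.scale /=; ring.
by have := @is_derive1_comp R expR (fun t => - t ^+ 2) t _ _ (is_derive_expR _) d1; rewrite mulrC.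
Qed.

Lemma continuous_cos_scale (z : R) : continuous (fun t : R => cos (t * z)).
Proof.
move=> t; apply: (@continuous_comp _ _ _ (fun t : R => t * z) (@cos R)); last exact: continuous_cos.
by apply: cvgM => //; exact: cvg_cst.
Qed.

Lemma continuous_sin_scale (z : R) : continuous (fun t : R => sin (t * z)).
Proof.
move=> t; apply: (@continuous_comp _ _ _ (fun t : R => t * z) (@sin R)); last exact: continuous_sin.
by apply: cvgM => //; exact: cvg_cst.
Qed.

Lemma is_derive_scale (z t : R) : is_derive t 1 (fun t : R => t * z) z.
Proof. by apply: is_derive_eq; rewrite /GRing.scale /=; ring. Qed.

Lemma is_derive_cos_scale (z t : R) :
  is_derive t 1 (fun t : R => cos (t * z)) (- z * sin (t * z)).
Proof.
have := @is_derive1_comp R (@cos R) (fun t => t * z) t _ _ (is_derive_cos _) (is_derive_scale z t).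
by rewrite mulrC mulrN -mulNr.
Qed.

Lemma is_derive_sin_scale (z t : R) :
  is_derive t 1 (fun t : R => sin (t * z)) (z * cos (t * z)).
Proof.
have := @is_derive1_comp R (@sin R) (fun t => t * z) t _ _ (is_derive_sin _) (is_derive_scale z t).
by rewrite mulrC.
Qed.

Lemma has_integral_gauss_cos_ex z :
  exists2 a, has_integral mu (fun t : R => G t * cos (t * z)) a & `|a| <= Num.sqrt pi.
Proof.
have mf : measurable_fun [set: measurableTypeR R] (fun t : R => G t * cos (t * z)).
  apply: measurable_funM; first exact: measurable_gauss_fun.
  (apply: continuous_measurable_fun; exact: continuous_cos_scale).
apply: (has_integral_dom mf has_integral_gauss).
move=> t; rewrite normrM (ger0_norm (gauss_fun_ge0 _)) ler_piMr ?gauss_fun_ge0//.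
by rewrite ler_norml cos_le1 cos_geN1.
Qed.

Lemma has_integral_gauss_moment_sin_ex z :
  exists a, has_integral mu (fun t : R => t * G t * sin (t * z)) a.
Proof.
have [b bh b0] := has_integral_gauss_moment.
have mf : measurable_fun [set: measurableTypeR R] (fun t : R => t * G t * sin (t * z)).
  apply: measurable_funM; last (apply: continuous_measurable_fun; exact: continuous_sin_scale).
  by apply: measurable_funM => //; exact: measurable_gauss_fun.
have [|a ? _] := has_integral_dom mf bh; last by exists a.
by move=> t; rewrite normrM ler_piMr// ler_norml sin_le1 sin_geN1.
Qed.

Lemma cvg_gauss_nat : G n%:R @[n --> \oo] --> (0 : R).
Proof.
by have /cvg_pinftyP := @cvg_gauss_fun R => /(_ (fun n => n%:R) (@cvgr_idn _)).
Qed.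

Lemma gauss_sin0 z : G n%:R * sin (n%:R * z) @[n --> \oo] --> (0 : R).
Proof.
apply: (@squeeze_cvgr _ _ _ _ (fun n => - G n%:R) (fun n => G n%:R)).
- near=> n; rewrite -ler_norml normrM (ger0_norm (gauss_fun_ge0 _)).
  by rewrite ler_piMr ?gauss_fun_ge0// ler_norml sin_le1 sin_geN1.
- by rewrite -[X in _ --> X]oppr0; apply: cvgN; exact: cvg_gauss_nat.
- exact: cvg_gauss_nat.
Unshelve. all: by end_near. Qed.

(* Integrate the derivative of [G t * sin (t * z)]. *)
Lemma gauss_moment_sinE z a b :
  has_integral mu (fun t : R => G t * cos (t * z)) a ->
  has_integral mu (fun t : R => t * G t * sin (t * z)) b -> b = z / 2 * a.
Proof.
move=> ah bh.
have h : has_integral mu (fun t : R => - (t * 2) * G t * sin (t * z) + G t * (z * cos (t * z)))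
    (- 2 * b + z * a).
  apply: (eq_has_integral (has_integralD (has_integralZ (-2) bh) (has_integralZ z ah))) => //.
  by move=> t /=; ring.
suff : - 2 * b + z * a = 0 by move=> ?; lra.
apply: (has_integral_line (F := fun t => G t * sin (t * z)) h).
- move=> t; apply: cvgD; apply: cvgM.
  + apply: cvgM; last exact: continuous_gauss_fun.
    by apply: cvgN; apply: cvgM; [exact: cvg_id|exact: cvg_cst].
  + exact: continuous_sin_scale.
  + exact: continuous_gauss_fun.
  + by apply: cvgM; [exact: cvg_cst|exact: continuous_cos_scale].
- move=> t; have := is_deriveM (is_derive_gauss t) (is_derive_sin_scale z t).
  move/is_derive_eq; apply; rewrite /GRing.scale /=; ring.
- exact: gauss_sin0.
- rewrite (_ : (fun n => _) = (fun n : nat => G n%:R * sin (n%:R * - z))).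
    exact: gauss_sin0.
  by apply/funext => n; rewrite /gauss_fun sqrrN mulrN mulNr.
Qed.

Lemma is_derive_gauss_cos (z : R) (J K : R -> R) :
  (forall z, has_integral mu (fun t : R => G t * cos (t * z)) (J z)) ->
  (forall z, has_integral mu (fun t : R => t * G t * sin (t * z)) (K z)) ->
  is_derive z 1 J (- K z).
Proof.
move=> hJ hK; have [b hb b0] := has_integral_gauss_moment.
pose f (z t : R) := G t * cos (t * z).
have df (t z' : R) : is_derive z' 1 (f ^~ t) (- (t * G t * sin (t * z'))).
  have h := is_derive_cos_scale t z'.
  have := @is_deriveZ _ _ _ _ (G t) _ _ _ h.
  rewrite (_ : f ^~ t = (G t \*: (fun y => cos (y * t)))); last first.
    by apply/funext => y; rewrite /f mulrC (mulrC t) mulrC.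
  by rewrite mulNr scalerN /GRing.scale/= mulrCA mulrA (mulrC t z').
have JE : J = fun z => (\int[mu]_t f z t)%R.
  by apply/funext => y; rewrite (has_integral_RintegralE (hJ y)).
have uv : `]z - 1, z + 1[%classic z by rewrite /= in_itv/=; lra.
have d1E (x t : R) : partial1of2 f x t = - (t * G t * sin (t * x)).
  by rewrite partial1of2E; apply: derive_val.
have h1 (x : R) : `]z - 1, z + 1[%classic x -> mu.-integrable setT (EFin \o f x).
  by move=> _; case: (hJ x).
have h2 (x t : R) : `]z - 1, z + 1[%classic x -> [set: R] t -> derivable (f ^~ t) x 1.
  by move=> _ _; case: (df t x).
have h3 (t : R) : 0 <= `|t * G t| by [].
have h4 : mu.-integrable setT (EFin \o (fun t : R => `|t * G t|)) by case: hb.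
have h5 (x t : R) : `]z - 1, z + 1[%classic x -> [set: R] t -> `|partial1of2 f x t| <= `|t * G t|.
  move=> _ _; rewrite d1E normrN normrM ler_piMr//.
  by rewrite ler_norml sin_le1 sin_geN1.
rewrite JE; apply: DeriveDef.
  exact: (derivable_under_integral measurableT uv h1 h2 h3 h4 h5).
rewrite -derive1E (differentiation_under_integral measurableT uv h1 h2 h3 h4 h5).
rewrite -[RHS](has_integral_RintegralE (has_integralN (hK z))).
by apply: eq_Rintegral => t _; rewrite d1E.
Qed.

(** The transform satisfies [J' = - K = - (z / 2) J], so [J z * exp(z^2 / 4)] is constant, and its
    value at 0 is the Gaussian integral. *)
Lemma has_integral_gauss_cos (z : R) :
  has_integral mu (fun t : R => G t * cos (t * z)) (Num.sqrt pi * expR (- (z ^+ 2 / 4))).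
Proof.
pose J z := sval (cid2 (has_integral_gauss_cos_ex z)).
pose K z := sval (cid (has_integral_gauss_moment_sin_ex z)).
have hJ y : has_integral mu (fun t : R => G t * cos (t * y)) (J y).
  by rewrite /J; case: cid2.
have hK y : has_integral mu (fun t : R => t * G t * sin (t * y)) (K y).
  by rewrite /K; case: cid.
have dE (x : R) : is_derive x 1 (fun x => expR (x ^+ 2 / 4)) (x / 2 * expR (x ^+ 2 / 4)).
  have d1 : is_derive x 1 (fun x : R => x ^+ 2 / 4) (x / 2).
    by apply: is_derive_eq; rewrite /GRing.scale /=; field.
  have := @is_derive1_comp R expR (fun x => x ^+ 2 / 4) x _ _ (is_derive_expR _) d1.
  by rewrite mulrC.
have dJE (x : R) : is_derive x 1 (J * (fun x => expR (x ^+ 2 / 4))) 0.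
  have := is_deriveM (is_derive_gauss_cos x hJ hK) (dE x).
  move/is_derive_eq; apply; rewrite (gauss_moment_sinE (hJ x) (hK x)).
  by rewrite /GRing.scale /=; field.
have E : J z * expR (z ^+ 2 / 4) = J 0 * expR (0 ^+ 2 / 4) := is_derive_0_is_cst z 0 dJE.
move: E; rewrite expr0n/= mul0r expR0 mulr1.
have -> : J 0 = Num.sqrt pi.
  apply: has_integral_unique (hJ 0) _; apply: (eq_has_integral has_integral_gauss) => //.
  by move=> t; rewrite mulr0 cos0 mulr1.
move=> h; apply: (eq_has_integral (hJ z)) => //.
by rewrite expRN -h mulfK// gt_eqF// expR_gt0.
Qed.

Lemma has_integral_gauss_moment_sin (z : R) :
  has_integral mu (fun t : R => t * G t * sin (t * z))
    (z / 2 * (Num.sqrt pi * expR (- (z ^+ 2 / 4)))).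
Proof.
have [b hb] := has_integral_gauss_moment_sin_ex z.
by rewrite -(gauss_moment_sinE (has_integral_gauss_cos z) hb).
Qed.

End gaussian_1d.

Section profile.
Context {R : realType}.
Local Notation mu := (@lebesgue_measure R).
Local Notation G := (@gauss_fun R).
Local Notation ghat := (fun z : R => Num.sqrt pi * expR (- (z ^+ 2 / 4))).

Lemma measurable_if_lt d (T : measurableType d) (f g h k : T -> R) :
  measurable_fun setT f -> measurable_fun setT g ->
  measurable_fun setT h -> measurable_fun setT k ->
  measurable_fun setT (fun x => if f x < g x then h x else k x).
Proof.
by move=> mf mg mh mk; apply: measurable_fun_ifT => //; exact: measurable_fun_ltr.
Qed.

Lemma has_integral_tail (f : R -> R) (c e : R) : has_integral mu f c -> 0 < e ->
  exists2 T : R, 0 < T &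
  exists2 a : R, has_integral mu (fun x => if T < `|x| then `|f x| else 0) a & a <= e.
Proof.
move=> fc e0; have mf := has_integral_measurable fc.
have [b bf _] := has_integral_abs fc.
pose tl (T : R) (x : R) := if T < `|x| then `|f x| else 0.
have mtl T : measurable_fun [set: measurableTypeR R] (tl T).
  by apply: measurable_if_lt => //; exact: measurableT_comp.
have ltl T (x : R) : `|tl T x| <= `|f x|.
  by rewrite /tl; case: ifP => _; rewrite ?normr_id ?normr0.
have H1 : (fun n : nat => \int[mu]_x (tl n%:R x)%:E)%E @ \oo --> 0%E.
  rewrite [X in _ --> X](_ : _ = \int[mu]_x (cst 0 x)%:E)%E; last by rewrite /= integral0.
  apply: (@dominated_cvg _ _ _ mu setT measurableT _ _ (fun x => `|f x|%:E)).
  - by move=> n; apply/measurable_EFinP; exact: mtl.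
  - move=> x _; apply: cvg_near_cst; near=> n; congr (_%:E); rewrite /tl ltNge ifF//.
    by apply/negbTE; rewrite negbK; near: n; exact: nbhs_infty_ger.
  - by [].
  - by case: bf.
  - by move=> n x _; rewrite lee_fin ltl.
have : \forall n \near \oo, (\int[mu]_x (tl n%:R x) < e)%R /\ (0 < n)%N.
  near=> n; split; last by near: n; exact: nbhs_infty_gt.
  by near: n; have := cvgr_lt 0 (fine_cvg H1) e; apply.
case=> n _ /(_ n (leqnn n))/= [ltn n0].
have [a ah _] := has_integral_dom (mtl n%:R) bf (ltl _).
exists n%:R; first by rewrite ltr0n.
by exists a => //; rewrite -(has_integral_RintegralE ah) ltW.
Unshelve. all: by end_near. Qed.

(* The factor (1 - G)^N makes the profile vanish to order 2N + 1 at 0, which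
   compensates for the crowding of the tubes at low frequencies; as a combination
   of Gaussians it still has an explicit sine transform. *)
Definition prof (N : nat) (t : R) := t * G t * (1 - G t) ^+ N.

Definition prof_weight N (j : 'I_N.+1) : R := (-1) ^+ j *+ 'C(N, j).
Definition prof_scale (j : nat) : R := Num.sqrt j.+1%:R.

(** The sine transform of [prof N]. As [G t ^+ j.+1] is [G (prof_scale j * t)], the binomial
    expansion writes [prof N] through rescaled copies of [t * G t], whose transform is [z / 2] times
    that of [G]. Of the factor [j.+1^-1], one square root comes from [t] and one from the change of
    variables. *)
Definition prof_hat (N : nat) (z : R) := \sum_(j < N.+1)
  prof_weight j * (j.+1%:R^-1 * (z / prof_scale j / 2 * ghat (z / prof_scale j))).

Lemma prof_scale_gt0 j : 0 < prof_scale j. Proof. by rewrite sqrtr_gt0 ltr0n. Qed.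

Lemma prof_scale2 j : prof_scale j ^+ 2 = j.+1%:R. Proof. by rewrite sqr_sqrtr. Qed.

Lemma gauss_prof_scale j t : G (prof_scale j * t) = G t ^+ j.+1.
Proof.
by rewrite /gauss_fun exprMn prof_scale2 -mulrN expRM_natl.
Qed.

Lemma gauss_binomial N t : (1 - G t) ^+ N * G t =
  \sum_(j < N.+1) prof_weight j * G (prof_scale j * t).
Proof.
rewrite exprBn mulr_suml; apply: eq_bigr => j _.
rewrite /prof_weight gauss_prof_scale expr1n mulr1 exprS -!mulrnAl -!mulrA; congr (_ * _).
by rewrite mulrC.
Qed.

Lemma has_integral_prof_sin N z :
  has_integral mu (fun t => prof N t * sin (t * z)) (prof_hat N z).
Proof.
have h : has_integral mu (fun t : R => \sum_(j < N.+1) prof_weight j *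
     ((prof_scale j)^-1 * ((prof_scale j * t + 0) * G (prof_scale j * t + 0) * sin ((prof_scale j * t + 0) * (z / prof_scale j)))))
   (\sum_(j < N.+1) prof_weight j * ((prof_scale j)^-1 * (`|prof_scale j|^-1 * (z / prof_scale j / 2 * ghat (z / prof_scale j))))).
  apply: has_integral_sum => j; apply: has_integralZ; apply: has_integralZ.
  apply: (has_integral_affine (f := fun t => t * G t * sin (t * (z / prof_scale j)))).
    by rewrite gt_eqF ?prof_scale_gt0.
  exact: has_integral_gauss_moment_sin.
apply: (eq_has_integral h).
- move=> t; rewrite /prof -[t * G t * _]mulrA [G t * _]mulrC gauss_binomial.
  rewrite mulr_sumr mulr_suml; apply: eq_bigr => j _; rewrite addr0.
  have k0 : prof_scale j != 0 by rewrite gt_eqF ?prof_scale_gt0.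
  have -> : prof_scale j * t * (z / prof_scale j) = t * z by field.
  by field.
- apply: eq_bigr => j _; congr (_ * _); rewrite mulrA; congr (_ * _).
  by rewrite gtr0_norm ?prof_scale_gt0// -invfM -expr2 prof_scale2.
Qed.

Lemma ghat_gauss (z : R) : expR (- (z ^+ 2 / 4)) = G (2^-1 * z).
Proof. by rewrite /gauss_fun; congr expR; field. Qed.

Lemma has_integral_ghat : has_integral mu ghat (2 * pi).
Proof.
have h2 : (2^-1 : R) != 0 by [].
have := has_integralZ (Num.sqrt pi) (has_integral_affine 0 h2 has_integral_gauss).
move/eq_has_integral; apply; first by move=> z; rewrite addr0 -ghat_gauss.
rewrite ger0_norm// invrK mulrCA -expr2 sqr_sqrtr ?pi_ge0//.
Qed.

Definition dghat (z : R) := z / 2 * ghat z.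

Lemma has_integral_dghat : exists a, has_integral mu dghat a.
Proof.
have [b hb b0] := has_integral_gauss_moment (R := R).
have h2 : (2^-1 : R) != 0 by [].
have mf : measurable_fun [set: measurableTypeR R] dghat.
  apply: measurable_funM; first exact: measurable_funM.
  by have [+ _] := has_integral_ghat => /measurable_int/measurable_EFinP.
have [|a ah _] := has_integral_dom mf (has_integralZ (Num.sqrt pi) (has_integral_affine 0 h2 hb)).
  move=> z; rewrite /dghat ghat_gauss addr0 !normrM (ger0_norm (sqrtr_ge0 _)).
  by rewrite le_eqVlt; apply/orP; left; apply/eqP; ring.
by exists a.
Qed.

Lemma has_integral_dghat_ray :
  has_integral mu (fun z => if z < 0 then dghat z else 0) (- Num.sqrt pi).
Proof.
have [a ah] := has_integral_dghat.
have d1 (x : R) : is_derive x 1 (fun x : R => - Num.sqrt pi * expR (- (x ^+ 2 / 4))) (dghat x).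
  have d2 : is_derive x 1 (fun x : R => - (x ^+ 2 / 4)) (- (x / 2)).
    by apply: is_derive_eq; rewrite /GRing.scale /=; field.
  have d3 := @is_derive1_comp R expR (fun x => - (x ^+ 2 / 4)) x _ _ (is_derive_expR _) d2.
  have := @is_deriveZ _ _ _ _ (- Num.sqrt pi) _ _ _ d3.
  by move/is_derive_eq; apply; rewrite /GRing.scale/= /dghat; ring.
have cd : continuous dghat.
  move=> x; apply: cvgM; first by apply: cvgM; [exact: cvg_id|exact: cvg_cst].
  apply: cvgM; first exact: cvg_cst.
  apply: (@continuous_comp _ _ _ (fun x : R => - (x ^+ 2 / 4)) expR); last exact: continuous_expR.
  apply: cvgN; apply: cvgM; last exact: cvg_cst.
  exact: exprn_continuous.
have h := has_integral_ray ah cd d1.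
have {}h : has_integral mu (fun x : R => \1_`[0, +oo[ x * dghat x) (Num.sqrt pi).
  apply: (eq_has_integral (h _)) => //; last first.
    by rewrite expr0n/= mul0r oppr0 expR0 mulr1 opprK.
  rewrite -[X in _ --> X](mulr0 (- Num.sqrt pi)); apply: cvgM; first exact: cvg_cst.
  have /cvg_pinftyP := @cvg_gauss_fun R => /(_ (fun n => 2^-1 * n%:R)) H.
  under eq_fun do rewrite ghat_gauss.
  apply: H; apply/cvgryPge => A; near=> n.
  rewrite ler_pdivlMl//; near: n; exact: nbhs_infty_ger.
have n1 : (-1 : R) != 0 by rewrite oppr_eq0 oner_eq0.
apply: (eq_has_integral (has_integralN (has_integral_affine 0 n1 h))).
  move=> x; rewrite mulN1r addr0 indicE mem_setE in_itv/= andbT oppr_ge0.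
  rewrite le_eqVlt /dghat; have [->|x0] := eqVneq x 0.
    by rewrite oppr0 !mul0r mulr0 oppr0 ltxx.
  by rewrite orFb sqrrN; case: ifP => _; rewrite ?mul1r ?mul0r ?oppr0// mulNr mulNr opprK.
by rewrite normrN1 invr1 mul1r.
Unshelve. all: by end_near. Qed.

Lemma prof_hatE N z : prof_hat N z = \sum_(j < N.+1)
  (prof_weight j * j.+1%:R^-1) * dghat ((prof_scale j)^-1 * z + 0).
Proof.
by apply: eq_bigr => j _; rewrite /dghat addr0 [_^-1 * z]mulrC !mulrA.
Qed.

Lemma has_integral_prof_hat N : exists c, has_integral mu (prof_hat N) c.
Proof.
have [a ah] := has_integral_dghat.
have k0 (j : nat) : (prof_scale j)^-1 != 0 by rewrite invr_eq0 gt_eqF ?prof_scale_gt0.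
have h : has_integral mu (fun z : R => \sum_(j < N.+1)
     (prof_weight j * j.+1%:R^-1) * dghat ((prof_scale j)^-1 * z + 0))
   (\sum_(j < N.+1) (prof_weight j * j.+1%:R^-1) * (`|(prof_scale j)^-1|^-1 * a)).
  by apply: has_integral_sum => j; apply: has_integralZ; exact: has_integral_affine.
by eexists; apply: (eq_has_integral h) => // z; rewrite prof_hatE.
Qed.

(** The value found termwise is an alternating sum whose sign is not apparent; the same sum is the
    integral of [G * (1 - G)^N], that is of [prof N t / t], and this function is bounded below on
    [[1, 2]]. *)
Lemma has_integral_prof_hat_neg N : exists2 c, 0 < c &
  has_integral mu (fun z => if z < 0 then prof_hat N z else 0) (- c).
Proof.
have k0 (j : nat) : (prof_scale j)^-1 != 0 by rewrite invr_eq0 gt_eqF ?prof_scale_gt0.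
have k1 (j : nat) : prof_scale j != 0 by rewrite gt_eqF ?prof_scale_gt0.
pose c := \sum_(j < N.+1) prof_weight j * (`|prof_scale j|^-1 * Num.sqrt pi).
have h : has_integral mu (fun t : R => \sum_(j < N.+1) prof_weight j * G (prof_scale j * t + 0)) c.
  by apply: has_integral_sum => j; apply: has_integralZ; apply: has_integral_affine has_integral_gauss.
exists c.
  have h1 : has_integral mu (\1_`[1, 2] : R -> R) 1.
    apply: has_integral_indic; first exact: measurable_itv.
    by rewrite /= lebesgue_measure_itv/= lte_fin ltr1n -EFinD; congr (_%:E); ring.
  have e0 : 0 < (1 - expR (-1)) ^+ N * expR (- 4) :> R.
    by rewrite mulr_gt0 ?expR_gt0// exprn_gt0// subr_gt0 expR_lt1.
  apply: (lt_le_trans e0); rewrite -[leLHS]mulr1.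
  apply: (has_integral_le (has_integralZ _ h1) h) => t.
  under eq_bigr do rewrite addr0.
  rewrite -gauss_binomial indicE mem_setE in_itv/=.
  case: andP => [[t1 t2]|_]; last first.
    rewrite mulr0 mulr_ge0 ?gauss_fun_ge0// exprn_ge0// subr_ge0; exact: gauss_fun_le1.
  have E1 : expR (-4) <= G t.
    by rewrite ler_expR lerN2; nra.
  have E2 : G t <= expR (-1).
    by rewrite ler_expR lerN2; nra.
  have E3 : 0 <= 1 - expR (-1) :> R by rewrite subr_ge0 expR_le1 lerN10.
  have E4 : 1 - expR (-1) <= 1 - G t by rewrite lerD2l lerN2.
  rewrite mulr1; apply: ler_pM => //; rewrite ?exprn_ge0 ?expR_ge0//.
  by apply: lerXn2r => //; rewrite nnegrE (le_trans E3).
have hr := has_integral_dghat_ray.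
have h' : has_integral mu (fun z : R => \sum_(j < N.+1) (prof_weight j * j.+1%:R^-1) *
     (if (prof_scale j)^-1 * z + 0 < 0 then dghat ((prof_scale j)^-1 * z + 0) else 0))
   (\sum_(j < N.+1) (prof_weight j * j.+1%:R^-1) * (`|(prof_scale j)^-1|^-1 * - Num.sqrt pi)).
  apply: has_integral_sum => j; apply: has_integralZ.
  exact: (has_integral_affine (f := fun z => if z < 0 then dghat z else 0)).
apply: (eq_has_integral h').
- move=> z; rewrite prof_hatE; case: ifPn => z0.
    apply: eq_bigr => j _; rewrite addr0 pmulr_rlt0 ?invr_gt0 ?prof_scale_gt0// z0//.
  apply: big1 => j _; rewrite addr0 pmulr_rlt0 ?invr_gt0 ?prof_scale_gt0// (negbTE z0) mulr0//.
- rewrite /c -sumrN; apply: eq_bigr => j _.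
  rewrite !gtr0_norm ?invr_gt0 ?prof_scale_gt0// invrK -prof_scale2; field.
  by [].
Qed.

Lemma has_integral_prof_abs N : exists2 a, has_integral mu (fun t => `|prof N t|) a & 0 <= a.
Proof.
have [b hb b0] := has_integral_gauss_moment (R := R).
have mf : measurable_fun [set: measurableTypeR R] (fun t => `|prof N t|).
  apply: measurableT_comp => //; apply: measurable_funM.
    by apply: measurable_funM => //; exact: measurable_gauss_fun.
  apply: measurable_funX; apply: measurable_funB => //; exact: measurable_gauss_fun.
have [|a ah _] := has_integral_dom mf hb.
  move=> t; rewrite normr_id /prof normrM ler_piMr// normrX exprn_ile1//.
  have := gauss_fun_le1 t; have := gauss_fun_ge0 t; rewrite ler_norml => ? ?; lra.
by exists a => //; apply: has_integral_ge0 ah _.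
Qed.

Lemma prof_hat_bound N : exists2 a, 0 <= a & forall z, `|prof_hat N z| <= a.
Proof.
have [a ah a0] := has_integral_prof_abs N; exists a => // z.
have mf := has_integral_measurable (has_integral_prof_sin N z).
have [|b bh ba] := has_integral_dom mf ah.
  by move=> t; rewrite normrM ler_piMr// ler_norml sin_le1 sin_geN1.
by rewrite (has_integral_unique (has_integral_prof_sin N z) bh).
Qed.

(** With [u = |t|], [(1 + u)^m <= exp(m u)], and [m u - u^2] is at most [m^2 / 4]. *)
Lemma gauss_pow_bound (m : nat) (t : R) :
  (1 + `|t|) ^+ m * G t <= expR (m%:R ^+ 2 / 4).
Proof.
set u := `|t|; have u0 : 0 <= u by rewrite normr_ge0.
have uE : t ^+ 2 = u ^+ 2 by rewrite real_normK ?num_real.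
have h : (1 + u) ^+ m <= expR (m%:R * u).
  by rewrite expRM_natl lerXn2r ?nnegrE ?expR_ge0 ?addr_ge0// expR_ge1Dx.
apply: (le_trans (ler_wpM2r (gauss_fun_ge0 _) h)).
rewrite /gauss_fun uE -expRD ler_expR.
by have := sqr_ge0 (u - m%:R / 2); rewrite sqrrB; lra.
Qed.

(** The factor [(1 + 1 / |t|)^d] counts overlapping tubes. Since [1 - G t <= t^2], the left side is
    at most [|t| G(t) (1 + |t|)^(2 d)], and two more powers of [1 + |t|] are spent on decay; hence
    [2 d + 2] in the constant. *)
Lemma prof_bound (d : nat) (t : R) : t != 0 ->
  `|prof d t| * (1 + `|t|^-1) ^+ d <=
    expR ((d.*2.+2)%:R ^+ 2 / 4) * (`|t| / (1 + `|t|) ^+ 2).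
Proof.
move=> t0; have u0 : 0 < `|t| by rewrite normr_gt0.
have g1 := gauss_fun_le1 t; have g0 := gauss_fun_ge0 t.
have gt : 1 - G t <= `|t| ^+ 2.
  rewrite real_normK ?num_real// lerBlDl -lerBlDr.
  exact: le_trans (expR_ge1Dx _).
apply: le_trans (ler_wpM2r _ (gauss_pow_bound d.*2.+2 t)); last first.
  by rewrite divr_ge0// exprn_ge0// addr_ge0.
rewrite /prof !normrM (ger0_norm g0) normrX (@ger0_norm _ (1 - _)) ?subr_ge0//.
have -> : (1 + `|t|) ^+ d.*2.+2 * G t * (`|t| / (1 + `|t|) ^+ 2) =
    `|t| * G t * ((1 + `|t|) ^+ d * (1 + `|t|) ^+ d).
  rewrite -exprD addnn -addn2 exprD; field.
  by rewrite gt_eqF// addr_gt0.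
rewrite -[leLHS]mulrA ler_wpM2l ?mulr_ge0//.
apply: (@le_trans _ _ ((`|t| ^+ 2) ^+ d * (1 + `|t|^-1) ^+ d)).
  rewrite ler_wpM2r ?exprn_ge0 ?addr_ge0 ?invr_ge0//.
  by apply: lerXn2r; rewrite // nnegrE ?subr_ge0// exprn_ge0.
rewrite -exprMn -exprMn; apply: lerXn2r; rewrite ?nnegrE ?mulr_ge0 ?addr_ge0 ?exprn_ge0 ?invr_ge0//.
have -> : `|t| ^+ 2 * (1 + `|t|^-1) = `|t| * (1 + `|t|) by field; rewrite normr_eq0.
by rewrite ler_wpM2r ?addr_ge0// lerDr.
Qed.

End profile.

(** * The test functions *)

Section test_function.
Context {R : realType}.
Local Notation mu := (@lebesgue_measure R).
Local Notation G := (@gauss_fun R).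
Local Notation ghat := (fun z : R => Num.sqrt pi * expR (- (z ^+ 2 / 4))).

Lemma has_integral_dominated_fubini n (f g : 'rV[R]_n.+1 -> R) (F : R -> R) (b c : R) :
  measurable_fun setT f -> has_integral (lebesgue_rV R n.+1) g b ->
  (forall x, `|f x| <= g x) ->
  (forall s, has_integral (lebesgue_rV R n)
     (fun z => f (consrV (s : measurableTypeR R, z))) (F s)) ->
  has_integral mu F c ->
  has_integral (lebesgue_rV R n.+1) f c.
Proof.
move=> mf gb fg fF Fc; apply: has_integral_consrV.
have gb' : has_integral (mu \x lebesgue_rV R n)%E (g \o @consrV R n) (1 * b).
  apply: has_integral_pushforward gb => //; first exact: measurable_consrV.
  by move=> A mA; rewrite mul1e.
refine (has_integral_prod12 (F := F : measurableTypeR R -> R) _ gb' _ fF Fc).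
  by apply: measurableT_comp mf _; exact: measurable_consrV.
by move=> z; exact: fg.
Qed.

Lemma has_integral_gauss_shift (a c : R) : 0 < a ->
  has_integral mu (fun t => G (a * (t - c))) (a^-1 * Num.sqrt pi).
Proof.
move=> a0; have an0 : a != 0 by rewrite gt_eqF.
apply: (eq_has_integral (has_integral_affine (- (a * c)) an0 has_integral_gauss)).
  by move=> t; rewrite mulrBr.
by rewrite gtr0_norm.
Qed.

Lemma has_integral_gauss_phase (a c beta y : R) : 0 < a ->
  has_integral mu (fun t => G (a * (t - c)) * cos (beta + y * t))
    (cos (beta + y * c) * (a^-1 * ghat (y / a))).
Proof.
move=> a0; have an0 : a != 0 by rewrite gt_eqF.
have ms : measurable_fun [set: measurableTypeR R] (fun u : R => G u * sin (u * (y / a))).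
  apply: measurable_funM; first exact: measurable_gauss_fun.
  by apply: continuous_measurable_fun; exact: continuous_sin_scale.
have [|s sh _] := has_integral_dom ms has_integral_gauss.
  move=> u; rewrite normrM (ger0_norm (gauss_fun_ge0 _)).
  by rewrite ler_piMr ?gauss_fun_ge0// ler_norml sin_le1 sin_geN1.
have s0 : s = 0.
  have n1 : (-1 : R) != 0 by rewrite oppr_eq0 oner_eq0.
  suff : s = - s by move=> ?; lra.
  apply: (has_integral_unique sh).
  apply: (eq_has_integral (has_integralN (has_integral_affine 0 n1 sh))).
    by move=> u; rewrite mulN1r addr0 mulNr sinN /gauss_fun sqrrN mulrN opprK.
  by rewrite normrN1 invr1 mul1r.
move: sh; rewrite {}s0 => sh.
have h := has_integralB (has_integralZ (cos (beta + y * c)) (has_integral_gauss_cos (y / a)))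
  (has_integralZ (sin (beta + y * c)) sh).
apply: (eq_has_integral (has_integral_affine (- (a * c)) an0 h)).
  move=> t; have -> : beta + y * t = beta + y * c + (a * t + - (a * c)) * (y / a) by field.
  have -> : a * t + - (a * c) = a * (t - c) by ring.
  by rewrite [in RHS]cosD/=; ring.
by rewrite gtr0_norm// mulr0 subr0; ring.
Qed.

Lemma measurable_prod_coord n (k : 'I_n -> R -> R) :
  (forall j, measurable_fun setT (k j)) ->
  measurable_fun setT (fun x : 'rV[R]_n => \prod_j k j (x ord0 j)).
Proof.
move=> mk; apply: measurable_prod => j _.
by apply: measurableT_comp (mk j) _; exact: measurable_coord.
Qed.

Lemma measurable_gauss_shift (a c : R) : measurable_fun setT (fun t : R => G (a * (t - c))).
Proof.
apply: measurableT_comp; first exact: measurable_gauss_fun.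
by apply: measurable_funM => //; exact: measurable_funB.
Qed.

Lemma measurable_lin n (y : 'I_n -> R) :
  measurable_fun setT (fun x : 'rV[R]_n => \sum_j y j * x ord0 j).
Proof.
by apply: measurable_sum => j; apply: measurable_funM => //; exact: measurable_coord.
Qed.

(** The phase [beta] is there for the induction: fixing the head coordinate at [s] adds [y ord0 * s]
    to it. *)
Lemma has_integral_gauss_prod_phase n (a beta : R) (c y : 'I_n -> R) : 0 < a ->
  has_integral (lebesgue_rV R n)
    (fun z => (\prod_j G (a * (z ord0 j - c j))) * cos (beta + \sum_j y j * z ord0 j))
    (cos (beta + \sum_j y j * c j) * \prod_j (a^-1 * ghat (y j / a))).
Proof.
move=> a0; elim: n beta c y => [|n IH] beta c y.
  have h := @has_integral_prod R 0 (fun _ => cst 0) (fun _ => 0) (fun _ => has_integral0 _).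
  apply: (eq_has_integral (has_integralZ (cos beta) h)) => [x|].
    by rewrite !big_ord0 addr0 mulrC.
  by rewrite !big_ord0 addr0.
have gb := has_integral_prod (fun j => has_integral_gauss_shift (c j) a0).
refine (has_integral_dominated_fubini (F := fun s => G (a * (s - c ord0)) *
   (cos (beta + y ord0 * s + \sum_j y (lift ord0 j) * c (lift ord0 j)) *
    \prod_j (a^-1 * ghat (y (lift ord0 j) / a)))) _ gb _ _ _).
- apply: measurable_funM.
    exact: (measurable_prod_coord (fun j => measurable_gauss_shift a (c j))).
  apply: measurableT_comp; first exact: (continuous_measurable_fun (@continuous_cos R)).
  by apply: measurable_funD => //; exact: measurable_lin.
- move=> x; rewrite normrM ger0_norm ?prodr_ge0//; last by move=> *; exact: gauss_fun_ge0.
  rewrite ler_piMr ?prodr_ge0//; last by rewrite ler_norml cos_le1 cos_geN1.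
  by move=> *; exact: gauss_fun_ge0.
- move=> s; have := has_integralZ (G (a * (s - c ord0))) (IH (beta + y ord0 * s)
    (fun j => c (lift ord0 j)) (fun j => y (lift ord0 j))).
  move/eq_has_integral; apply=> // z.
  rewrite !big_ord_recl !consrV_head/= -!mulrA addrA; congr (_ * _).
  congr (_ * cos (_ + _)); last by apply: eq_bigr => j _; rewrite consrV_tail.
  by apply: eq_bigr => j _; rewrite consrV_tail.
- have := has_integralZ (\prod_j (a^-1 * ghat (y (lift ord0 j) / a)))
    (has_integral_gauss_phase (c ord0)
      (beta + \sum_j y (lift ord0 j) * c (lift ord0 j)) (y ord0) a0).
  move/eq_has_integral; apply=> [s|].
    by rewrite [RHS]mulrCA [RHS]mulrC -[RHS]mulrA mulrC [RHS]mulrC addrAC; ring.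
  by rewrite !big_ord_recl addrAC addrA; ring.
Qed.

(** The line is slanted by a shear of the coordinates rather than by a rotation, so that integrals
    of [psi] and sums over grids of directions factor over the transverse coordinates. The tube has
    width of order [1 / a], and its head coordinate is of order [1 / b]. *)
Definition psi d (a b : R) (v : 'I_d -> R) (x : 'rV[R]_d.+1) : R :=
  prof d (b * x ord0 ord0) *
  \prod_j G (a * (x ord0 (lift ord0 j) - x ord0 ord0 * v j)).

(** The sine transform of [psi]. Dually to the shear, the profile is evaluated at the inner product
    with [(1, v)]; the other factors are positive Gaussians, so changes of sign come from that inner
    product alone. *)
Definition psi_hat d (a b : R) (v : 'I_d -> R) (y : 'rV[R]_d.+1) : R :=
  (b^-1 * prof_hat d ((y ord0 ord0 + \sum_j v j * y ord0 (lift ord0 j)) / b)) *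
  \prod_j (a^-1 * ghat (y ord0 (lift ord0 j) / a)).

Lemma measurable_prof d : measurable_fun setT (@prof R d).
Proof.
apply: measurable_funM.
  by apply: measurable_funM => //; exact: measurable_gauss_fun.
apply: measurable_funX; apply: measurable_funB => //; exact: measurable_gauss_fun.
Qed.

Lemma measurable_psi d a b v : measurable_fun setT (@psi d a b v).
Proof.
apply: measurable_funM.
  apply: measurableT_comp; first exact: measurable_prof.
  by apply: measurable_funM => //; exact: measurable_coord.
apply: measurable_prod => j _; apply: measurableT_comp; first exact: measurable_gauss_fun.
apply: measurable_funM => //; apply: measurable_funB; first exact: measurable_coord.
by apply: measurable_funM => //; exact: measurable_coord.
Qed.

Lemma has_integral_psi_abs d : exists2 K : R, 0 < K & forall a b v, 0 < a -> 0 < b ->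
  exists2 c, has_integral (lebesgue_rV R d.+1) (fun x => `|@psi d a b v x|) c &
    0 <= c <= K / (b * a ^+ d).
Proof.
have [A hA A0] := has_integral_prof_abs (R := R) d.
exists (A * Num.sqrt pi ^+ d + 1).
  by rewrite ltr_wpDl// mulr_ge0// exprn_ge0.
move=> a b v a0 b0; have bn0 : b != 0 by rewrite gt_eqF.
exists ((`|b|^-1 * A) * \prod_(j < d) (a^-1 * Num.sqrt pi)); last first.
  apply/andP; split.
    by rewrite !mulr_ge0// prodr_ge0// => *; rewrite mulr_ge0// invr_ge0 ltW.
  rewrite prodr_const card_ord gtr0_norm// exprMn exprVn.
  have -> : b^-1 * A * (a ^- d * Num.sqrt pi ^+ d) =
    A * Num.sqrt pi ^+ d / (b * a ^+ d).
    by field; rewrite expf_neq0 ?gt_eqF.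
  by rewrite ler_wpM2r ?lerDl// invr_ge0 mulr_ge0 ?exprn_ge0 ?ltW.
have h1 := has_integral_affine 0 bn0 hA.
pose g s (z : 'rV[R]_d) := \prod_j G (a * (z ord0 j - s * v j)).
have mg : measurable_fun setT (fun x : 'rV[R]_d.+1 =>
    g (x ord0 ord0) (rsubmx (x : 'rV_(1 + d)))).
  apply: measurable_prod => j _; apply: measurableT_comp; first exact: measurable_gauss_fun.
  apply: measurable_funM => //; apply: measurable_funB; last first.
    by apply: measurable_funM => //; exact: measurable_coord.
  rewrite (_ : (fun _ => _) = (fun x : 'rV[R]_d.+1 => x ord0 (rshift 1 j))).
    exact: measurable_coord.
  by apply/funext => x; rewrite mxE.
have g0 s z : 0 <= g s z.
  by rewrite prodr_ge0// => *; exact: gauss_fun_ge0.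
have gK s : has_integral (lebesgue_rV R d) (g s) (\prod_(j < d) (a^-1 * Num.sqrt pi)).
  exact: (has_integral_prod (fun j => has_integral_gauss_shift (s * v j) a0)).
apply: (eq_has_integral (has_integral_shear_tail h1 mg g0 gK)) => // x.
rewrite /psi [RHS]normrM addr0; congr (_ * _).
rewrite ger0_norm ?prodr_ge0//; last by move=> *; exact: gauss_fun_ge0.
apply: eq_bigr => j _; rewrite mxE.
by rewrite (_ : rshift 1 j = lift ord0 j)//; exact/val_inj.
Qed.

Lemma has_integral_psi_sin d a b v (y : 'rV[R]_d.+1) : 0 < a -> 0 < b ->
  has_integral (lebesgue_rV R d.+1) (fun x => psi a b v x * sin (inner y x))
    (psi_hat a b v y).
Proof.
move=> a0 b0; have bn0 : b != 0 by rewrite gt_eqF.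
have [K K0 /(_ a b v a0 b0)[c hc _]] := has_integral_psi_abs d.
pose Y := y ord0 ord0 + \sum_j v j * y ord0 (lift ord0 j).
refine (has_integral_dominated_fubini (F := fun s => prof d (b * s) * (sin (s * Y) *
   \prod_j (a^-1 * ghat (y ord0 (lift ord0 j) / a)))) _ hc _ _ _).
- apply: measurable_funM; first exact: measurable_psi.
  apply: measurableT_comp; first exact: (continuous_measurable_fun (@continuous_sin R)).
  exact: (measurable_lin (fun j => y ord0 j)).
- by move=> x; rewrite normrM ler_piMr// ler_norml sin_le1 sin_geN1.
- move=> s.
  (* A phase of [- pi / 2] turns the cosine of [has_integral_gauss_prod_phase] into the sine. *)
  have := has_integralZ (prof d (b * s)) (has_integral_gauss_prod_phase
    (y ord0 ord0 * s - pi / 2) (fun j => s * v j) (fun j => y ord0 (lift ord0 j)) a0).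
  move/eq_has_integral; apply=> [z|].
    rewrite /psi consrV_head/= -mulrA; congr (_ * (_ * _)).
      by apply: eq_bigr => j _; rewrite consrV_tail.
    rewrite /inner big_ord_recl consrV_head/= addrAC cosBpihalf; congr sin; congr (_ + _).
    by apply: eq_bigr => j _; rewrite consrV_tail.
  congr (_ * (_ * _)); rewrite addrAC cosBpihalf; congr sin.
  rewrite /Y mulrDr mulrC; congr (_ + _); rewrite mulr_sumr.
  by apply: eq_bigr => j _; rewrite mulrC mulrA.
- have := has_integralZ (\prod_j (a^-1 * ghat (y ord0 (lift ord0 j) / a)))
    (has_integral_affine 0 bn0 (has_integral_prof_sin d (Y / b))).
  move/eq_has_integral; apply=> [s|].
    by rewrite addr0 (_ : b * s * (Y / b) = s * Y); [ring|field].
  by rewrite /psi_hat -/Y gtr0_norm// mulrC.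
Qed.

End test_function.

(** * A domain near a point of its boundary *)

Section euclidean_inner.
Context {R : realType} {n : nat}.
Implicit Types x y z : 'rV[R]_n.

Lemma inner_mx x y : inner x y = (x *m y^T) ord0 ord0.
Proof. by rewrite mxE; apply: eq_bigr => i _; rewrite mxE. Qed.

Lemma innerC x y : inner x y = inner y x.
Proof. by apply: eq_bigr => i _; rewrite mulrC. Qed.

Lemma innerDl x y z : inner (x + y) z = inner x z + inner y z.
Proof. by rewrite -big_split; apply: eq_bigr => i _; rewrite mxE mulrDl. Qed.

Lemma innerZl (a : R) x y : inner (a *: x) y = a * inner x y.
Proof. by rewrite [RHS]mulr_sumr; apply: eq_bigr => i _; rewrite mxE mulrA. Qed.

Lemma innerNl x y : inner (- x) y = - inner x y.
Proof. by rewrite -scaleN1r innerZl mulN1r. Qed.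

Lemma innerBl x y z : inner (x - y) z = inner x z - inner y z.
Proof. by rewrite innerDl innerNl. Qed.

Lemma innerDr x y z : inner x (y + z) = inner x y + inner x z.
Proof. by rewrite innerC innerDl !(innerC x). Qed.

Lemma innerZr (a : R) x y : inner x (a *: y) = a * inner x y.
Proof. by rewrite innerC innerZl innerC. Qed.

Lemma innerBr x y z : inner x (y - z) = inner x y - inner x z.
Proof. by rewrite innerC innerBl !(innerC x). Qed.

Lemma inner_ge0 x : 0 <= inner x x.
Proof. by apply: sumr_ge0 => i _; rewrite -expr2 sqr_ge0. Qed.

Lemma enorm_sqr x : enorm x ^+ 2 = inner x x.
Proof. by rewrite sqr_sqrtr// inner_ge0. Qed.

Lemma enorm_ge0 x : 0 <= enorm x. Proof. exact: sqrtr_ge0. Qed.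

Lemma coord_le_enorm x i : `|x ord0 i| <= enorm x.
Proof.
rewrite -(ler_pXn2r (_ : (0 < 2)%N)) ?nnegrE ?enorm_ge0// enorm_sqr real_normK ?num_real//.
rewrite /inner (bigD1 i)//= -expr2 lerDl; apply: sumr_ge0 => j _.
by rewrite -expr2 sqr_ge0.
Qed.

Lemma inner_eq0 x : inner x x = 0 -> x = 0.
Proof.
move=> x0; apply/rowP => i; rewrite mxE; apply/eqP; rewrite -normr_le0.
by apply: (le_trans (coord_le_enorm x i)); rewrite /enorm x0 sqrtr0.
Qed.

Lemma inner_le_enorm x y : `|inner x y| <= enorm x * enorm y.
Proof.
rewrite -(ler_pXn2r (_ : (0 < 2)%N)) ?nnegrE ?mulr_ge0 ?enorm_ge0//.
rewrite exprMn !enorm_sqr real_normK ?num_real//.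
have [->|y0] := eqVneq y 0.
  have i0 z : inner z (0 : 'rV[R]_n) = 0 by rewrite -(scale0r z) innerZr mul0r.
  by rewrite !i0 mulr0 expr0n.
have yy : 0 < inner y y.
  by rewrite lt_neqAle inner_ge0 andbT eq_sym; apply: contra_neq y0; exact: inner_eq0.
have := inner_ge0 (inner y y *: x - inner x y *: y).
rewrite innerBl !innerBr !innerZl !innerZr (innerC y x) => h.
have {h} : 0 <= inner y y * (inner x x * inner y y - inner x y ^+ 2).
  by apply: (le_trans h); rewrite le_eqVlt; apply/orP; left; apply/eqP; ring.
by rewrite pmulr_rge0// subr_ge0.
Qed.

Lemma enormZ (a : R) x : enorm (a *: x) = `|a| * enorm x.
Proof.
by rewrite /enorm innerZl innerZr mulrA -expr2 sqrtrM ?sqr_ge0// sqrtr_sqr.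
Qed.

Lemma continuous_inner (y : 'rV[R]_n) : continuous (fun x => inner x y).
Proof.
rewrite /inner; apply: continuous_big; first exact: add_continuous.
by move=> i _ x; exact: (cvgM (@coord_continuous R 1 n ord0 i x) (cvg_cst _)).
Qed.

End euclidean_inner.

Section geometry.
Context {R : realType} {d : nat}.
Local Notation E := 'rV[R]_d.+1.
Implicit Types (x y u nu : E) (D : set E).

(** The row [e] and the rows of [U] form a square matrix [M] with [M M^T = 1], hence also
    [M^T M = 1]. *)
Lemma orthonormal_decomp (U : 'M[R]_(d, d.+1)) (e x : E) :
  U *m U^T = 1%:M -> enorm e = 1 -> U *m e^T = 0 ->
  x = x *m U^T *m U + inner x e *: e.
Proof.
move=> UU e1 Ue.
have ee : e *m e^T = 1%:M.
  apply/matrixP => i j; rewrite !ord1 -inner_mx -enorm_sqr e1 expr1n mxE//.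
have eU : e *m U^T = 0 by rewrite -[LHS]trmxK trmx_mul trmxK Ue trmx0.
pose M : 'M[R]_(1 + d) := col_mx e U.
have MM : M *m M^T = 1%:M.
  by rewrite tr_col_mx mul_col_row ee eU Ue UU scalar_mx_block.
have := mulmx1C MM; rewrite tr_col_mx mul_row_col => h.
rewrite -[LHS](mulmx1 x) -h mulmxDr addrC !mulmxA; congr (_ + _).
by rewrite [x *m e^T]mx11_scalar -inner_mx mul_scalar_mx.
Qed.

Lemma rV_norm_le m k (x : 'M[R]_(m, k)) (c : R) :
  0 <= c -> (forall i j, `|x i j| <= c) -> `|x| <= c.
Proof.
by move=> c0 xc; rewrite /Num.norm/= mx_normrE; apply: bigmax_le => // -[i j] _; exact: xc.
Qed.

Lemma rV_coord_le m k (x : 'M[R]_(m, k)) i j : `|x i j| <= `|x|.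
Proof.
rewrite [leRHS]/Num.norm/= mx_normrE.
exact: (le_bigmax 0 (fun ij : 'I_m * 'I_k => `|x ij.1 ij.2|) (i, j)).
Qed.

Lemma mulmx_norm_le m k (A : 'M[R]_(m, k)) : exists2 C : R, 0 < C &
  forall x : 'rV[R]_m, `|x *m A| <= C * `|x|.
Proof.
exists (1 + \sum_i \sum_j `|A i j|).
  by rewrite ltr_wpDr// sumr_ge0// => i _; rewrite sumr_ge0.
move=> x; apply: rV_norm_le.
  by rewrite mulr_ge0// addr_ge0// sumr_ge0// => i _; rewrite sumr_ge0.
move=> i j; rewrite mxE mulrDl mul1r ler_wpDl// mulr_suml.
apply: (le_trans (ler_norm_sum _ _ _)); apply: ler_sum => k' _.
rewrite normrM mulrC ler_pM// ?rV_coord_le//.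
by rewrite (bigD1 j)//= lerDl sumr_ge0.
Qed.

Lemma cvg_is_derive (V W : normedModType R) (f : V -> W) (a v : V) (df : W) :
  h^-1 *: (f (h *: v + a) - f a) @[h --> (0 : R)^'] --> df -> is_derive a v f df.
Proof.
move=> fdf; apply: DeriveDef; first by apply/cvg_ex; exists df.
by apply: cvg_lim fdf; exact: norm_hausdorff.
Qed.

(* [rho] is a defining function of the boundary near [x], with gradient [nu] at
   [x]. *)
Lemma boundary_local_form D x nu : C1_graph_at (boundary D) x -> boundary D x ->
  outer_unit_normal D x nu -> exists rho : E -> R,
  (exists2 dl : R, 0 < dl & forall w, `|w| < dl ->
     (boundary D (x + w) <-> rho (x + w) = 0)) /\
  forall eps : R, 0 < eps -> exists2 dl : R, 0 < dl & forall w, `|w| < dl ->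
    `|rho (x + w) - inner w nu| <= eps * `|w|.
Proof.
move=> [U [e [h [UU e1 Ue Ch Sh]]]] Bx [nu1 nuT _].
have dec y := orthonormal_decomp y UU e1 Ue.
have [dh _] := nbhs_singleton Ch.
have xh : inner x e = h (x *m U^T) by apply: (nbhs_singleton Sh).1.
set w0 := x *m U^T in Ch dh xh.
have ee : inner e e = 1 by rewrite -enorm_sqr e1 expr1n.
have eU : e *m U^T = 0 by rewrite -[LHS]trmxK trmx_mul trmxK Ue trmx0.
(* Moving the base point of the graph by [t *: k] gives a curve in the boundary with this tangent
   vector, which is therefore orthogonal to [nu]. *)
have tang k : inner (k *m U + ('d h w0 k) *: e) nu = 0.
  have gE : w0 *m U + h w0 *: e = x by rewrite -xh -dec.
  have dg : is_derive (0 : R) 1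
      (fun t : R => (t *: k + w0) *m U + h (t *: k + w0) *: e) (k *m U + 'd h w0 k *: e).
    apply: cvg_is_derive; rewrite -(deriveE k dh).
    have dhk : t^-1 *: (h (t *: k + w0) - h w0) @[t --> (0 : R)^'] --> 'D_k h w0.
      have /cvg_ex[l hl] := @diff_derivable _ _ _ h w0 k dh.
      have -> : 'D_k h w0 = l by apply: cvg_lim hl; exact: norm_hausdorff.
      exact: hl.
    apply: (@cvg_trans _ ((k *m U + (t^-1 *: (h (t *: k + w0) - h w0)) *: e) @[t --> (0 : R)^'])).
      apply: near_eq_cvg; near=> t.
      have t0 : t != 0 by near: t; exact: nbhs_dnbhs_neq.
      have -> : (t *: 1 + 0 : R) = t by rewrite addr0 /GRing.scale/= mulr1.
      rewrite scale0r add0r mulmxDl -scalemxAl.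
      have -> : t *: (k *m U) + w0 *m U + h (t *: k + w0) *: e - (w0 *m U + h w0 *: e) =
          t *: (k *m U) + (h (t *: k + w0) - h w0) *: e.
        by rewrite scalerBl opprD addrACA -[_ + _ - _ *m _]addrA subrr addr0.
      by rewrite [RHS]scalerDr !scalerA mulVf// scale1r.
    apply: cvgD; first exact: cvg_cst.
    by apply: cvgZr_tmp.
  apply: nuT; exists (fun t => (t *: k + w0) *m U + h (t *: k + w0) *: e); split.
  - by rewrite scale0r add0r.
  - pose g (t : R) := (t *: k + w0) *m U + h (t *: k + w0) *: e.
    have cg : g t @[t --> (0 : R)] --> g 0.
      apply/differentiable_continuous/derivable1_diffP.
      by case: dg.
    have g0 : g 0 = x by rewrite /g scale0r add0r.
    rewrite -g0 in Sh.
    near=> t.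
    have Sg : boundary D (g t) <-> inner (g t) e = h (g t *m U^T).
      by near: t; exact: cg Sh.
    rewrite Sg /g mulmxDl -mulmxA UU mulmx1 -scalemxAl eU scaler0 addr0.
    by rewrite innerDl innerZl ee mulr1 inner_mx -mulmxA Ue mulmx0 mxE add0r.
  - exact: dg.
pose s := inner e nu.
(* Hence [nu] is [s] times the gradient of [inner y e - h (y *m U^T)] at [x]; [s] is nonzero because
   [nu] is a unit vector. *)
have key u : inner u nu = s * (inner u e - 'd h w0 (u *m U^T)).
  rewrite {1}(dec u) innerDl innerZl -/s.
  have := tang (u *m U^T); rewrite innerDl innerZl -/s => /eqP.
  by rewrite addr_eq0 => /eqP ->; ring.
exists (fun y => s * (inner y e - h (y *m U^T))); split.
  have /nbhs_normP[dl /= dl0 hdl] := Sh; exists dl => // w wdl.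
  have -> := hdl (x + w); last by rewrite /= opprD addrA subrr sub0r normrN.
  split => [->|]; first by rewrite subrr mulr0.
  have s0 : s != 0.
    apply/eqP => s0; have := key nu; rewrite s0 mul0r -enorm_sqr nu1 expr1n => /eqP.
    by rewrite oner_eq0.
  by move/eqP; rewrite mulf_eq0 (negbTE s0)/= subr_eq0 => /eqP.
move=> eps eps0.
have [C C0 CU] := mulmx_norm_le U^T.
pose eps' := eps / (`|s| + 1) / C.
have e'0 : 0 < eps' by rewrite !divr_gt0// ltr_wpDl.
have := diff_locally dh => /eqaddoP/(_ _ e'0) hw.
have /nbhs_norm0P[dl /= dl0 hdl] := hw.
exists (C^-1 * dl); first by rewrite mulr_gt0// invr_gt0.
move=> w wdl; have : `|h (w *m U^T + w0) - (h w0 + 'd h w0 (w *m U^T))| <= eps' * `|w *m U^T|.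
  by apply: hdl; apply: le_lt_trans (CU w) _; rewrite -ltr_pdivlMl.
move=> hw'; rewrite key -mulrBr.
have -> : inner (x + w) e - h ((x + w) *m U^T) - (inner w e - 'd h w0 (w *m U^T)) =
  - (h (w *m U^T + w0) - (h w0 + 'd h w0 (w *m U^T))).
  by rewrite innerDl mulmxDl -/w0 xh [w0 + _]addrC; ring.
rewrite normrM normrN.
apply: (le_trans (ler_wpM2l (normr_ge0 _) hw')).
apply: (@le_trans _ _ (`|s| * (eps' * (C * `|w|)))).
  by rewrite !ler_wpM2l// ltW.
have -> : `|s| * (eps' * (C * `|w|)) = `|s| / (`|s| + 1) * (eps * `|w|).
  by rewrite /eps'; field; rewrite !gt_eqF// ltr_wpDl.
apply: ler_piMl; first by rewrite mulr_ge0// ltW.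
by rewrite ler_pdivrMr ?ltr_wpDl// mul1r lerDl.
Unshelve. all: by end_near. Qed.

(** On the segment [D] and [closure D] coincide, so [D] cuts out an open and closed part of a
    connected set. *)
Lemma segment_avoid_boundary D (a b : E) : open D ->
  (forall t : R, 0 <= t <= 1 -> ~ boundary D (t *: a + (1 - t) *: b)) -> D b -> D a.
Proof.
move=> oD nB Db.
pose f (t : R) : E := t *: a + (1 - t) *: b.
pose A := f @` `[0, 1]%classic.
have cA : connected A.
  apply: connected_continuous_connected; first exact: segment_connected.
  apply: continuous_subspaceT => t; apply: cvgD; apply: cvgZr_tmp; first exact: cvg_id.
  by apply: cvgB; [exact: cvg_cst|exact: cvg_id].
have Aa : A a by exists 1; rewrite /f/= ?in_itv/= ?ler01 ?lexx// scale1r subrr scale0r addr0.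
have Ab : A b by exists 0; rewrite /f/= ?in_itv/= ?ler01 ?lexx// scale0r subr0 scale1r add0r.
have AD : A `&` D = A `&` closure D.
  apply/seteqP; split => y [Ay Dy]; split => //; first exact: subset_closure.
  case: Ay Dy => t /=; rewrite in_itv/= => t01 <- cy.
  by apply: contrapT => nD; apply: (nB t t01); split => //; rewrite ((interior_id D).1 oD).
have : A `&` D = A.
  apply: cA.
  - by exists b.
  - by exists D.
  - by exists (closure D); [exact: closed_closure|exact: AD].
by move=> ADA; have [] : (A `&` D) a by rewrite ADA.
Qed.

Lemma not_boundary_closure D y : open D -> ~ boundary D y -> closure D y -> D y.
Proof.
move=> oD nB cy; apply: contrapT => nD; apply: nB; split => //.
by rewrite ((interior_id D).1 oD).
Qed.

(** The definition of the outer normal tells the two sides apart only along [nu]. For [z] between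
    [u] and [nu], the defining function at [x + t *: z] and [x - t *: z] is dominated by its linear
    part, since [inner z nu] stays positive; so the segments from [nu] to [u] avoid the boundary and
    transfer the sides. *)
Lemma boundary_crossing D x nu u : open D -> boundary D x ->
  C1_graph_at (boundary D) x -> outer_unit_normal D x nu -> 0 < inner u nu ->
  exists2 dl : R, 0 < dl & forall t : R, 0 < t < dl ->
    D (x - t *: u) /\ ~ closure D (x + t *: u).
Proof.
move=> oD Bx Gx Nx unu.
have [rho [[d0 d00 hd0] hrho]] := boundary_local_form Gx Bx Nx.
case: Nx => nu1 _ Nn.
have {Nn} /nbhs_norm0P[d1 /= d10 hd1] :
  \forall t \near (0 : R), 0 < t -> D (x - t *: nu) /\ ~ D (x + t *: nu) by exact: Nn.
have nn1 : inner nu nu = 1 by rewrite -enorm_sqr nu1 expr1n.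
(* Over all [z] between [u] and [nu], [m] bounds [inner z nu] from below and [M] bounds the norm
   from above; [eps] lets the error take at most half of the linear part. *)
pose m := Num.min (inner u nu) 1.
have m0 : 0 < m by rewrite lt_min unu ltr01.
pose M := `|u| + `|nu| + 1.
have M0 : 0 < M by rewrite ltr_wpDl// addr_ge0.
pose eps := m / 2 / M.
have e0 : 0 < eps by rewrite !divr_gt0.
have [d2 d20 hd2] := hrho _ e0.
pose dl := Num.min d1 (Num.min (d0 / M) (d2 / M)).
have avoid (s t a : R) : `|s| = 1 -> 0 < t < dl -> 0 <= a <= 1 ->
    ~ boundary D (x + (s * t) *: (a *: u + (1 - a) *: nu)).
  move=> s1 /andP[t0]; rewrite !lt_min => /and3P[_ td0 td2] /andP[a0 a1].
  set z := a *: u + (1 - a) *: nu.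
  have zM : `|z| <= M.
    apply: (le_trans (ler_normD _ _)); rewrite !normrZ (ger0_norm a0) ger0_norm ?subr_ge0//.
    rewrite /M; have := normr_ge0 u; have := normr_ge0 nu => h1 h2; nra.
  have zm : m <= inner z nu.
    rewrite innerDl !innerZl nn1.
    have : m <= inner u nu by rewrite ge_min lexx.
    have : m <= 1 by rewrite ge_min lexx orbT.
    by move=> h1 h2; nra.
  have wM : `|(s * t) *: z| <= t * M.
    by rewrite normrZ normrM s1 mul1r gtr0_norm// ler_wpM2l// ltW.
  rewrite hd0; last by apply: le_lt_trans wM _; rewrite -ltr_pdivlMr.
  move=> r0; have := hd2 ((s * t) *: z).
  rewrite r0 sub0r normrN innerZl !normrM s1 mul1r (gtr0_norm t0).
  rewrite (@ger0_norm _ (inner z nu)); last by rewrite (le_trans (ltW m0)).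
  have -> : `|(s * t) *: z| < d2.
    by apply: le_lt_trans wM _; rewrite -ltr_pdivlMr.
  move=> /(_ isT); apply/negP; rewrite -ltNge.
  apply: (le_lt_trans (ler_wpM2l (ltW e0) wM)).
  have -> : eps * (t * M) = t * (m / 2) by rewrite /eps; field; rewrite gt_eqF.
  by rewrite ltr_pM2l//; lra.
exists dl; first by rewrite !lt_min d10 !divr_gt0.
move=> t tdl; have /andP[t0] := tdl; rewrite lt_min => /andP[td1 _].
have [Dm Dp] : D (x - t *: nu) /\ ~ D (x + t *: nu) by apply: hd1 => //=; rewrite gtr0_norm.
have seg (s a : R) (p q : E) :
    a *: (x + s *: p) + (1 - a) *: (x + s *: q) = x + s *: (a *: p + (1 - a) *: q).
  by rewrite !scalerDr !scalerA addrACA -scalerDl subrKC scale1r ![s * _]mulrC.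
split.
  apply: segment_avoid_boundary Dm => // a a01.
  rewrite -!scaleNr seg; have := avoid (-1) t a; rewrite mulN1r; apply => //.
  by rewrite normrN1.
move=> cu; have Du : D (x + t *: u).
  apply: not_boundary_closure cu => //.
  have := avoid 1 t 1; rewrite mul1r scale1r subrr scale0r addr0; apply => //.
  - by rewrite normr1.
  - by rewrite ler01 lexx.
apply: Dp; apply: segment_avoid_boundary Du => // a /andP[a0 a1].
have nb : ~ boundary D (x + (1 * t) *: ((1 - a) *: u + (1 - (1 - a)) *: nu)).
  by apply: avoid; rewrite ?normr1//; apply/andP; split; lra.
have zE : (1 - a) *: u + (1 - (1 - a)) *: nu = a *: nu + (1 - a) *: u.
  by rewrite subKr addrC.
by rewrite seg -zE -[t]mul1r.
Qed.

(* Along a ray from [x] that makes a large enough angle with the tangent space,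
   every crossing of the boundary would be outward, so there is none. *)
Lemma cone_outside D (nu : E -> E) (x y : E) (r w : R) : open D -> C1_boundary D ->
  (forall z, boundary D z -> outer_unit_normal D z (nu z)) -> boundary D x ->
  (forall z, boundary D z -> enorm (z - x) <= r -> enorm (nu z - nu x) <= w) ->
  enorm (y - x) <= r -> w * enorm (y - x) < inner (y - x) (nu x) -> ~ D y.
Proof.
move=> oD C1 Nn Bx nuw yr; set u := y - x => uw Dy.
have yE : y = x + 1 *: u by rewrite scale1r /u subrKC.
(* The supremum [s] of [A] is the last parameter outside [D]. Just after it the segment lies in [D],
   although [u] has positive inner product with the normal there and should lead out of [D]. *)
pose A := [set t : R | 0 <= t <= 1 /\ ~ D (x + t *: u)].
have A0 : A 0.
  split; first by rewrite lexx ler01.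
  by rewrite scale0r addr0 => Dx; case: Bx => _; rewrite ((interior_id D).1 oD).
have ubA : ubound A 1 by move=> t [/andP[]].
have sA : has_sup A by split; [exists 0|exists 1].
pose s := sup A.
have s0 : 0 <= s by apply: ub_le_sup => //; case: sA.
have s1 : s <= 1 by apply: ge_sup => //; exists 0.
have cont : continuous (fun t : R => x + t *: u).
  by move=> t; apply: cvgD; [exact: cvg_cst|apply: cvgZr_tmp; exact: cvg_id].
have nDs : ~ D (x + s *: u).
  move=> Ds; have /cont/nbhs_normP[dl /= dl0 hdl] : nbhs (x + s *: u) D by exact: open_nbhs_nbhs.
  have [t At] := sup_adherent dl0 sA; rewrite -/s => st.
  have ts : t <= s by apply: ub_le_sup => //; case: sA.
  case: At => _; apply; apply: hdl => /=.
  by rewrite ger0_norm ?subr_ge0// ltrBlDl -ltrBlDr.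
have s1' : s < 1.
  by rewrite lt_neqAle s1 andbT; apply/eqP => sE; apply: nDs; rewrite sE -yE.
have above (t : R) : s < t <= 1 -> D (x + t *: u).
  move=> /andP[st t1]; apply: contrapT => nD.
  have : t <= s by apply: ub_le_sup; [case: sA|split => //; rewrite t1 (le_trans s0 (ltW st))].
  by rewrite leNgt st.
have Bs : boundary D (x + s *: u).
  split; last by rewrite ((interior_id D).1 oD).
  move=> B /cont/nbhs_normP[dl /= dl0 hdl].
  pose t := Num.min 1 (s + dl / 2).
  have st : s < t by rewrite lt_min s1' ltrDl divr_gt0.
  exists (x + t *: u); split.
    by apply: above; rewrite st ge_min lexx.
  apply: hdl; rewrite /= distrC gtr0_norm ?subr_gt0// ltrBlDl gt_min ltrD2l; apply/orP; right; lra.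
have usr : enorm (x + s *: u - x) <= r.
  rewrite addrAC subrr add0r enormZ (ger0_norm s0) (le_trans _ yr)//.
  by rewrite ler_piMl// enorm_ge0.
have unu : 0 < inner u (nu (x + s *: u)).
  have -> : nu (x + s *: u) = nu x + (nu (x + s *: u) - nu x) by rewrite subrKC.
  rewrite innerDr -ltrBlDr sub0r.
  apply: le_lt_trans uw; rewrite lerNl.
  have := inner_le_enorm u (nu (x + s *: u) - nu x).
  rewrite ler_norml => /andP[h _]; apply: le_trans h; rewrite lerN2 mulrC.
  by apply: ler_wpM2r; [exact: enorm_ge0|exact: nuw].
have [dl dl0 hdl] := boundary_crossing oD Bs (C1 _ Bs) (Nn _ Bs) unu.
pose t := Num.min (1 - s) (dl / 2).
have t0 : 0 < t by rewrite lt_min subr_gt0 s1' divr_gt0.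
have [] := hdl t.
  rewrite t0 gt_min; apply/orP; right; lra.
move=> _; apply; apply: subset_closure.
rewrite -addrA -scalerDl; apply: above.
by rewrite ltrDl t0 -lerBrDl ge_min lexx.
Qed.

(** Every crossing along the segment is inward. The one at [x] puts points of [D] right after it. If
    [y] were outside, the supremum of the parameters in [D] would be a crossing with points of [D]
    just before it, where an inward crossing leaves none. *)
Lemma cone_inside D (nu : E -> E) (x y : E) (r w : R) : open D -> C1_boundary D ->
  (forall z, boundary D z -> outer_unit_normal D z (nu z)) -> boundary D x ->
  (forall z, boundary D z -> enorm (z - x) <= r -> enorm (nu z - nu x) <= w) ->
  enorm (y - x) <= r -> inner (y - x) (nu x) < - (w * enorm (y - x)) -> D y.
Proof.
move=> oD C1 Nn Bx nuw yr; set u := y - x => uw; apply: contrapT => nDy.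
have yE : y = x + 1 *: u by rewrite scale1r /u subrKC.
have cross (s : R) : 0 <= s <= 1 -> boundary D (x + s *: u) ->
    exists2 dl : R, 0 < dl & forall t : R, 0 < t < dl ->
      D (x + (s + t) *: u) /\ ~ closure D (x + (s - t) *: u).
  move=> /andP[s0 s1] Bs.
  have usr : enorm (x + s *: u - x) <= r.
    rewrite addrAC subrr add0r enormZ (ger0_norm s0) (le_trans _ yr)//.
    by rewrite ler_piMl// enorm_ge0.
  have unu : 0 < inner (- u) (nu (x + s *: u)).
    have -> : nu (x + s *: u) = nu x + (nu (x + s *: u) - nu x) by rewrite subrKC.
    rewrite innerNl oppr_gt0 innerDr -ltrBrDr sub0r.
    apply: (lt_le_trans uw); rewrite lerN2.
    have := inner_le_enorm u (nu (x + s *: u) - nu x).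
    rewrite ler_norml => /andP[_ h]; apply: (le_trans h); rewrite mulrC.
    by apply: ler_wpM2r; [exact: enorm_ge0|exact: nuw].
  have [dl dl0 hdl] := boundary_crossing oD Bs (C1 _ Bs) (Nn _ Bs) unu.
  exists dl; first exact: dl0.
  move=> t /hdl[h1 h2]; split.
    by move: h1; rewrite scalerN opprK -addrA -scalerDl.
  by move: h2; rewrite scalerN -scaleNr -addrA -scalerDl.
pose A := [set t : R | 0 <= t <= 1 /\ D (x + t *: u)].
have [dl dl0 hdl] : exists2 dl : R, 0 < dl & forall t : R, 0 < t < dl -> D (x + t *: u).
  have [||dl dl0 hdl] := cross 0; rewrite ?lexx ?ler01 ?scale0r ?addr0//.
  by exists dl => // t /hdl[]; rewrite add0r.
have ubA : ubound A 1 by move=> t [/andP[]].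
pose t0 := Num.min 1 (dl / 2).
have t00 : 0 < t0 by rewrite lt_min ltr01 divr_gt0.
have At0 : A t0.
  split; first by rewrite (ltW t00) ge_min lexx.
  by apply: hdl; rewrite t00 gt_min; apply/orP; right; lra.
have sA : has_sup A by split; [exists t0|exists 1].
pose s := sup A.
have s0 : 0 < s by apply: (lt_le_trans t00); apply: ub_le_sup => //; case: sA.
have s1 : s <= 1 by apply: ge_sup => //; exists t0.
have cont : continuous (fun t : R => x + t *: u).
  by move=> t; apply: cvgD; [exact: cvg_cst|apply: cvgZr_tmp; exact: cvg_id].
have above (t : R) : s < t <= 1 -> ~ D (x + t *: u).
  move=> /andP[st t1] Dt.
  have : t <= s by apply: ub_le_sup; [case: sA|split => //; rewrite t1 (le_trans (ltW s0) (ltW st))].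
  by rewrite leNgt st.
have nDs : ~ D (x + s *: u).
  move=> Ds; have /cont/nbhs_normP[e /= e0 he] : nbhs (x + s *: u) D by exact: open_nbhs_nbhs.
  have s1' : s < 1.
    by rewrite lt_neqAle s1 andbT; apply/eqP => sE; apply: nDy; rewrite yE -sE.
  pose t := Num.min 1 (s + e / 2).
  have st : s < t by rewrite lt_min s1' ltrDl divr_gt0.
  apply: (above t); first by rewrite st ge_min lexx.
  apply: he; rewrite /= distrC gtr0_norm ?subr_gt0// ltrBlDl gt_min ltrD2l; apply/orP; right; lra.
have Bs : boundary D (x + s *: u).
  split; last by rewrite ((interior_id D).1 oD).
  move=> B /cont/nbhs_normP[e /= e0 he].
  have [t At] := sup_adherent e0 sA; rewrite -/s => st.
  have ts : t <= s by apply: ub_le_sup => //; case: sA.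
  exists (x + t *: u); split; first by case: At.
  by apply: he => /=; rewrite ger0_norm ?subr_ge0// ltrBlDl -ltrBlDr.
have [||e e0 he] := cross s => //; first by rewrite (ltW s0).
have [t At] := sup_adherent e0 sA; rewrite -/s => st.
have ts : t <= s by apply: ub_le_sup => //; case: sA.
have ts' : t < s.
  by rewrite lt_neqAle ts andbT; apply/eqP => tsE; case: At => _; rewrite tsE.
have [] := he (s - t).
  by rewrite subr_gt0 ts' ltrBlDl -ltrBlDr.
by move=> _; rewrite subKr; apply; apply: subset_closure; case: At.
Qed.

End geometry.

(** * Boundary points with a prescribed normal direction *)

Section support.
Context {R : realType} {d : nat}.
Local Notation E := 'rV[R]_d.+1.
Implicit Types (x y u nu : E) (D : set E).

Lemma support_point D (theta : E) : D !=set0 -> open D -> bounded_set D ->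
  theta != 0 -> exists2 x, boundary D x &
    forall y, D y -> inner y theta <= inner x theta.
Proof.
move=> [y0 Dy0] oD bD th0.
have bcD : bounded_set (closure D).
  move: bD => [M [Mreal hM]]; exists M; split => // M' MM' y cy.
  have cB : closed [set z : E | `|z| <= M'].
    apply: (@closed_comp _ _ (fun z : E => `|z|) [set t | t <= M']).
      by move=> z _; exact: norm_continuous.
    exact: closed_le.
  have : closure D `<=` [set z : E | `|z| <= M'].
    by rewrite closureE; apply: smallest_sub => // z Dz; exact: hM.
  exact.
have cpt : compact (closure D) by apply: bounded_closed_compact => //; exact: closed_closure.
have [||x /set_mem cx xmax] := @EVT_max_rV R d.+1 (fun y => inner y theta) (closure D) _ cpt.
- by exists y0; exact: subset_closure.
- by apply: continuous_subspaceT; exact: continuous_inner.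
exists x; last by move=> y Dy; apply: xmax; apply: mem_set; exact: subset_closure.
split => // Dx.
have cont : continuous (fun t : R => x + t *: theta).
  by move=> t; apply: cvgD; [exact: cvg_cst|apply: cvgZr_tmp; exact: cvg_id].
have Dx0 : nbhs (x + 0 *: theta) D by rewrite scale0r addr0.
have /cont/nbhs_normP[dl /= dl0 hdl] := Dx0.
have Dt : D (x + (dl / 2) *: theta).
  apply: hdl => /=.
  by rewrite sub0r normrN gtr0_norm ?divr_gt0//; lra.
have := xmax (x + (dl / 2) *: theta) (mem_set (subset_closure Dt)).
rewrite innerDl innerZl gerDl; apply/negP; rewrite -ltNge mulr_gt0 ?divr_gt0//.
rewrite lt_neqAle inner_ge0 andbT eq_sym; apply: contra_neq th0; exact: inner_eq0.
Qed.

(** If [inner u nu > 0], then [- u] points into [D], and maximality gives [inner u theta >= 0]; a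
    linear form that is nonnegative on a half-space is a nonnegative multiple of the normal. *)
Lemma support_normal D (nu : E) (x theta : E) : open D -> C1_graph_at (boundary D) x ->
  boundary D x -> outer_unit_normal D x nu ->
  (forall y, D y -> inner y theta <= inner x theta) ->
  theta = enorm theta *: nu.
Proof.
move=> oD Gx Bx Nx xmax.
have pos u : 0 < inner u nu -> 0 <= inner u theta.
  move=> unu; have [dl dl0 hdl] := boundary_crossing oD Bx Gx Nx unu.
  have [|Dt _] := hdl (dl / 2); first by apply/andP; split; lra.
  have := xmax _ Dt; rewrite innerBl innerZl gerBl => h.
  by rewrite -(pmulr_rge0 _ (_ : 0 < dl / 2))// divr_gt0.
have nn1 : inner nu nu = 1 by case: Nx => nu1 _ _; rewrite -enorm_sqr nu1 expr1n.
pose c := inner theta nu.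
have c0 : 0 <= c by rewrite /c innerC; apply: pos; rewrite nn1.
pose p := theta - c *: nu.
have pnu : inner p nu = 0 by rewrite innerBl innerZl nn1 mulr1 subrr.
have p0 : p = 0.
  apply: inner_eq0.
  have pth : inner p theta = inner p p.
    by rewrite [RHS]innerBr innerZr pnu mulr0 subr0.
  apply/eqP; rewrite eq_le inner_ge0 andbT leNgt; apply/negP => pp.
  (* A small multiple of [nu] makes [- p] admissible for [pos]; [e * c] must stay below [inner p p],
     and [c + 1] in the denominator covers [c = 0]. *)
  pose e := inner p p / (c + 1) / 2.
  have e0 : 0 < e by rewrite !divr_gt0// ltr_wpDl.
  have h1 : inner (e *: nu - p) nu = e by rewrite innerBl innerZl nn1 mulr1 pnu subr0.
  have h2 : inner (e *: nu - p) theta = e * c - inner p p.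
    by rewrite innerBl innerZl pth innerC.
  have := pos (e *: nu - p); rewrite h1 h2 => /(_ e0) h.
  have : e * c <= inner p p / 2.
    have -> : e * c = inner p p / 2 * (c / (c + 1)).
      by rewrite /e; field; rewrite gt_eqF// ltr_wpDl.
    apply: ler_piMr; first by rewrite divr_ge0// ltW.
    by rewrite ler_pdivrMr ?ltr_wpDl// mul1r lerDl.
  lra.
have thE : theta = c *: nu by apply/eqP; rewrite -subr_eq0 -/p p0.
by rewrite {2}thE enormZ (ger0_norm c0); case: Nx => -> _ _; rewrite mulr1.
Qed.

(** In the ball of radius [r] about [x] the domain agrees with a half-space off a slab of
    half-thickness [w * r]. The factor [enorm theta] is there because [theta] is not normalized. *)
Lemma boundary_cap D (nu : E -> E) (theta : E) : D !=set0 -> open D ->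
  bounded_set D -> C1_boundary D ->
  (forall z, boundary D z -> outer_unit_normal D z (nu z)) -> theta != 0 ->
  exists2 x, boundary D x & forall r w : R, 0 <= w ->
    (forall z, boundary D z -> enorm (z - x) <= r -> enorm (nu z - nu x) <= w) ->
    forall y, enorm (y - x) <= r ->
      (inner (y - x) theta < - (w * r * enorm theta) -> D y) /\
      (w * r * enorm theta < inner (y - x) theta -> ~ D y).
Proof.
move=> D0 oD bD C1 Nn th0; have [x Bx xmax] := support_point D0 oD bD th0.
exists x => // r w w0 nuw y yr.
have thE := support_normal oD (C1 _ Bx) Bx (Nn _ Bx) xmax.
have e0 : 0 < enorm theta.
  rewrite lt_neqAle enorm_ge0 andbT eq_sym; apply: contra_neq th0 => e0.
  by apply: inner_eq0; rewrite -enorm_sqr e0 expr0n.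
have wr : w * enorm (y - x) <= w * r by rewrite ler_wpM2l.
have iE : inner (y - x) theta = enorm theta * inner (y - x) (nu x).
  by rewrite {1}thE innerZr.
rewrite iE [w * r * _]mulrC -mulrN !ltr_pM2l//; split => h.
  apply: (cone_inside oD C1 Nn Bx nuw yr); apply: (lt_le_trans h).
  by rewrite lerN2.
by apply: (cone_outside oD C1 Nn Bx nuw yr); apply: le_lt_trans h.
Qed.

End support.

(** * Pairing the domain with a test function *)

Section kernel_bound.
Context {R : realType} {d : nat}.
Local Notation mu := (@lebesgue_measure R).
Local Notation E := 'rV[R]_d.+1.
Local Notation ghat := (fun z : R => Num.sqrt pi * expR (- (z ^+ 2 / 4))).

Definition direction (v : 'I_d -> R) : E :=
  \row_i (if unlift ord0 i is Some j then v j else 1).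

Lemma inner_direction (v : 'I_d -> R) (y : E) :
  inner y (direction v) = y ord0 ord0 + \sum_j v j * y ord0 (lift ord0 j).
Proof.
rewrite /inner big_ord_recl !mxE unlift_none mulr1; congr (_ + _).
by apply: eq_bigr => j _; rewrite !mxE liftK mulrC.
Qed.

Lemma enorm_le_sum n (y : 'rV[R]_n) : enorm y <= \sum_i `|y ord0 i|.
Proof.
have s0 : 0 <= \sum_i `|y ord0 i| by apply: sumr_ge0.
rewrite -(ler_pXn2r (_ : (0 < 2)%N)) ?nnegrE ?enorm_ge0// enorm_sqr.
rewrite expr2 mulr_suml; apply: ler_sum => i _.
rewrite -expr2 -real_normK ?num_real// expr2 ler_wpM2l//.
by rewrite (bigD1 i)//= lerDl sumr_ge0.
Qed.

Lemma enorm_direction (v : 'I_d -> R) : (forall j, 0 <= v j <= 1) ->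
  1 <= enorm (direction v) <= d.+1%:R.
Proof.
move=> v01; apply/andP; split.
  apply: le_trans (coord_le_enorm _ ord0).
  by rewrite mxE unlift_none normr1.
apply: (le_trans (enorm_le_sum _)).
rewrite -[leRHS]mulr1 -[X in X%:R * _](card_ord d.+1) mulr_natl -sumr_const.
apply: ler_sum => i _; rewrite mxE; case: unliftP => [j _|_]; last by rewrite normr1.
by have /andP[h0 h1] := v01 j; rewrite ger0_norm.
Qed.

Lemma enorm_le_direction (v : 'I_d -> R) (y : E) : (forall j, 0 <= v j <= 1) ->
  enorm y <= `|inner y (direction v)| + 2 * \sum_j `|y ord0 (lift ord0 j)|.
Proof.
move=> v01; apply: (le_trans (enorm_le_sum _)).
rewrite big_ord_recl mulr2n mulrDl mul1r addrA lerD2r.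
have -> : y ord0 ord0 = inner y (direction v) - \sum_j v j * y ord0 (lift ord0 j).
  by rewrite inner_direction addrK.
apply: (le_trans (ler_normB _ _)); rewrite lerD2l.
apply: (le_trans (ler_norm_sum _ _ _)); apply: ler_sum => j _.
by have /andP[h0 h1] := v01 j; rewrite normrM (ger0_norm h0) ler_piMl.
Qed.

(** In the coordinates [inner x (direction v)] and the tail of [x], obtained by a shear of
    determinant 1, the function is a product. The value does not depend on [a], [b], [v] and [x0],
    and this is the source of uniformity in scale and direction. *)
Lemma has_integral_centered (h : R -> R) (k : 'I_d -> R -> R) (c : R)
    (kc v : 'I_d -> R) (a b : R) (x0 : E) : 0 < a -> 0 < b ->
  has_integral mu h c -> (forall j, has_integral mu (k j) (kc j)) ->
  has_integral (lebesgue_rV R d.+1)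
    (fun x => (b^-1 * h (inner (x - x0) (direction v) / b)) *
      \prod_j (a^-1 * k j ((x - x0) ord0 (lift ord0 j) / a))) (c * \prod_j kc j).
Proof.
move=> a0 b0 hc kkc.
have aff (f : R -> R) (e c' s : R) : 0 < e -> has_integral mu f c' ->
    has_integral mu (fun t => e^-1 * f ((t - s) / e)) c'.
  move=> e0 fc; have en0 : e^-1 != 0 by rewrite invr_eq0 gt_eqF.
  apply: (eq_has_integral (has_integralZ e^-1 (has_integral_affine (- (s / e)) en0 fc))).
    by move=> t; rewrite (_ : (t - s) / e = e^-1 * t + - (s / e))//; ring.
  by rewrite gtr0_norm ?invr_gt0// invrK mulKf// gt_eqF.
have h1 := aff h b c (inner x0 (direction v)) b0 hc.
pose k' j t := a^-1 * k j ((t - x0 ord0 (lift ord0 j)) / a).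
have k1 := has_integral_prod (k := k') (fun j => aff (k j) a (kc j) (x0 ord0 (lift ord0 j)) a0 (kkc j)).
apply: (eq_has_integral (has_integral_shear (k := k') (measurable_lin v) h1 k1)) => // x.
congr (_ * _); last by apply: eq_bigr => j _; rewrite /k' !mxE.
congr (_ * h (_ / _)); rewrite innerBl; congr (_ - _); rewrite inner_direction.
congr (_ + _); apply: eq_bigr => j _; rewrite mxE; congr (_ * _).
by rewrite (_ : rshift 1 j = lift ord0 j)//; exact/val_inj.
Qed.

Lemma psi_hat_direction (a b : R) (v : 'I_d -> R) (y : E) : psi_hat a b v y =
  (b^-1 * prof_hat d (inner y (direction v) / b)) *
    \prod_j (a^-1 * ghat (y ord0 (lift ord0 j) / a)).
Proof. by rewrite /psi_hat inner_direction. Qed.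

Lemma nat_bool_mul_le (i c : bool) (h : R) :
  i%:R * h <= (if c then h else 0) + `|h|.
Proof.
have := ler_norm h; have := ler_norm (- h); have := normr_ge0 h; rewrite normrN.
by case: i; case: c => ? ? ?; rewrite ?mul1r ?mul0r; lra.
Qed.

(** With the half-space [inner (x - x0) (direction v) < 0] in place of [D] the integral is exactly
    [- cH * P]. The errors come from the slab [|z| <= la], the tail [|z| > TH] and the [d]
    transverse tails together; each of the three is at most one eighth of [cH * P]. The constants
    depend on [d] alone. *)
Lemma psi_hat_integral_le : exists al ka et c1 : R,
  [/\ 0 < al, 0 < ka, 0 < et, 0 < c1 &
  forall (D : set E) (x0 : E) (v : 'I_d -> R) (r eta : R),
  measurable D -> (forall j, 0 <= v j <= 1) -> 0 < r -> 0 < eta <= et ->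
  (forall y, enorm (y - x0) <= r ->
    (inner (y - x0) (direction v) < - (eta * r * enorm (direction v)) -> D y) /\
    (eta * r * enorm (direction v) < inner (y - x0) (direction v) -> ~ D y)) ->
  exists2 I : R, has_integral (lebesgue_rV R d.+1)
     (fun x => \1_D x * psi_hat (r / al) (ka * r * eta) v (x - x0)) I & I <= - c1].
Proof.
have [cH cH0 hneg] := has_integral_prof_hat_neg (R := R) d.
have [aH aH0 Hb] := prof_hat_bound (R := R) d.
have [c hH] := has_integral_prof_hat (R := R) d.
have [bH hbH _] := has_integral_abs hH.
have bH0 : 0 <= bH by apply: has_integral_ge0 hbH _.
have hg := has_integral_ghat (R := R).
have pi1 : 1 <= 2 * pi :> R by have := @pi_ge2 R; lra.
have pi0 : 0 < 2 * pi :> R by apply: lt_le_trans pi1.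
pose P : R := \prod_(j < d) (2 * pi).
have P0 : 0 < P by apply: prodr_gt0.
(* Inside the ball of radius r, [D] differs from a half-space only in a slab, whose
   contribution [la] controls; [TH] and [Tg] control the exterior of the ball. *)
pose la := cH / (16 * (aH + 1)).
have la0 : 0 < la by rewrite divr_gt0// mulr_gt0// ltr_wpDl.
have cH8 : 0 < cH / 8 by rewrite divr_gt0.
have [TH TH0 [tH htH tHle]] := has_integral_tail hH cH8.
(* Each of the [d] transverse tails is weighted by the factor [bH] of the profile; [bH + 1] and
   [d.+1] keep the denominator positive. *)
pose eg := cH / (8 * (bH + 1) * d.+1%:R).
have eg0 : 0 < eg by rewrite divr_gt0// !mulr_gt0// ltr_wpDl.
have [Tg Tg0 [tg htg tgle]] := has_integral_tail hg eg0.
have [sl hsl slle] : exists2 s : R,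
    has_integral mu (fun z => if la < `|z| then 0 else `|prof_hat d z|) s & s <= cH / 8.
  have h1 : has_integral mu (\1_`[- la, la] : R -> R) (la + la).
    apply: has_integral_indic; first exact: measurable_itv.
    by rewrite /= lebesgue_measure_itv/= lte_fin gtrN// opprK -EFinD.
  have mf : measurable_fun [set: measurableTypeR R] (fun z : R => if la < `|z| then 0 else `|prof_hat d z|).
    apply: measurable_if_lt => //.
    by apply: measurableT_comp => //; exact: has_integral_measurable hH.
  have [|s hs ss] := has_integral_dom mf (has_integralZ aH h1).
    move=> z; rewrite indicE mem_setE in_itv/= -ler_norml.
    by case: (leP `|z| la) => _ /=; rewrite ?mulr0 ?normr0 ?mulr1 ?normr_id.
  exists s => //; apply: (le_trans (ler_norm _)); apply: (le_trans ss).
  rewrite /la; have -> : aH * (cH / (16 * (aH + 1)) + cH / (16 * (aH + 1))) =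
    cH / 8 * (aH / (aH + 1)) by field; rewrite gt_eqF// ltr_wpDl.
  apply: ler_piMr; first exact: ltW.
  by rewrite ler_pdivrMr ?ltr_wpDl// mul1r lerDl.
(* Chosen so that [2 * d * Tg * a <= r / 2] for [a = r / al]. *)
pose al := 4 * d%:R * Tg + 1.
have al0 : 0 < al by rewrite ltr_wpDl// !mulr_ge0// ltW.
(* Chosen so that [la * b = eta * r * d.+1]; as [direction v] has length at most [d.+1], the
   undecided slab of the cap lies in [|z| <= la]. *)
pose ka := d.+1%:R / la.
have ka0 : 0 < ka by rewrite divr_gt0.
(* Chosen so that [TH * b <= r / 2] for [eta <= et]; with the transverse bound this keeps the point
   in the ball of radius [r]. *)
pose et := (2 * ka * TH)^-1.
have et0 : 0 < et by rewrite invr_gt0 mulr_gt0// mulr_gt0.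
exists al, ka, et, (cH * P / 2); split => //; first by rewrite divr_gt0// mulr_gt0.
move=> D x0 v r eta mD v01 r0 /andP[eta0 etale] cap.
set a := r / al; set b := ka * r * eta.
have a0 : 0 < a by rewrite divr_gt0.
have b0 : 0 < b by rewrite mulr_gt0// mulr_gt0.
have hfull := has_integral_centered v x0 a0 b0 hH (fun _ : 'I_d => hg).
have hhalf := has_integral_centered v x0 a0 b0 hneg (fun _ : 'I_d => hg).
have hE1 := has_integral_centered v x0 a0 b0 hsl (fun _ : 'I_d => hg).
have hE2 := has_integral_centered v x0 a0 b0 htH (fun _ : 'I_d => hg).
(* The transverse Gaussians with the [j]-th one cut down to its tail. *)
pose kj (j i : 'I_d) (z : R) := if i == j then (if Tg < `|z| then `|ghat z| else 0) else ghat z.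
pose kc (j i : 'I_d) := if i == j then tg else 2 * pi.
have hkj j i : has_integral mu (kj j i) (kc j i).
  by rewrite /kj /kc; case: (i == j).
have hE3 j := has_integral_centered v x0 a0 b0 hbH (hkj j).
have hE := has_integralD (has_integralD hE1 hE2) (has_integral_sum (index_enum 'I_d) hE3).
have mf : measurable_fun setT (fun x : E => \1_D x * psi_hat a b v (x - x0)).
  apply: measurable_funM; first exact: measurable_indic.
  have := has_integral_measurable hfull.
  by under eq_fun do rewrite -psi_hat_direction.
have [Ea hEa _] := has_integral_abs hfull.
have [|I hI _] := has_integral_dom mf hEa.
  move=> x; rewrite -psi_hat_direction normrM ler_piMl// indicE.
  by case: (_ \in _); rewrite ?normr1 ?normr0.
exists I => //.
have key := has_integral_le hI (has_integralD hhalf hE).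
set tot := (- cH * _ + _) in key.
have totle : tot <= - (cH * P / 2).
  have cP : 0 < cH * P by rewrite mulr_gt0.
  have e1 : sl * P <= cH * P / 8 by rewrite mulrAC ler_wpM2r// ltW.
  have e2 : tH * P <= cH * P / 8 by rewrite mulrAC ler_wpM2r// ltW.
  have tg0 : 0 <= tg by apply: has_integral_ge0 htg _ => z; case: ifP.
  have e3 : \sum_(i < d) bH * \prod_j kc i j <= cH * P / 8.
    apply: (@le_trans _ _ (\sum_(i < d) (cH * P / 8 / d.+1%:R))).
      apply: ler_sum => i _; rewrite (bigD1 i)//= /kc eqxx.
      have -> : \prod_(j < d | j != i) (if j == i then tg else 2 * pi) = P / (2 * pi).
        rewrite /P [in RHS](bigD1 i)//= [RHS]mulrC mulKf ?gt_eqF//.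
        by apply: eq_bigr => j /negbTE ->.
      have h : P / (2 * pi) <= P by rewrite ler_pdivrMr// ler_peMr// ltW.
      have h' : tg * (P / (2 * pi)) <= eg * P.
        by apply: ler_pM => //; rewrite divr_ge0// ltW.
      apply: (le_trans (ler_wpM2l bH0 h')); rewrite /eg.
      have -> : bH * (cH / (8 * (bH + 1) * d.+1%:R) * P) =
          cH * P / 8 / d.+1%:R * (bH / (bH + 1)).
        have d1 : d.+1%:R != 0 :> R by rewrite pnatr_eq0.
        have b1 : bH + 1 != 0 by rewrite gt_eqF ?ltr_wpDl.
        by move: (d.+1%:R : R) d1 => N d1; field; rewrite d1 b1.
      apply: ler_piMr; first by rewrite divr_ge0// divr_ge0// ltW.
      by rewrite ler_pdivrMr ?ltr_wpDl// mul1r lerDl.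
    rewrite sumr_const card_ord -[leLHS]mulr_natl mulrA ler_pdivrMr// mulrC.
    by rewrite ler_wpM2l ?divr_ge0 ?(ltW cP)// ler_nat.
  by apply: le_trans (lerD (lexx _) (lerD (lerD e1 e2) e3)) _; rewrite -/P; move: cP; clear; lra.
apply: le_trans totle; apply: key => x.
rewrite psi_hat_direction.
set y := x - x0; set z := inner y (direction v) / b.
set Q := \prod_j (a^-1 * ghat (y ord0 (lift ord0 j) / a)).
have Q0 : 0 <= Q.
  apply: prodr_ge0 => j _; apply: mulr_ge0; first by rewrite invr_ge0 ltW.
  by apply: mulr_ge0; [exact: sqrtr_ge0|exact: expR_ge0].
have b0' : 0 <= b^-1 by rewrite invr_ge0 ltW.
pose h := prof_hat d z; rewrite -/h.
have E3_ge0 j : 0 <= b^-1 * `|h| *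
    \prod_i (a^-1 * kj j i (y ord0 (lift ord0 i) / a)).
  apply: mulr_ge0; first exact: mulr_ge0.
  apply: prodr_ge0 => i _; apply: mulr_ge0; first by rewrite invr_ge0 ltW.
  rewrite /kj; case: ifP => _; first by case: ifP.
  by apply: mulr_ge0; [exact: sqrtr_ge0|exact: expR_ge0].
have E3s_ge0 : 0 <= \sum_j b^-1 * `|h| *
    \prod_i (a^-1 * kj j i (y ord0 (lift ord0 i) / a)) by apply: sumr_ge0.
have bQ : 0 <= b^-1 * Q by rewrite mulr_ge0.
(* A crude bound valid everywhere; in each exceptional region its last term is paid by one of the
   error integrals. *)
have base : \1_D x * (b^-1 * h * Q) <= b^-1 * (if z < 0 then h else 0) * Q + b^-1 * `|h| * Q.
  have h' : (\1_D x : R) * h <= (if z < 0 then h else 0) + `|h|.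
    by rewrite indicE; exact: nat_bool_mul_le.
  have := ler_wpM2l bQ h'; set i1 := \1_D x; set i2 := if _ then _ else _ => h2.
  have -> : i1 * (b^-1 * h * Q) = b^-1 * Q * (i1 * h) by ring.
  apply: (le_trans h2); rewrite le_eqVlt; apply/orP; left; apply/eqP; ring.
have [zla|zla] := leP `|z| la.
  apply: (le_trans base); rewrite lerD2l -addrA lerDl; apply: addr_ge0 => //.
  apply: mulr_ge0; last exact: Q0.
  by apply: mulr_ge0; [exact: b0'|case: ifP].
have [zTH|zTH] := ltP TH `|z|.
  apply: (le_trans base); rewrite lerD2l mulr0 mul0r add0r lerDl//.
have [[j uj]|nuj] := pselect (exists j, Tg < `|y ord0 (lift ord0 j) / a|).
  apply: (le_trans base); rewrite lerD2l !mulr0 !mul0r !add0r.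
  rewrite (bigD1 j)//= (eq_bigr (fun i => a^-1 * ghat (y ord0 (lift ord0 i) / a))).
    by rewrite lerDl sumr_ge0.
  have g0 (t : R) : 0 <= ghat t.
    by apply: mulr_ge0; [exact: sqrtr_ge0|exact: expR_ge0].
  by move=> i _; rewrite /kj; case: eqP => // ->; rewrite uj (ger0_norm (g0 _)).
rewrite !mulr0 !mul0r !add0r.
(* What remains is inside the ball and off the slab, where [D] coincides with the half-space. *)
suff -> : \1_D x * (b^-1 * h * Q) = b^-1 * (if z < 0 then h else 0) * Q by rewrite lerDl.
have zE : inner y (direction v) = z * b by rewrite divfK// gt_eqF.
have yr : enorm y <= r.
  apply: (le_trans (enorm_le_direction y v01)).
  have h1 : `|inner y (direction v)| <= r / 2.
    rewrite zE normrM (gtr0_norm b0); apply: (@le_trans _ _ (TH * b)).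
      by rewrite ler_wpM2r// ltW.
    rewrite /b; have : TH * (ka * r * et) <= r / 2.
      have -> : TH * (ka * r * et) = r / 2; last exact: lexx.
      by rewrite /et; field; rewrite !gt_eqF.
    apply: le_trans; rewrite ler_wpM2l ?(ltW TH0)// ler_wpM2l//.
    by rewrite mulr_ge0// ltW.
  have h2 : \sum_j `|y ord0 (lift ord0 j)| <= d%:R * (Tg * a).
    have -> : d%:R * (Tg * a) = \sum_(j < d) Tg * a.
      by rewrite sumr_const card_ord mulr_natl.
    apply: ler_sum => j _; rewrite leNgt; apply/negP => h3; apply: nuj; exists j.
    by rewrite normrM normfV (gtr0_norm a0) ltr_pdivlMr.
  have h3 : 2 * (d%:R * (Tg * a)) <= r / 2.
    have -> : 2 * (d%:R * (Tg * a)) = r / 2 * (4 * d%:R * Tg / al).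
      by rewrite /a; field; rewrite gt_eqF.
    apply: ler_piMr; first by rewrite divr_ge0// ltW.
    by rewrite ler_pdivrMr// mul1r /al lerDl.
  lra.
have [cap1 cap2] := cap x yr.
have thr : eta * r * enorm (direction v) <= la * b.
  have -> : la * b = eta * r * d.+1%:R.
    rewrite /b /ka; move: (d.+1%:R : R) => N; field; exact: lt0r_neq0.
  apply: ler_wpM2l; first by rewrite mulr_ge0// ltW.
  by have /andP[] := enorm_direction v01.
have lab : la * b < `|z| * b by rewrite ltr_pM2r.
rewrite indicE; have [z0|z0] := ltP z 0.
  have Dx : D x.
    apply: cap1; rewrite -/y zE ltrNr -mulNr -(ltr0_norm z0).
    exact: le_lt_trans thr lab.
  by rewrite mem_set// mul1r.
have nDx : ~ D x.
  apply: cap2; rewrite -/y zE -(ger0_norm z0); exact: le_lt_trans thr lab.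
by rewrite memNset// mulr0 !mul0r.
Qed.

End kernel_bound.

(** * The test functions are Schwartz *)

Section directional.
Context {R : realType} {V : normedModType R}.

Lemma is_derive_line (f : V -> R) (x v : V) (df : R) :
  is_derive x v f df <-> is_derive (0 : R) 1 (fun t => f (t *: v + x)) df.
Proof.
have E : (fun h : R => h^-1 *: ((f \o shift x) (h *: v) - f x)) =
    (fun h : R => h^-1 *: (((fun t : R => f (t *: v + x)) \o shift 0) (h *: 1) - f (0 *: v + x))).
  by apply/funext => h /=; rewrite addr0 scale0r add0r /GRing.scale/= mulr1.
by split=> -[dx dv]; apply: DeriveDef; move: dx dv; rewrite /derivable /derive E.
Qed.

Lemma is_derive_comp1 (phi : R -> R) (f : V -> R) (x v : V) (df dphi : R) :
  is_derive x v f df -> is_derive (f x) 1 phi dphi ->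
  is_derive x v (fun y => phi (f y)) (dphi * df).
Proof.
move=> /is_derive_line hf hphi; apply/is_derive_line.
apply: (is_derive1_comp (f := phi) _ hf).
by rewrite scale0r add0r.
Qed.

Lemma is_derive_additive (f : V -> R) (x v : V) :
  (forall a b, f (a + b) = f a + f b) -> (forall (k : R) a, f (k *: a) = k * f a) ->
  is_derive x v f (f v).
Proof.
move=> fD fZ; apply: cvg_is_derive; apply: cvg_near_cst; near=> h.
have h0 : h != 0 by near: h; exact: nbhs_dnbhs_neq.
by rewrite fD fZ addrK /GRing.scale/= mulKf.
Unshelve. all: by end_near. Qed.

End directional.

Section schwartz_gaussian.
Context {R : realType} {n : nat}.
Local Notation E := 'rV[R]_n.
Implicit Types (f g q : E -> R).

(** A quadratic form is kept as a sum of squares of linear forms so that its derivatives are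
    explicit; the last condition is coercivity, the source of decay. *)
Definition quadratic q (l : 'I_n -> E) (C : R) :=
  [/\ forall x, q x = \sum_k inner x (l k) ^+ 2, 0 < C &
      forall (x : E) i, x ord0 i ^+ 2 <= C * q x].

(* The span of monomials times modulated Gaussians; the phase [beta] accounts for
   sines. *)
Inductive gaussian_class : (E -> R) -> Prop :=
| gaussian_atom q l C x0 beta : quadratic q l C ->
    gaussian_class (fun x => expR (- q x) * cos (inner x x0 + beta))
| gaussian_coord i f : gaussian_class f -> gaussian_class (fun x : E => x ord0 i * f x)
| gaussian_add f g : gaussian_class f -> gaussian_class g ->
    gaussian_class (fun x => f x + g x)
| gaussian_scale c f : gaussian_class f -> gaussian_class (fun x => c * f x)
| gaussian_zero : gaussian_class (fun=> 0).

Lemma gaussian_sum (I : Type) (s : seq I) (f : I -> E -> R) :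
  (forall i, gaussian_class (f i)) -> gaussian_class (fun x => \sum_(i <- s) f i x).
Proof.
move=> gf; elim: s => [|i s IH].
  rewrite (_ : (fun _ => _) = fun=> 0); first exact: gaussian_zero.
  by apply/funext => x; rewrite big_nil.
rewrite (_ : (fun _ => _) = fun x => f i x + \sum_(i <- s) f i x); first exact: gaussian_add.
by apply/funext => x; rewrite big_cons.
Qed.

Lemma gaussian_class_continuous f : gaussian_class f -> continuous f.
Proof.
elim=> {f} [q l C x0 beta [qE _ _]|i f _ cf|f g _ cf _ cg|c f _ cf|] x.
- have cq : continuous q.
    rewrite (funext qE); apply: continuous_big; first exact: add_continuous.
    move=> k _ y.
    exact: (continuous_comp (@continuous_inner R n (l k) y) (@exprn_continuous R 2 _)).
  have cl : continuous (fun y => inner y x0 + beta).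
    by move=> y; exact: (cvgD (@continuous_inner R n x0 y) (cvg_cst _)).
  have c1 : {for x, continuous (fun y => expR (- q y))}.
    have cN : {for x, continuous (fun y => - q y)} by exact: (continuousN (cq x)).
    exact: (continuous_comp cN (@continuous_expR R _)).
  have c2 : {for x, continuous (fun y => cos (inner y x0 + beta))}.
    exact: (continuous_comp (cl x) (@continuous_cos R _)).
  exact: (continuousM c1 c2).
- exact: (cvgM (@coord_continuous R 1 n ord0 i x) (cf x)).
- exact: (cvgD (cf x) (cg x)).
- exact: (cvgM (cvg_cst _) (cf x)).
- exact: (@cst_continuous _ _ (0 : R) x).
Qed.

Lemma is_derive_quadratic q l C x v : quadratic q l C ->
  is_derive x v q (\sum_k (2 * inner v (l k)) * inner x (l k)).
Proof.
move=> [qE _ _]; rewrite (funext qE).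
have dk k : is_derive x v (fun y => inner y (l k) ^+ 2) ((2 * inner v (l k)) * inner x (l k)).
  have dl : is_derive x v (fun y => inner y (l k)) (inner v (l k)).
    apply: is_derive_additive => [a b|c a]; [exact: innerDl|exact: innerZl].
  have d2 : is_derive (inner x (l k)) 1 (fun t : R => t ^+ 2) (2 * inner x (l k)).
    by apply: is_derive_eq; rewrite /GRing.scale/=; ring.
  have := is_derive_comp1 dl d2; move/is_derive_eq; apply; ring.
have := @is_derive_sum _ _ _ _ (fun k y => inner y (l k) ^+ 2) x v
  (fun k => (2 * inner v (l k)) * inner x (l k)) dk.
by move/is_derive_eq; rewrite fct_sumE; apply.
Qed.

(** Differentiating the exponential brings down linear forms, hence coordinates; differentiating the
    cosine shifts its phase by [pi / 2]. *)
Lemma gaussian_class_derive f (i : 'I_n) : gaussian_class f ->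
  exists2 g, gaussian_class g & forall x, is_derive x (delta_mx ord0 i) f (g x).
Proof.
elim=> {f} [q l C x0 beta Q|j f gf [g gg dg]|f1 f2 g1 [h1 gh1 dh1] g2 [h2 gh2 dh2]|c f gf [g gg dg]|].
- pose A b' x := expR (- q x) * cos (inner x x0 + b').
  have gA b' : gaussian_class (A b') by apply: gaussian_atom Q.
  pose e : E := delta_mx ord0 i.
  exists (fun x : E => \sum_k (- (2 * inner e (l k))) * (\sum_j l k ord0 j * (x ord0 j * A beta x))
     + inner e x0 * A (beta + pi / 2) x).
    apply: gaussian_add; last exact: gaussian_scale.
    apply: gaussian_sum => k; apply: gaussian_scale; apply: gaussian_sum => j.
    by apply: gaussian_scale; apply: gaussian_coord.
  move=> x; have dq := is_derive_quadratic x e Q.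
  have dl : is_derive x e (fun y => inner y x0 + beta) (inner e x0).
    have dl0 : is_derive x e (fun y => inner y x0) (inner e x0).
      apply: is_derive_additive => [a b|c a]; [exact: innerDl|exact: innerZl].
    have := is_deriveD dl0 (is_derive_cst beta x e); rewrite addr0; exact.
  have d1 := is_derive_comp1 (is_deriveN dq) (is_derive_expR _).
  have d2 := is_derive_comp1 dl (is_derive_cos _).
  have := is_deriveM d1 d2; move/is_derive_eq; apply.
  rewrite /A addrA cosDpihalf /GRing.scale/=.
  have -> : \sum_k - (2 * inner e (l k)) * (\sum_j l k ord0 j * (x ord0 j * (expR (- q x) * cos (inner x x0 + beta)))) =
     - (\sum_k (2 * inner e (l k)) * inner x (l k)) * (expR (- q x) * cos (inner x x0 + beta)).
    rewrite -sumrN mulr_suml; apply: eq_bigr => k _.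
    set X := expR _ * cos _.
    have -> : \sum_j l k ord0 j * (x ord0 j * X) = inner x (l k) * X.
      by rewrite [RHS]mulr_suml; apply: eq_bigr => j _; rewrite mulrA (mulrC (l k ord0 j)).
    by rewrite mulrA mulNr.
  ring.
- exists (fun x : E => x ord0 j * g x + (delta_mx ord0 i : E) ord0 j * f x).
    by apply: gaussian_add; [exact: gaussian_coord|exact: gaussian_scale].
  move=> x; have dj : is_derive x (delta_mx ord0 i) (fun y : E => y ord0 j) ((delta_mx ord0 i : E) ord0 j).
    by apply: is_derive_additive => [a b|c a]; rewrite mxE.
  have := is_deriveM dj (dg x); move/is_derive_eq; apply.
  by rewrite /GRing.scale/=; ring.
- exists (fun x => h1 x + h2 x); first exact: gaussian_add.
  by move=> x; exact: is_deriveD.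
- exists (fun x => c * g x); first exact: gaussian_scale.
  by move=> x; exact: is_deriveZ.
- by exists (fun=> 0); [exact: gaussian_zero|move=> x; exact: is_derive_cst].
Qed.

(** From [1 + u <= (m + 1) exp(u / (m + 1))], raised to the power [m]; dividing by [m + 1] avoids a
    case [m = 0]. *)
Lemma expR_pow_bound (m : nat) (u : R) : 0 <= u ->
  (1 + u) ^+ m * expR (- u) <= m.+1%:R ^+ m.
Proof.
move=> u0; have m0 : 0 < m.+1%:R :> R by [].
have h : 1 + u <= m.+1%:R * expR (u / m.+1%:R).
  apply: (@le_trans _ _ (m.+1%:R * (1 + u / m.+1%:R))); last first.
    by rewrite ler_wpM2l// expR_ge1Dx.
  rewrite mulrDr mulr1 mulrCA mulfV ?gt_eqF// mulr1 lerD2r.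
  by rewrite (ler_nat _ 1).
have h2 : (1 + u) ^+ m <= m.+1%:R ^+ m * expR u.
  apply: (@le_trans _ _ ((m.+1%:R * expR (u / m.+1%:R)) ^+ m)).
    by apply: lerXn2r => //; rewrite nnegrE ?addr_ge0// mulr_ge0// expR_ge0.
  rewrite exprMn -expRM_natl ler_wpM2l ?exprn_ge0// ler_expR.
  rewrite mulrCA ler_piMr// ler_pdivrMr// mul1r ler_nat//.
by rewrite expRN ler_pdivrMr ?expR_gt0.
Qed.

Lemma monomial_le (a : seq 'I_n) (x : E) (B : R) : 0 <= B ->
  (forall i, `|x ord0 i| <= B) -> `|monomial a x| <= B ^+ size a.
Proof.
move=> B0 xB; rewrite /monomial; elim: a => [|i a IH]; first by rewrite big_nil normr1.
by rewrite big_cons normrM exprS ler_pM.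
Qed.

Lemma gaussian_class_bound f (a : seq 'I_n) : gaussian_class f ->
  exists M, forall x, `|monomial a x * f x| <= M.
Proof.
move=> gf; elim: gf a => {f} [q l C x0 beta [qE C0 qC]|j f gf IH|f1 f2 g1 IH1 g2 IH2|c f gf IH|] a.
- exists ((1 + C) ^+ size a * (size a).+1%:R ^+ size a) => x.
  have q0 : 0 <= q x by rewrite qE sumr_ge0// => k _; rewrite sqr_ge0.
  have xB i : `|x ord0 i| <= (1 + C) * (1 + q x).
    apply: (@le_trans _ _ (1 + x ord0 i ^+ 2)).
      rewrite -[X in _ <= _ + X]real_normK ?num_real//.
      have := sqr_ge0 (`|x ord0 i| - 1); have := normr_ge0 (x ord0 i).
      by rewrite sqrrB1 => ? ?; lra.
    have := qC x i => h; apply: (@le_trans _ _ (1 + C * q x)); first by rewrite lerD2l.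
    by rewrite mulrDl mul1r mulrDr mulr1; lra.
  have B0 : 0 <= (1 + C) * (1 + q x) by rewrite mulr_ge0 ?addr_ge0// ltW.
  rewrite normrM; apply: (@le_trans _ _ (((1 + C) * (1 + q x)) ^+ size a * expR (- q x))).
    apply: ler_pM => //; first exact: monomial_le.
    rewrite normrM (ger0_norm (expR_ge0 _)) ler_piMr ?expR_ge0//.
    by rewrite ler_norml cos_le1 cos_geN1.
  rewrite exprMn -mulrA ler_wpM2l ?exprn_ge0 ?addr_ge0 ?(ltW C0)//.
  exact: expR_pow_bound.
- have [M hM] := IH (j :: a); exists M => x.
  by have := hM x; rewrite /monomial big_cons mulrCA mulrA.
- have [M1 hM1] := IH1 a; have [M2 hM2] := IH2 a; exists (M1 + M2) => x.
  by rewrite mulrDr; apply: (le_trans (ler_normD _ _)); exact: lerD.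
- have [M hM] := IH a; exists (`|c| * M) => x.
  by rewrite mulrCA normrM ler_wpM2l.
- by exists 0 => x; rewrite mulr0 normr0.
Qed.

Lemma gaussian_class_partial f (b : seq 'I_n) : gaussian_class f ->
  gaussian_class (partial b f).
Proof.
move=> gf; elim: b => [|i b IH] //=.
have [g gg dg] := gaussian_class_derive i IH.
rewrite (_ : 'D_(_) _ = g)//; apply/funext => x.
by have [_] := dg x.
Qed.

Lemma gaussian_class_smooth f : gaussian_class f -> smooth f.
Proof.
move=> gf b; have gb := gaussian_class_partial b gf; split.
  exact: gaussian_class_continuous.
by move=> i x; have [g _ /(_ x)[]] := gaussian_class_derive i gb.
Qed.

(** Multi-indices are lists, and finitely many of them have size at most [N], so one constant serves
    them all. *)
Lemma seq_bound (I : finType) (F : seq I -> R) (N : nat) :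
  exists M, forall a, (size a <= N)%N -> F a <= M.
Proof.
elim: N F => [|N IH] F; first by exists (F [::]) => a; rewrite leqn0 => /nilP ->.
have /choice[M hM] := fun i => IH (fun a => F (i :: a)).
exists (`|F [::]| + \sum_i `|M i|) => -[_|i a /= aN].
  by rewrite (le_trans (ler_norm _))// lerDl sumr_ge0.
apply: (le_trans (hM i a aN)); apply: (le_trans (ler_norm _)).
rewrite ler_wpDl// (bigD1 i)//= lerDl sumr_ge0//.
Qed.

Lemma gaussian_class_schwartz_bound f (N : nat) : gaussian_class f ->
  exists M, forall a b : seq 'I_n, (size a <= N)%N -> (size b <= N)%N ->
    forall x, `|monomial a x * partial b f x| <= M.
Proof.
move=> gf.
have /choice[m hm] : forall b, exists m : R, forall a, (size a <= N)%N ->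
    forall x, `|monomial a x * partial b f x| <= m.
  move=> b; have /choice[m hm] := fun a => gaussian_class_bound a (gaussian_class_partial b gf).
  by have [M hM] := seq_bound m N; exists M => a aN x; apply: le_trans (hm a x) (hM a aN).
have [M hM] := seq_bound m N; exists M => a b aN bN x.
exact: le_trans (hm b a aN x) (hM b bN).
Qed.

Lemma gaussian_class_schwartz (phi : E -> R[i]) :
  gaussian_class (fun x => complex.Re (phi x)) ->
  gaussian_class (fun x => complex.Im (phi x)) -> schwartz phi.
Proof.
move=> gr gi; split; [exact: gaussian_class_smooth|exact: gaussian_class_smooth|].
move=> N; have [M1 h1] := gaussian_class_schwartz_bound N gr.
have [M2 h2] := gaussian_class_schwartz_bound N gi.
exists (Num.max M1 M2) => a b aN bN x; split; rewrite le_max.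
  by rewrite h1.
by rewrite h2// orbT.
Qed.

End schwartz_gaussian.

Section psi_schwartz.
Context {R : realType} {d : nat}.
Local Notation E := 'rV[R]_d.+1.
Local Notation G := (@gauss_fun R).

(** The linear forms whose squares add up to the exponent of the [m]-th Gaussian in the binomial
    expansion of [psi]. *)
Definition psi_form (a b : R) (v : 'I_d -> R) (m : nat) (k : 'I_d.+1) : E :=
  if unlift ord0 k is Some j
  then a *: (delta_mx ord0 (lift ord0 j) - v j *: delta_mx ord0 ord0)
  else (prof_scale m * b) *: delta_mx ord0 ord0.

Definition psi_quad (a b : R) (v : 'I_d -> R) (m : nat) (x : E) : R :=
  \sum_k inner x (psi_form a b v m k) ^+ 2.

Lemma inner_delta (x : E) i : inner x (delta_mx ord0 i) = x ord0 i.
Proof.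
rewrite /inner (bigD1 i)//= mxE !eqxx mulr1 big1 ?addr0// => j /negbTE ji.
by rewrite mxE ji andbF mulr0.
Qed.

Lemma psi_quadE (a b : R) (v : 'I_d -> R) (m : nat) (x : E) :
  psi_quad a b v m x = (prof_scale m * (b * x ord0 ord0)) ^+ 2 +
    \sum_j (a * (x ord0 (lift ord0 j) - x ord0 ord0 * v j)) ^+ 2.
Proof.
rewrite /psi_quad big_ord_recl; congr (_ + _).
  by rewrite /psi_form unlift_none innerZr inner_delta mulrA.
apply: eq_bigr => j _; rewrite /psi_form liftK innerZr innerBr innerZr !inner_delta.
by rewrite [v j * _]mulrC.
Qed.

(** The first form controls the head coordinate [s]; any other coordinate [z] is then controlled by
    [z^2 <= 2 (z - s v_j)^2 + 2 (s v_j)^2] and [v_j <= 1]. *)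
Lemma psi_quadratic (a b : R) (v : 'I_d -> R) (m : nat) : 0 < a -> 0 < b ->
  (forall j, 0 <= v j <= 1) ->
  quadratic (psi_quad a b v m) (psi_form a b v m) (2 / a ^+ 2 + 2 / b ^+ 2).
Proof.
move=> a0 b0 v01; have a2 : 0 < 2 / a ^+ 2 by rewrite divr_gt0// exprn_gt0.
have b2 : 0 < 2 / b ^+ 2 by rewrite divr_gt0// exprn_gt0.
split=> [//||x i]; first exact: addr_gt0.
rewrite psi_quadE; set s := x ord0 ord0; set A := (_ * _) ^+ 2; set B := \sum_j _.
have B0 : 0 <= B by apply: sumr_ge0 => j _; exact: sqr_ge0.
have sA : s ^+ 2 <= b ^- 2 * A.
  have -> : b ^- 2 * A = m.+1%:R * s ^+ 2.
    by rewrite /A exprMn prof_scale2; field; rewrite gt_eqF.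
  by rewrite ler_peMl ?sqr_ge0// ler1n.
have A0 : 0 <= A by exact: sqr_ge0.
have bb : 0 <= b ^- 2 by rewrite invr_ge0 sqr_ge0.
have aa : 0 <= a ^- 2 by rewrite invr_ge0 sqr_ge0.
have aA : 0 <= a ^- 2 * A by exact: mulr_ge0.
have bB : 0 <= b ^- 2 * B by exact: mulr_ge0.
have aB : 0 <= a ^- 2 * B by exact: mulr_ge0.
have bA : 0 <= b ^- 2 * A by exact: mulr_ge0.
have -> : (2 / a ^+ 2 + 2 / b ^+ 2) * (A + B) =
    2 * (a ^- 2 * A) + 2 * (b ^- 2 * B) + 2 * (a ^- 2 * B) + 2 * (b ^- 2 * A) by ring.
case: (unliftP ord0 i) => [j ->|->]; last first.
  rewrite -/s; move: sA bA aA bB aB; clear; lra.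
set z := x ord0 (lift ord0 j).
have Bj : (z - s * v j) ^+ 2 <= a ^- 2 * B.
  rewrite -[leLHS](@mulKf _ (a ^+ 2)) ?sqrf_eq0 ?gt_eqF//.
  rewrite ler_wpM2l// -exprMn /B (bigD1 j)//= lerDl sumr_ge0// => k _; exact: sqr_ge0.
have sv : (s * v j) ^+ 2 <= s ^+ 2.
  rewrite exprMn ler_piMr ?sqr_ge0//; have /andP[v0 v1] := v01 j.
  by rewrite expr_le1.
have : z ^+ 2 <= 2 * (z - s * v j) ^+ 2 + 2 * (s * v j) ^+ 2.
  have := sqr_ge0 (z - s * v j - s * v j); move: (s * v j) => t.
  by rewrite !sqrrB; lra.
move: Bj sv sA aA bB; clear; lra.
Qed.

Lemma psi_gaussian (a b : R) (v : 'I_d -> R) (x0 : E) (beta : R) : 0 < a -> 0 < b ->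
  (forall j, 0 <= v j <= 1) ->
  gaussian_class (fun x => psi a b v x * cos (inner x x0 + beta)).
Proof.
move=> a0 b0 v01.
have h : gaussian_class (fun x : E => \sum_(m < d.+1) (b * prof_weight m) *
    (x ord0 ord0 * (expR (- psi_quad a b v m x) * cos (inner x x0 + beta)))).
  apply: gaussian_sum => m; apply: gaussian_scale; apply: gaussian_coord.
  by apply: gaussian_atom; exact: psi_quadratic.
rewrite (_ : (fun _ => _) = (fun x : E => \sum_(m < d.+1) (b * prof_weight m) *
    (x ord0 ord0 * (expR (- psi_quad a b v m x) * cos (inner x x0 + beta)))))//.
apply/funext => x; rewrite /psi /prof -[_ * G _ * _]mulrA [G _ * _]mulrC gauss_binomial.
rewrite mulr_sumr !mulr_suml; apply: eq_bigr => m _.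
have -> : expR (- psi_quad a b v m x) = G (prof_scale m * (b * x ord0 ord0)) *
    \prod_j G (a * (x ord0 (lift ord0 j) - x ord0 ord0 * v j)).
  rewrite psi_quadE opprD expRD -sumrN expR_sum//.
ring.
Qed.

End psi_schwartz.

(** * Summation over directions and scales *)

Section frequency_sum.
Context {R : realType}.
Local Notation G := (@gauss_fun R).

(* The increment of [sat] over a unit step dominates the Gaussian, so that sums of
   Gaussians over progressions telescope. *)
Definition sat (x : R) := x / (1 + `|x|).

Lemma sat_le1 x : `|sat x| <= 1.
Proof.
rewrite /sat normrM normfV (@ger0_norm _ (1 + _)) ?addr_ge0//.
by rewrite ler_pdivrMr ?ltr_pwDl// mul1r lerDr.
Qed.

Lemma sat_diff x y : x <= y -> (y - x) / ((1 + `|x|) * (1 + `|y|)) <= sat y - sat x.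
Proof.
move=> xy; have x0 : 0 < 1 + `|x| by rewrite ltr_pwDl.
have y0 : 0 < 1 + `|y| by rewrite ltr_pwDl.
rewrite /sat ler_pdivrMr ?mulr_gt0//.
have -> : (y / (1 + `|y|) - x / (1 + `|x|)) * ((1 + `|x|) * (1 + `|y|)) =
    y * (1 + `|x|) - x * (1 + `|y|) by field; rewrite !gt_eqF.
have [hx|hx] := leP 0 x; have [hy|hy] := leP 0 y.
- by rewrite (ger0_norm hx) (ger0_norm hy); nra.
- by lra.
- by rewrite (ltr0_norm hx) (ger0_norm hy); nra.
- by rewrite (ltr0_norm hx) (ltr0_norm hy); nra.
Qed.

Lemma sat_homo : {homo sat : x y / x <= y}.
Proof.
move=> x y xy; rewrite -subr_ge0; apply: le_trans (sat_diff xy).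
by rewrite divr_ge0 ?subr_ge0// mulr_ge0// addr_ge0.
Qed.

Lemma gauss_le_sat (x t : R) : 0 < t ->
  G x <= 2 * expR 1 * (1 + t^-1) * (sat (x + t) - sat x).
Proof.
(* A step of length at most 1 keeps [1 + |x + s|] below twice [1 + |x|]; the price is
   [s^-1 <= 1 + t^-1]. *)
move=> t0; pose s := Num.min t 1.
have s0 : 0 < s by rewrite lt_min t0 ltr01.
have x1 : 0 < 1 + `|x| by rewrite ltr_pwDl.
have h1 : s / (2 * (1 + `|x|) ^+ 2) <= sat (x + t) - sat x.
  apply: (@le_trans _ _ (sat (x + s) - sat x)); last first.
    by rewrite lerD2r; apply: sat_homo; rewrite lerD2l ge_min lexx.
  apply: le_trans (sat_diff _); last by rewrite lerDl ltW.
  rewrite addrAC subrr add0r ler_pM2l// lef_pV2 ?posrE ?mulr_gt0 ?exprn_gt0// ?ltr_pwDl//.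
  rewrite expr2 mulrCA ler_pM2l//.
  have := ler_normD x s; rewrite (gtr0_norm s0).
  have : s <= 1 by rewrite ge_min lexx orbT.
  by have := normr_ge0 x; lra.
have h2 : G x <= expR 1 / (1 + `|x|) ^+ 2.
  rewrite ler_pdivlMr ?exprn_gt0// mulrC; have := gauss_pow_bound 2 x.
  by rewrite -(natrX _ 2 2) divff.
have h3 : s^-1 <= 1 + t^-1.
  rewrite /s /Num.min; case: ifP => _; first by rewrite lerDr.
  by rewrite invr1 lerDl invr_ge0 ltW.
apply: (le_trans h2).
have -> : expR 1 / (1 + `|x|) ^+ 2 = 2 * expR 1 * s^-1 * (s / (2 * (1 + `|x|) ^+ 2)).
  by field; rewrite !gt_eqF.
apply: ler_pM => //.
- by rewrite !mulr_ge0 ?expR_ge0// invr_ge0 ltW.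
- by rewrite divr_ge0 ?ltW// mulr_gt0// exprn_gt0.
- by rewrite ler_wpM2l// mulr_ge0// expR_ge0.
Qed.

Lemma gauss_progression_pos (x t : R) q : 0 < t ->
  \sum_(i < q) G (x + t * i%:R) <= 4 * expR 1 * (1 + t^-1).
Proof.
move=> t0; pose F i := sat (x + t * i%:R).
have C0 : 0 <= 2 * expR 1 * (1 + t^-1).
  by rewrite !mulr_ge0 ?expR_ge0// addr_ge0// invr_ge0 ltW.
apply: (@le_trans _ _ (\sum_(0 <= i < q) 2 * expR 1 * (1 + t^-1) * (F i.+1 - F i))).
  rewrite big_mkord; apply: ler_sum => i _; apply: (le_trans (gauss_le_sat _ t0)).
  rewrite /F (_ : x + t * i.+1%:R = x + t * i%:R + t)//.
  by rewrite -natr1 mulrDr mulr1 addrA.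
rewrite -mulr_sumr telescope_sumr//.
apply: (@le_trans _ _ (2 * expR 1 * (1 + t^-1) * 2)); last first.
  by rewrite le_eqVlt; apply/orP; left; apply/eqP; ring.
apply: ler_wpM2l => //; have := sat_le1 (x + t * q%:R); have := sat_le1 (x + t * 0%:R).
by rewrite !ler_norml -/(F q) -/(F 0%N) => /andP[? ?] /andP[? ?]; lra.
Qed.

Lemma gauss_progression (x t : R) q : t != 0 ->
  \sum_(i < q) G (x - t * i%:R) <= 4 * expR 1 * (1 + `|t|^-1).
Proof.
move=> t0; have [tp|tn] := ltP 0 t.
  have := gauss_progression_pos (- x) q tp; rewrite (gtr0_norm tp); apply: le_trans.
  apply: ler_sum => i _; rewrite le_eqVlt; apply/orP; left; apply/eqP.
  by rewrite /gauss_fun -sqrrN opprB addrC.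
have tp : 0 < - t by rewrite oppr_gt0 lt_neqAle t0.
have := gauss_progression_pos x q tp; rewrite (ler0_norm tn); apply: le_trans.
by apply: ler_sum => i _; rewrite mulNr.
Qed.

Definition grid d q (m : {ffun 'I_d -> 'I_q}) (j : 'I_d) : R := (m j)%:R / q%:R.

Lemma grid01 d q (m : {ffun 'I_d -> 'I_q}) j : 0 <= grid m j <= 1.
Proof.
have q0 : (0 < q)%N by apply: leq_ltn_trans (ltn_ord (m j)).
rewrite /grid divr_ge0//= ler_pdivrMr ?ltr0n// mul1r ler_nat.
exact: ltnW.
Qed.

Lemma psi_grid_sum d (al ka : R) : 0 < al -> 0 < ka -> exists2 C : R, 0 < C &
  forall (r : R) (q : nat) (x : 'rV[R]_d.+1), 0 < r -> (0 < q)%N ->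
    \sum_(m : {ffun 'I_d -> 'I_q}) `|psi (r / al) (ka * r * q%:R^-1) (grid m) x| <=
    C * (`|ka * r * q%:R^-1 * x ord0 ord0| / (1 + `|ka * r * q%:R^-1 * x ord0 ord0|) ^+ 2).
Proof.
move=> al0 ka0; pose L := 4 * expR 1 * (1 + al * ka).
have L0 : 0 < L by rewrite !mulr_gt0 ?expR_gt0// ltr_wpDr// mulr_ge0// ltW.
exists (L ^+ d * expR ((d.*2.+2)%:R ^+ 2 / 4)).
  by rewrite mulr_gt0 ?exprn_gt0 ?expR_gt0.
move=> r q x r0 q0; have q0' : 0 < q%:R :> R by rewrite ltr0n.
set b := ka * r * q%:R^-1; have b0 : 0 < b by rewrite /b !mulr_gt0// invr_gt0.
set s := x ord0 ord0; set t := b * s.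
(* A sum over the grid of products over coordinates is a product of one-dimensional sums, each of a
   Gaussian over a progression of step [t / (al * ka)] up to sign. *)
have -> : \sum_(m : {ffun 'I_d -> 'I_q}) `|psi (r / al) b (grid m) x| =
    `|prof d t| * \prod_j \sum_(i < q) G (r / al * x ord0 (lift ord0 j) - (r / al * s / q%:R) * i%:R).
  rewrite bigA_distr_bigA mulr_sumr; apply: eq_bigr => m _.
  rewrite /psi [LHS]normrM; congr (_ * _).
  rewrite ger0_norm ?prodr_ge0//; last by move=> *; exact: gauss_fun_ge0.
  apply: eq_bigr => j _; rewrite (_ : r / al * (_ - _) =
    r / al * x ord0 (lift ord0 j) - r / al * s / q%:R * (m j)%:R)//.
  by rewrite /grid -/s; field; rewrite !gt_eqF.
have [s0|s0] := eqVneq s 0.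
  by rewrite /t s0 mulr0 /prof !mul0r normr0 !mul0r mulr0.
have t0 : t != 0 by rewrite mulf_neq0// gt_eqF.
have u0 : 0 < `|t| by rewrite normr_gt0.
have hp : \prod_j \sum_(i < q) G (r / al * x ord0 (lift ord0 j) - (r / al * s / q%:R) * i%:R)
    <= L ^+ d * (1 + `|t|^-1) ^+ d.
  rewrite -exprMn -[X in _ <= _ ^+ X](card_ord d) -prodr_const.
  apply: ler_prod => j _; rewrite sumr_ge0//=; last by move=> *; exact: gauss_fun_ge0.
  have tn0 : r / al * s / q%:R != 0.
    apply: mulf_neq0; last by rewrite invr_neq0 ?gt_eqF.
    by apply: mulf_neq0 => //; rewrite gt_eqF// divr_gt0.
  apply: (le_trans (gauss_progression _ _ tn0)).
  rewrite /L -[leRHS]mulrA; apply: ler_wpM2l; first by rewrite mulr_ge0// expR_ge0.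
  have -> : `|r / al * s / q%:R|^-1 = al * ka * `|t|^-1.
    rewrite /t /b !normrM !normfV (gtr0_norm r0) (gtr0_norm al0) (gtr0_norm q0') (gtr0_norm ka0).
    by field; rewrite !gt_eqF ?normr_gt0.
  have ti0 : 0 <= `|t|^-1 by rewrite invr_ge0.
  have ak0 : 0 <= al * ka by rewrite mulr_ge0// ltW.
  by rewrite mulrDl mul1r mulrDr mulr1; move: ti0 ak0; clear; lra.
apply: (le_trans (ler_wpM2l (normr_ge0 _) hp)).
rewrite mulrCA -[leRHS]mulrA ler_wpM2l ?exprn_ge0 ?(ltW L0)//.
exact: prof_bound.
Qed.

(** Since [t k - t k.+1 >= t k / 2], each term is at most twice the decrease of [sat] from [t k] to
    [t k.+1], and the sum telescopes. *)
Lemma dyadic_sum (t : nat -> R) N : (forall k, 0 <= t k) -> (forall k, 2 * t k.+1 <= t k) ->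
  \sum_(k < N) t k / (1 + t k) ^+ 2 <= 2.
Proof.
move=> t0 t2.
apply: (@le_trans _ _ (\sum_(0 <= k < N) 2 * (- sat (t k.+1) - - sat (t k)))).
  rewrite big_mkord; apply: ler_sum => k _.
  have tk := t0 k; have tk1 := t0 k.+1; have h := t2 k.
  have hh : t k.+1 <= t k by lra.
  have h2 := sat_diff hh; rewrite (ger0_norm tk) (ger0_norm tk1) in h2.
  rewrite opprK [- sat _ + _]addrC.
  apply: (@le_trans _ _ (2 * ((t k - t k.+1) / ((1 + t k.+1) * (1 + t k))))); last by rewrite ler_pM2l.
  have p1 : 0 < 1 + t k by rewrite ltr_pwDl.
  have p2 : 0 < 1 + t k.+1 by rewrite ltr_pwDl.
  rewrite mulrA expr2; apply: ler_pM => //; first by rewrite invr_ge0 mulr_ge0// ltW.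
    lra.
  by rewrite lef_pV2 ?posrE ?mulr_gt0// ler_wpM2r ?(ltW p1)// lerD2l.
rewrite -mulr_sumr telescope_sumr//.
have := sat_le1 (t N); rewrite ler_norml => /andP[_ h].
have h1 : sat (t 0%N) <= 1 by have := sat_le1 (t 0%N); rewrite ler_norml => /andP[].
have h2 : 0 <= sat (t N) by rewrite /sat divr_ge0// addr_ge0.
lra.
Qed.

Lemma psi_sum_bound d (al ka : R) : 0 < al -> 0 < ka -> exists2 C : R, 0 < C &
  forall (N : nat) (r : nat -> R) (q : nat -> nat) (x : 'rV[R]_d.+1),
    (forall k, 0 < r k) -> (forall k, r k = 2 * r k.+1) ->
    (forall k, (0 < q k)%N) -> (forall k, (q k <= q k.+1)%N) ->
    \sum_(k < N) \sum_(m : {ffun 'I_d -> 'I_(q k)})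
      `|psi (r k / al) (ka * r k * (q k)%:R^-1) (grid m) x| <= C.
Proof.
move=> al0 ka0; have [C C0 hC] := @psi_grid_sum d al ka al0 ka0.
exists (C * 2); first by rewrite mulr_gt0.
move=> N r q x r0 r2 q0 qq.
pose t k := `|ka * r k * (q k)%:R^-1 * x ord0 ord0|.
apply: (@le_trans _ _ (\sum_(k < N) C * (t k / (1 + t k) ^+ 2))).
  by apply: ler_sum => k _; exact: hC.
rewrite -mulr_sumr ler_pM2l//.
have tE k : t k = ka * r k * (q k)%:R^-1 * `|x ord0 ord0|.
  by rewrite /t normrM ger0_norm// !mulr_ge0 ?invr_ge0// ltW.
apply: (@dyadic_sum t) => [k|k]; first exact: normr_ge0.
rewrite !tE (r2 k) mulrA ler_wpM2r//.
rewrite (_ : 2 * (ka * r k.+1 / (q k.+1)%:R) = ka * (2 * r k.+1) / (q k.+1)%:R); last by ring.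
apply: ler_wpM2l; first by rewrite mulr_ge0 ?(ltW ka0)// mulr_ge0// ltW.
by rewrite lef_pV2 ?posrE ?ltr0n// ler_nat.
Qed.

End frequency_sum.

(** * Open sets as countable unions of rational boxes *)

Section open_measurable.
Context {R : realType} {n : nat}.

Let box (c : {ffun 'I_n -> rat} * nat) : set 'rV[R]_n :=
  [set x | forall i, `|x ord0 i - ratr (c.1 i)| < c.2.+1%:R^-1].

Let measurable_box c : measurable (box c).
Proof.
rewrite (_ : box c = \big[setI/setT]_(i < n) [set x : 'rV[R]_n | `|x ord0 i - ratr (c.1 i)| < c.2.+1%:R^-1]).
  apply: bigsetI_measurable => i _.
  have mf : measurable_fun setT (fun x : 'rV[R]_n => `|x ord0 i - ratr (c.1 i)|).
    by apply: measurableT_comp => //; apply: measurable_funB => //; exact: measurable_coord.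
  rewrite (_ : [set x | _] = (fun x : 'rV[R]_n => `|x ord0 i - ratr (c.1 i)|) @^-1` `]-oo, c.2.+1%:R^-1[).
    by rewrite -[X in measurable X]setTI; apply: mf.
  by apply/seteqP; split => x /=; rewrite in_itv.
rewrite -bigcap_seq; apply/seteqP; split => x /= h.
  by move=> i _; exact: h.
by move=> i; apply: h; rewrite /= mem_index_enum.
Qed.

Lemma open_measurable_rV (D : set 'rV[R]_n) : open D -> measurable D.
Proof.
move=> oD.
pose T : countType := ({ffun 'I_n -> rat} * nat)%type.
pose B k : set 'rV[R]_n := if unpickle k is Some c then
  (if `[< box c `<=` D >] then box c else set0) else set0.
rewrite (_ : D = \bigcup_k B k).
  apply: bigcupT_measurable => k; rewrite /B.
  by case: (unpickle k) => [c|//]; case: ifP => _ //; exact: measurable_box.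
apply/seteqP; split => [x Dx|x [k _]]; last first.
  by rewrite /B; case: (unpickle k) => [c|//]; case: asboolP => // cD /cD.
have /nbhs_normP[e /= e0 he] : nbhs x D by exact: open_nbhs_nbhs.
(* The box contains [x] but is centred at a nearby rational point, so its diameter and not only its
   radius has to be below [e]. *)
pose k := Num.trunc (2 / e).
have ek : 2 * k.+1%:R^-1 < e.
  have : 2 / e < k.+1%:R by exact: truncnS_gt.
  by rewrite ltr_pdivrMr// ltr_pdivrMr// mulrC.
have k0 : 0 < k.+1%:R^-1 :> R by rewrite invr_gt0.
have /choice[c hc] : forall i : 'I_n, exists q : rat, `|x ord0 i - ratr q| < k.+1%:R^-1.
  move=> i; have /rat_in_itvoo[q] : x ord0 i - k.+1%:R^-1 < x ord0 i + k.+1%:R^-1.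
    by rewrite ltrD2l (lt_trans _ k0)// oppr_lt0.
  rewrite in_itv/= => /andP[h1 h2]; exists q.
  by rewrite ltr_norml; move: (k.+1%:R^-1 : R) h1 h2; clear => K *; apply/andP; split; lra.
pose cc : T := (finfun c, k).
have xc : box cc x by move=> i; rewrite /= ffunE.
exists (pickle cc) => //; rewrite /B pickleK; case: asboolP => // ncD; exfalso; apply: ncD.
move=> y yc; apply: he => /=; apply: le_lt_trans ek.
apply: rV_norm_le => [|i j]; first by rewrite mulr_ge0// ltW.
rewrite ord1 !mxE; have := yc j; have := xc j; rewrite /= ffunE => h1 h2.
have -> : x ord0 j - y ord0 j = (x ord0 j - ratr (c j)) - (y ord0 j - ratr (c j)) by ring.
by apply: (le_trans (ler_normB _ _)); rewrite mulr2n mulrDl mul1r lerD// ltW.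
Qed.

End open_measurable.

(** * Pairing the Fourier transform of the domain with a test function *)

Section A_space_bound.
Context {R : realType} {d : nat}.
Local Notation E := 'rV[R]_d.+1.
Local Notation mu := (lebesgue_rV R d.+1).

Lemma Lp_has_integral (p : R) (g : E -> R[i]) : 1 <= p -> Lp p%:E g ->
  exists2 S, has_integral mu (fun x => Normc.normc (g x) `^ p) S & 0 <= S.
Proof.
move=> p1 [mr mi]; rewrite /finite_norm unlock => fin.
have p0 : p != 0 by rewrite gt_eqF// (lt_le_trans _ p1).
have mn : measurable_fun setT (fun x => Normc.normc (g x) `^ p).
  apply: (@measurableT_comp _ _ _ _ _ _ (fun t : R => t `^ p)).
    exact: measurable_powR.
  rewrite (_ : (fun x => _) = fun x => Num.sqrt (complex.Re (g x) ^+ 2 + complex.Im (g x) ^+ 2)).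
    apply: measurableT_comp => //.
      by apply: continuous_measurable_fun; exact: sqrt_continuous.
    by apply: measurable_funD; apply: measurable_funX.
  by apply/funext => x; case: (g x).
have {}fin : (\int[mu]_x (Normc.normc (g x) `^ p)%:E < +oo)%E.
  have := lty_poweRy (_ : p^-1 != 0) fin; rewrite invr_eq0 => /(_ p0).
  rewrite (eq_integral (fun x => (Normc.normc (g x) `^ p)%:E))// => x _ /=.
  rewrite ger0_norm//; case: (g x) => ? ?; exact: sqrtr_ge0.
have If : mu.-integrable setT (EFin \o (fun x => Normc.normc (g x) `^ p)).
  apply/integrableP; split; first exact/measurable_EFinP.
  rewrite (_ : integral _ _ _ = \int[mu]_x (Normc.normc (g x) `^ p)%:E)%E//.
  by apply: eq_integral => x _ /=; rewrite ger0_norm ?powR_ge0.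
have h := has_integral_Rintegral If.
eexists; first exact: h.
by apply: has_integral_ge0 h _ => x; exact: powR_ge0.
Qed.

(** The modulation moves the centre of the transform to [x0]. As [psi] is odd, the transform is
    purely imaginary, so the imaginary part of the pairing carries all the information. *)
Definition wave (a b : R) (v : 'I_d -> R) (x0 x : E) : R[i] :=
  (psi a b v x)%:C%C * cis (inner x0 x).

Lemma schwartz_wave a b v x0 : 0 < a -> 0 < b -> (forall j, 0 <= v j <= 1) ->
  schwartz (wave a b v x0).
Proof.
move=> a0 b0 v01; apply: gaussian_class_schwartz.
  rewrite (_ : (fun x => _) = fun x => psi a b v x * cos (inner x x0 + 0)).
    exact: psi_gaussian.
  by apply/funext => x; rewrite /wave /= mul0r subr0 addr0 innerC.
rewrite (_ : (fun x => _) = fun x => psi a b v x * cos (inner x x0 + (- (pi / 2)))).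
  exact: psi_gaussian.
by apply/funext => x; rewrite /wave /= mul0r addr0 innerC cosBpihalf.
Qed.

Lemma Im_fourier_wave a b v x0 x : 0 < a -> 0 < b ->
  complex.Im (fourier (wave a b v x0) x) = - psi_hat a b v (x - x0).
Proof.
move=> a0 b0; rewrite /fourier /cintegral /=.
apply: (has_integral_RintegralE (mu := mu)).
apply: (eq_has_integral (has_integralN (has_integral_psi_sin v (x - x0) a0 b0))) => // t.
rewrite /wave /cis /= !mul0r subr0 addr0 sinN cosN innerBl sinB; ring.
Qed.

Lemma Im_le_normc (z : R[i]) : `|complex.Im z| <= Normc.normc z.
Proof.
case: z => u w /=; rewrite -[leLHS]sqrtr_sqr ler_sqrt ?addr_ge0 ?sqr_ge0//.
by rewrite lerDr sqr_ge0.
Qed.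

Lemma normc_cis (t : R) : Normc.normc (cis t) = 1.
Proof. by rewrite /cis /= cos2Dsin2 sqrtr1. Qed.

(* Uses [|g| <= M + M^(1-p) |g|^p]; the choice of [M] is left open. *)
Lemma A_space_test (p : R) (D : set E) (g : E -> R[i]) a b v x0 I c0 M :
  1 <= p -> Lp p%:E g ->
  (forall phi, schwartz phi ->
     fourier_distr (distr_of_fun (char_fun D)) phi = distr_of_fun g phi) ->
  0 < a -> 0 < b -> (forall j, 0 <= v j <= 1) -> 0 < M ->
  has_integral mu (fun x => \1_D x * psi_hat a b v (x - x0)) I ->
  has_integral mu (fun x => `|psi a b v x|) c0 ->
  exists2 J, has_integral mu (fun x => Normc.normc (g x) `^ p * `|psi a b v x|) J &
    - I <= M * c0 + M `^ (1 - p) * J.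
Proof.
move=> p1 gp gD a0 b0 v01 M0 hI hc0.
have [S hS S0] := Lp_has_integral p1 gp.
have [B hB] : exists B, forall x, `|psi a b v x| <= B.
  have [B hB] := gaussian_class_bound [::] (psi_gaussian 0 0 a0 b0 v01).
  exists B => x; have := hB x; rewrite /monomial big_nil mul1r addr0.
  by rewrite innerC (_ : inner 0 x = 0) ?cos0 ?mulr1// -(scale0r (0 : E)) innerZl mul0r.
have mpsi := has_integral_measurable hc0.
have mS := has_integral_measurable hS.
have [|J hJ _] := has_integral_dom (measurable_funM mS mpsi) (has_integralZ B hS).
  move=> x; rewrite normrM normr_id ger0_norm ?powR_ge0// mulrC ler_wpM2r ?powR_ge0//.
exists J => //.
have /(congr1 (@complex.Im R)) := gD _ (schwartz_wave x0 a0 b0 v01).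
rewrite /fourier_distr /distr_of_fun /cintegral /=.
have -> : (\int[mu]_x complex.Im (char_fun D x * fourier (wave a b v x0) x))%R = - I.
  apply: has_integral_RintegralE; apply: (eq_has_integral (has_integralN hI)) => // x.
  rewrite -mulrN -(Im_fourier_wave v x0 x a0 b0) /char_fun.
  by case: (fourier _ _) => u w /=; rewrite mul0r addr0.
move=> ->.
have [_ mi _] := gp; have [mr _ _] := gp.
have hdom := has_integralD (has_integralZ M hc0) (has_integralZ (M `^ (1 - p)) hJ).
have mIm : measurable_fun setT (fun x => complex.Im (g x * wave a b v x0 x)).
  have minner : measurable_fun setT (fun x : E => inner x0 x).
    exact: (measurable_lin (fun j => x0 ord0 j)).
  rewrite (_ : (fun x => _) = fun x => complex.Re (g x) * (psi a b v x * sin (inner x0 x)) +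
      complex.Im (g x) * (psi a b v x * cos (inner x0 x))).
    apply: measurable_funD; apply: measurable_funM => //; apply: measurable_funM;
      try exact: measurable_psi; apply: measurableT_comp minner;
      apply: continuous_measurable_fun; [exact: continuous_sin|exact: continuous_cos].
  by apply/funext => x; case: (g x) => u w; rewrite /wave /= !mul0r subr0 addr0.
have [|K hK Kle] := has_integral_dom mIm hdom.
  move=> x; apply: (le_trans (Im_le_normc _)).
  rewrite Normc.normcM /wave Normc.normcM normc_cis mulr1.
  have -> : Normc.normc (psi a b v x)%:C%C = `|psi a b v x|.
    by rewrite /= expr0n addr0 sqrtr_sqr.
  rewrite mulrA -mulrDl ler_wpM2r//.
  set G := Normc.normc (g x).
  have G0 : 0 <= G by rewrite /G; case: (g x) => ? ?; exact: sqrtr_ge0.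
  have [GM|MG] := leP G M.
    by rewrite (le_trans GM)// lerDl mulr_ge0// powR_ge0.
  apply: (@le_trans _ _ (M `^ (1 - p) * G `^ p)); last by rewrite lerDr ltW.
  have GG0 : 0 < G by apply: lt_trans MG.
  have GE : G = G `^ (1 - p) * G `^ p.
    rewrite -powRD; last by rewrite subrK gt_eqF ?implybT.
    by rewrite subrK powRr1.
  rewrite {1}GE ler_wpM2r ?powR_ge0// -opprB !powRN.
  rewrite lef_pV2 ?posrE ?powR_gt0//; apply: ge0_ler_powR.
  - by rewrite subr_ge0.
  - by rewrite nnegrE ltW.
  - by rewrite nnegrE.
  - exact: ltW.
rewrite (has_integral_RintegralE hK); exact: le_trans (ler_norm _) Kle.
Qed.

End A_space_bound.

(** * The series over dyadic scales *)

Section series_bound.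
Context {R : realType} {d : nat}.
Local Notation E := 'rV[R]_d.+1.
Local Notation mu := (lebesgue_rV R d.+1).

Lemma A_space_series (p : R) (D : set E) (nu : E -> E) : 1 <= p ->
  D !=set0 -> open D -> bounded_set D -> C1_boundary D ->
  (forall z, boundary D z -> outer_unit_normal D z (nu z)) ->
  A_space p%:E (distr_of_fun (char_fun D)) ->
  exists S et : R, 0 < et /\ forall (N : nat) (r : nat -> R) (q : nat -> nat),
    (forall k, 0 < r k) -> (forall k, r k = 2 * r k.+1) ->
    (forall k, (0 < q k)%N) -> (forall k, (q k <= q k.+1)%N) ->
    (forall k, (q k)%:R^-1 <= et) ->
    (forall k x y, boundary D x -> boundary D y -> enorm (x - y) <= r k ->
       enorm (nu x - nu y) <= (q k)%:R^-1) ->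
    \sum_(k < N) (q k)%:R ^+ d * (r k ^+ d.+1 / (q k)%:R) `^ (p - 1) <= S.
Proof.
move=> p1 D0 oD bD C1 Nn [_ [g gp gD]].
have mD := open_measurable_rV oD.
have [al [ka [et [c1 [al0 ka0 et0 c10 hker]]]]] := @psi_hat_integral_le R d.
have [K K0 hK] := has_integral_psi_abs (R := R) d.
have [C C0 hC] := psi_sum_bound d al0 ka0.
have [S0 hS S00] := Lp_has_integral p1 gp.
(* With [M] as below, [J >= c1 / 2 * M ^ (p - 1)], and [M] is a constant times [r k ^+ d.+1 / q k];
   [c2] collects the factors independent of [k]. *)
pose c2 := c1 / 2 * (c1 * ka / (2 * K * al ^+ d)) `^ (p - 1).
have c3 : 0 < c1 * ka / (2 * K * al ^+ d).
  by rewrite divr_gt0 ?mulr_gt0// exprn_gt0.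
have c20 : 0 < c2 by rewrite mulr_gt0 ?divr_gt0// powR_gt0.
exists (C * S0 / c2), et; split => // N r q r0 r2 q0 qq qet hnu.
have q0' k : 0 < (q k)%:R :> R by rewrite ltr0n.
have step k : exists J, has_integral mu (fun x =>
      \sum_(m : {ffun 'I_d -> 'I_(q k)}) Normc.normc (g x) `^ p *
        `|psi (r k / al) (ka * r k * (q k)%:R^-1) (grid m) x|) J /\
    c2 * ((q k)%:R ^+ d * (r k ^+ d.+1 / (q k)%:R) `^ (p - 1)) <= J.
  pose a := r k / al; pose b := ka * r k * (q k)%:R^-1.
  have a0 : 0 < a by rewrite divr_gt0.
  have b0 : 0 < b by rewrite !mulr_gt0 ?invr_gt0.
  have /choice[J hJ] : forall m : {ffun 'I_d -> 'I_(q k)}, exists J,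
      has_integral mu (fun x => Normc.normc (g x) `^ p * `|psi a b (grid m) x|) J /\
      c2 * (r k ^+ d.+1 / (q k)%:R) `^ (p - 1) <= J.
    move=> m; have v01 := @grid01 R d (q k) m.
    have th0 : direction (grid m) != 0 :> E.
      apply/eqP => th0; have /andP[+ _] := enorm_direction v01.
      by rewrite th0 -(scale0r (0 : E)) enormZ normr0 mul0r ler10.
    have [x0 Bx0 hcap] := boundary_cap D0 oD bD C1 Nn th0.
    have w0 : 0 <= (q k)%:R^-1 :> R by rewrite invr_ge0 ltW.
    have hnu' z : boundary D z -> enorm (z - x0) <= r k -> enorm (nu z - nu x0) <= (q k)%:R^-1.
      by move=> Bz; exact: hnu.
    have etaq : 0 < ((q k)%:R^-1 : R) <= et.
      by apply/andP; split; [rewrite invr_gt0|exact: qet].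
    have [I hI Ile] := hker D x0 (grid m) (r k) (q k)%:R^-1 mD v01 (r0 k) etaq
      (hcap (r k) (q k)%:R^-1 w0 hnu').
    have [c0 hc0 /andP[c00 c0le]] := hK a b (grid m) a0 b0.
    (* The integral [c0] of [|psi|] is at most [K / (b * a ^+ d)], so [M * c0 <= c1 / 2] and half of
       the lower bound [c1] survives. *)
    pose M := c1 / 2 * (b * a ^+ d) / K.
    have ba : 0 < b * a ^+ d by rewrite mulr_gt0// exprn_gt0.
    have M0 : 0 < M by rewrite divr_gt0// mulr_gt0// divr_gt0.
    have [J hJ Jle] := A_space_test p1 gp gD a0 b0 v01 M0 hI hc0.
    exists J; split => //.
    have Mc : M * c0 <= c1 / 2.
      apply: (le_trans (ler_wpM2l (ltW M0) c0le)).
      rewrite /M le_eqVlt; apply/orP; left; apply/eqP.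
      by move: ba K0; move: (b * a ^+ d) => t t0 K0; field; rewrite !gt_eqF.
    have MJ : c1 / 2 <= M `^ (1 - p) * J by move: Ile Jle Mc; clear; lra.
    have ME : M = c1 * ka / (2 * K * al ^+ d) * (r k ^+ d.+1 / (q k)%:R).
      rewrite /M /a /b exprMn exprVn exprS.
      by field; rewrite !gt_eqF ?exprn_gt0.
    have rq0 : 0 < r k ^+ d.+1 / (q k)%:R by rewrite divr_gt0// exprn_gt0.
    rewrite /c2 -mulrA -powRM ?(ltW c3) ?(ltW rq0)//.
    rewrite -ME; move: MJ; rewrite -opprB powRN ler_pdivlMl ?powR_gt0//.
    by rewrite mulrC.
  exists (\sum_m J m); split.
    by apply: has_integral_sum => m; case: (hJ m).
  apply: (@le_trans _ _ (\sum_(m : {ffun 'I_d -> 'I_(q k)}) c2 * (r k ^+ d.+1 / (q k)%:R) `^ (p - 1))).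
    by rewrite sumr_const card_ffun !card_ord -[leRHS]mulr_natl natrX mulrCA.
  by apply: ler_sum => m _; case: (hJ m).
have /choice[J hJ] := step.
rewrite ler_pdivlMr// mulrC mulr_sumr.
apply: (@le_trans _ _ (\sum_(k < N) J k)).
  by apply: ler_sum => k _; case: (hJ k).
have h := has_integral_sum (index_enum 'I_N) (fun k : 'I_N => (hJ k).1).
apply: (has_integral_le h (has_integralZ C hS)) => x.
under eq_bigr do rewrite -mulr_sumr.
rewrite -mulr_sumr mulrC ler_wpM2r ?powR_ge0//.
exact: hC.
Qed.

End series_bound.

(** * From dyadic sums to the integral *)

Section modulus_facts.
Context {R : realType} {d : nat}.
Local Notation E := 'rV[R]_d.+1.

(** The set under [sup] is bounded, by 2, because normals are unit vectors; otherwise [sup] would be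
    a default value. *)
Lemma normal_diff_le_modulus (D : set E) (nu : E -> E) (x y : E) (dl : R) :
  (forall z, boundary D z -> outer_unit_normal D z (nu z)) ->
  boundary D x -> boundary D y -> enorm (x - y) <= dl ->
  enorm (nu x - nu y) <= modulus (boundary D) nu dl.
Proof.
move=> Nn Bx By xy; apply: ub_le_sup; last by exists x, y.
exists 2 => _ [x' [y' [Bx' By' _ ->]]].
have [nx _ _] := Nn _ Bx'; have [ny _ _] := Nn _ By'.
rewrite -(ler_pXn2r (_ : (0 < 2)%N)) ?nnegrE ?enorm_ge0// enorm_sqr.
rewrite innerBl !innerBr -!enorm_sqr nx ny (innerC (nu y')).
have := inner_le_enorm (nu x') (nu y'); rewrite nx ny mulr1 ler_norml => /andP[h _].
by rewrite !expr1n; lra.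
Qed.

End modulus_facts.

Section dyadic_scales.
Context {R : realType}.
Implicit Types rho : R.

Definition dyad rho (k : nat) : R := rho / 2 ^+ k.

Lemma dyad_gt0 rho k : 0 < rho -> 0 < dyad rho k.
Proof. by move=> r0; rewrite divr_gt0// exprn_gt0. Qed.

Lemma dyadS rho k : dyad rho k = 2 * dyad rho k.+1.
Proof. by rewrite /dyad exprS; field; rewrite expf_neq0. Qed.

Lemma dyad_le rho k l : 0 < rho -> (k <= l)%N -> dyad rho l <= dyad rho k.
Proof.
move=> r0 kl; rewrite /dyad ler_pM2l// lef_pV2 ?posrE ?exprn_gt0//.
by rewrite ler_eXn2l// ltr1n.
Qed.

Lemma dyad_small rho (x : R) : 0 < rho -> 0 < x -> exists k, dyad rho k <= x.
Proof.
move=> r0 x0; exists (Num.trunc (rho / x)).+1.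
rewrite /dyad ler_pdivrMr ?exprn_gt0// mulrC -ler_pdivrMr//.
apply: (le_trans (ltW (truncnS_gt _))).
by rewrite -natrX ler_nat ltnW// ltn_expl.
Qed.

End dyadic_scales.

Section scale_sum.
Context {R : realType} (d : nat) (p : R) (omega : R -> R) (Cw dl0 et S : R).
Context (pd : p < d.+1%:R) (Cw0 : 0 < Cw) (dl00 : 0 < dl0) (et0 : 0 < et).
Context (omega_nd : forall x y, 0 <= x -> x <= y -> omega x <= omega y).
Context (omega_cvg : omega x @[x --> 0^'+] --> (0 : R)).
Context (omega_ge0 : forall x, 0 <= x -> 0 <= omega x).
(** The bound of [A_space_series], with the condition on the normal replaced by one on [omega] at
    scales below [dl0]. *)
Context (HS : forall (N : nat) (r : nat -> R) (q : nat -> nat),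
  (forall k, 0 < r k < dl0) -> (forall k, r k = 2 * r k.+1) ->
  (forall k, (0 < q k)%N) -> (forall k, (q k <= q k.+1)%N) ->
  (forall k, (q k)%:R^-1 <= et) -> (forall k, Cw * omega (r k) <= (q k)%:R^-1) ->
  \sum_(k < N) (q k)%:R ^+ d * (r k ^+ d.+1 / (q k)%:R) `^ (p - 1) <= S).

Local Notation n := (d.+1%:R : R).

(* [q_k] is the integer part of [1 / (Cw * omega (r_k) + eps)]; a positive [eps]
   is needed as long as [omega] may vanish. *)
Lemma eps_sum_le : exists rho be : R, [/\ 0 < rho, rho <= 1 / 2, 0 < be &
  forall eps N, 0 < eps <= be -> \sum_(k < N) dyad rho k `^ (n * (p - 1)) *
    (2 * (Cw * omega (dyad rho k) + eps)) `^ (p - n) <= S].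
Proof.
(* [Cw * omega] and [eps] get one [be] each: [w k <= 2 * be] gives [w k <= 1 / 2], so [q k > 0], and
   [1 / q k <= 2 * w k <= et]. *)
pose be := Num.min (1 / 2) (et / 2) / 2.
have be0 : 0 < be by rewrite divr_gt0// lt_min !divr_gt0.
have be1 : 2 * be <= 1 / 2 by rewrite /be mulrC divfK// ge_min lexx.
have be2 : 2 * be <= et / 2 by rewrite /be mulrC divfK// ge_min lexx orbT.
have [rho [rho0 rho1 rhodl rhow]] : exists rho : R,
    [/\ 0 < rho, rho <= 1 / 2, rho < dl0 & Cw * omega rho <= be].
  have h : \forall x \near (0:R)^'+, omega x < be / Cw.
    by apply: (cvgr_lt 0 omega_cvg); rewrite divr_gt0.
  near (0 : R)^'+ => rho; exists rho; split.
  - by near: rho; exact: nbhs_right_gt.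
  - by near: rho; apply: nbhs_right_le.
  - by near: rho; apply: nbhs_right_lt.
  - by rewrite mulrC -ler_pdivlMr// ltW//; near: rho; exact: h.
exists rho, be; split => // eps N /andP[eps0 epsbe].
have d0 k : 0 < dyad rho k by exact: dyad_gt0.
have dle k : dyad rho k <= rho.
  by apply: le_trans (dyad_le rho0 (leq0n k)) _; rewrite /dyad expr0 divr1.
pose w k := Cw * omega (dyad rho k) + eps.
have wo k : 0 <= Cw * omega (dyad rho k) by apply: mulr_ge0; [exact: ltW|apply: omega_ge0; exact: ltW].
have w0 k : 0 < w k by rewrite ltr_wpDl.
have wbe k : w k <= 2 * be.
  rewrite mulr2n mulrDl mul1r lerD//; apply: le_trans rhow.
  by rewrite ler_pM2l//; apply: omega_nd => //; exact: ltW.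
pose q k := Num.trunc (w k)^-1.
have wi0 k : 0 <= (w k)^-1 by rewrite invr_ge0 ltW.
have q0 k : (0 < q k)%N.
  rewrite truncn_gt0 invr_ge1 ?unitfE ?gt_eqF//.
  by apply: (le_trans (wbe k)); apply: (le_trans be1); lra.
have q0' k : 0 < (q k)%:R :> R by rewrite ltr0n.
have qw k : w k <= (q k)%:R^-1.
  rewrite -[leLHS]invrK lef_pV2 ?posrE ?invr_gt0//.
  by rewrite truncn_le.
have qw2 k : (q k)%:R^-1 <= 2 * w k.
  rewrite -[leRHS]invrK lef_pV2 ?posrE ?invr_gt0 ?mulr_gt0//.
  have h1 : (w k)^-1 < (q k)%:R + 1 by rewrite natr1; exact: truncnS_gt.
  have h2 : 1 <= (q k)%:R :> R by rewrite ler1n.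
  by rewrite invfM mulrC ler_pdivrMr//; move: h1 h2; lra.
apply: le_trans (HS (r := dyad rho) (q := q) N _ _ _ _ _ _).
- apply: ler_sum => k _.
  have rk0 := d0 k; set r := dyad rho k in rk0 *.
  (* The powers of [q k] combine to [d - (p - 1) = n - p]. *)
  have -> : (q k)%:R ^+ d * (r ^+ d.+1 / (q k)%:R) `^ (p - 1) =
      r `^ (n * (p - 1)) * (q k)%:R `^ (n - p).
    rewrite powRM ?exprn_ge0 ?invr_ge0 ?ltW// mulrCA; congr (_ * _).
      by rewrite -powR_mulrn ?ltW// -powRrM.
    rewrite -powR_mulrn ?ltW// -[X in X `^ (p - 1)]powR_inv1 ?ltW// -powRrM -powRD.
      by congr (_ `^ _); rewrite -natr1; ring.
    by rewrite (gt_eqF (q0' k)) implybT.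
  rewrite ler_wpM2l ?powR_ge0// -[p - n]opprB powRN -/(w k).
  have w20 : 0 < 2 * w k by rewrite mulr_gt0.
  have np0 : 0 <= n - p by rewrite subr_ge0 ltW.
  rewrite -[leRHS]invrK lef_pV2 ?posrE ?invr_gt0 ?powR_gt0//.
  rewrite (_ : ((q k)%:R `^ (n - p))^-1 = (q k)%:R^-1 `^ (n - p)); last first.
    by rewrite -powRN -mulN1r powRrM powR_inv1 ?ltW.
  apply: ge0_ler_powR.
  - exact: np0.
  - by rewrite nnegrE invr_ge0 ltW.
  - by rewrite nnegrE ltW.
  - exact: qw2.
- by move=> k; rewrite d0/= (le_lt_trans (dle k)).
- by move=> k; exact: dyadS.
- exact: q0.
- move=> k; apply: le_truncn; rewrite lef_pV2 ?posrE// lerD2r ler_pM2l//.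
  by apply: omega_nd; [exact: ltW|exact: dyad_le].
- by move=> k; apply: (le_trans (qw2 k)); have := wbe k; move: be2; lra.
- by move=> k; apply: le_trans (qw k); rewrite lerDl ltW.
Unshelve. all: by end_near. Qed.

(* Otherwise a single term of the sums in [eps_sum_le] is unbounded as [eps] tends
   to 0. *)
Lemma omega_gt0 x : 0 < x -> 0 < omega x.
Proof.
move=> x0; rewrite lt_neqAle omega_ge0 ?ltW// andbT eq_sym; apply/negP => /eqP ox.
have [rho [be [rho0 rho1 be0 H]]] := eps_sum_le.
have [k kx] := dyad_small rho0 x0.
have dk0 := dyad_gt0 k rho0.
have ok : omega (dyad rho k) = 0.
  apply/le_anti/andP; split; last by apply: omega_ge0; exact: ltW.
  by apply: le_trans (omega_nd (ltW dk0) kx) _; rewrite ox.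
pose A := dyad rho k `^ (n * (p - 1)).
have A0 : 0 < A by rewrite powR_gt0.
have np0 : 0 < n - p by rewrite subr_gt0.
pose c := A / (`|S| + 1).
have S0 : 0 < `|S| + 1 by rewrite ltr_wpDl.
have c0 : 0 < c by rewrite divr_gt0.
(* The second bound gives [(2 * eps) ^ (n - p) <= c], so the term of index [k] alone is at least
   [A / c = |S| + 1]. *)
pose eps := Num.min be (c `^ (n - p)^-1 / 2).
have e0 : 0 < eps by rewrite lt_min be0 divr_gt0// powR_gt0.
have /H : 0 < eps <= be by rewrite e0 ge_min lexx.
move=> /(_ k.+1); apply/negP; rewrite -ltNge big_ord_recr/=.
apply: (@lt_le_trans _ _ (A * (2 * (Cw * omega (dyad rho k) + eps)) `^ (p - n))); last first.
  by rewrite lerDr sumr_ge0// => i _; rewrite mulr_ge0 ?powR_ge0.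
rewrite ok mulr0 add0r -[p - n]opprB powRN ltr_pdivlMr ?powR_gt0 ?mulr_gt0//.
have h : (2 * eps) `^ (n - p) <= c.
  have -> : c = (c `^ (n - p)^-1) `^ (n - p).
    by rewrite -powRrM mulVf ?gt_eqF// powRr1// ltW.
  apply: ge0_ler_powR.
  - exact: ltW.
  - by rewrite nnegrE ltW// mulr_gt0.
  - by rewrite nnegrE powR_ge0.
  - by rewrite mulrC -ler_pdivlMr// ge_min lexx orbT.
have h2 : S < `|S| + 1 by rewrite ltr_pwDr// ler_norm.
apply: (@lt_le_trans _ _ ((`|S| + 1) * (2 * eps) `^ (n - p))).
  by rewrite ltr_pM2r// powR_gt0// mulr_gt0.
by rewrite mulrC -ler_pdivlMr.
Qed.

Lemma omega_sum_le : exists rho S' : R, [/\ 0 < rho, rho <= 1 / 2 &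
  forall N, \sum_(k < N) dyad rho k `^ (n * (p - 1)) * omega (dyad rho k) `^ (p - n) <= S'].
Proof.
have [rho [be [rho0 rho1 be0 H]]] := eps_sum_le.
exists rho, (S / (4 * Cw) `^ (p - n)); split => // N.
have o0 k : 0 < omega (dyad rho k) by apply: omega_gt0; exact: dyad_gt0.
(* Being at most [Cw * omega] at a scale below all those of the sum, [eps] is absorbed by passing
   from [2 * Cw] to [4 * Cw]. *)
pose eps := Num.min be (Cw * omega (dyad rho N)).
have e0 : 0 < eps by rewrite lt_min be0 mulr_gt0.
have /H : 0 < eps <= be by rewrite e0 ge_min lexx.
move=> /(_ N); rewrite ler_pdivlMr ?powR_gt0 ?mulr_gt0//; apply: le_trans.
rewrite mulr_suml; apply: ler_sum => k _.
rewrite -mulrA; apply: ler_wpM2l; first exact: powR_ge0.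
have C40 : 0 < 4 * Cw by exact: mulr_gt0.
rewrite -(powRM _ (ltW (o0 k)) (ltW C40)) -[p - n]opprB !powRN.
have dk : dyad rho N <= dyad rho k by apply: dyad_le => //; exact/ltnW.
have ek : eps <= Cw * omega (dyad rho k).
  rewrite ge_min; apply/orP; right; rewrite ler_pM2l//.
  by apply: omega_nd => //; rewrite ltW// dyad_gt0.
have Co0 : 0 < Cw * omega (dyad rho k) by exact: mulr_gt0.
rewrite lef_pV2 ?posrE ?powR_gt0 ?mulr_gt0 ?addr_gt0//.
apply: ge0_ler_powR.
- by rewrite subr_ge0 ltW.
- by rewrite nnegrE ltW// mulr_gt0// addr_gt0.
- by rewrite nnegrE ltW// !mulr_gt0.
- by move: ek; move: (omega _) => o; lra.
Qed.

End scale_sum.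

Section dyadic_integral.
Context {R : realType}.
Local Notation mu := (@lebesgue_measure R).

(** The quotient [x / r] lies between 1 and [c]; the exponent [|e|] treats growing and decaying
    powers alike. *)
Lemma powR_le_scaled (x r c e : R) : 0 < r -> r <= x -> x <= c * r ->
  x `^ e <= c `^ `|e| * r `^ e.
Proof.
move=> r0 rx xc.
have y1 : 1 <= x / r by rewrite ler_pdivlMr// mul1r.
have y0 : 0 <= x / r by exact: le_trans y1.
have yc : x / r <= c by rewrite ler_pdivrMr.
have xE : x = x / r * r by rewrite divfK// gt_eqF.
rewrite {1}xE powRM ?(ltW r0)//.
apply: ler_wpM2r; first exact: powR_ge0.
apply: (le_trans (ler_powR y1 (ler_norm e))).
by apply: ge0_ler_powR; rewrite ?nnegrE// (le_trans y0).
Qed.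

Lemma integral_le_const (f : R -> R) (i : interval R) (c : R) :
  measurable_fun [set` i] f -> (forall x, x \in i -> 0 <= f x <= c) ->
  (\int[mu]_(x in [set` i]) (f x)%:E <= c%:E * mu [set` i])%E.
Proof.
move=> mf fc; rewrite -integral_cst; last exact: measurable_itv.
apply: ge0_le_integral => //.
- by move=> x /fc/andP[]; rewrite lee_fin.
- exact/measurable_EFinP.
- by move=> x /fc/andP[]; rewrite lee_fin.
Qed.

(** The interval between [dyad rho k.+1] and [dyad rho k] has length [dyad rho k.+1], whence the
    weights; [M] covers the part above [rho], and monotone convergence exhausts the unit
    interval. *)
Lemma dyadic_integral_le (f : R -> R) (rho M C : R) (a : nat -> R) :
  0 < rho -> rho < 1 -> 0 <= M -> measurable_fun `](0 : R), 1[%classic f ->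
  (forall x, 0 < x -> 0 <= f x) ->
  (forall x, rho <= x -> x < 1 -> f x <= M) ->
  (forall k x, dyad rho k.+1 <= x -> x <= dyad rho k -> f x <= a k) ->
  (forall N, \sum_(k < N) a k * dyad rho k.+1 <= C) ->
  (\int[mu]_(x in `]0%R, 1%R[) (f x)%:E <= (M + C)%:E)%E.
Proof.
move=> r0 r1 M0 mf f0 fM fa aC.
have d0 k := dyad_gt0 k r0.
have d1 k : dyad rho k <= rho.
  by apply: le_trans (dyad_le r0 (leq0n k)) _; rewrite /dyad expr0 divr1.
have sub1 (i : interval R) k : (forall x, x \in i -> dyad rho k <= x < 1) ->
    [set` i] `<=` `](0 : R), 1[%classic.
  by move=> h x /= /h /andP[kx x1]; rewrite in_itv/= x1 andbT (lt_le_trans (d0 k)).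
have msub (i : interval R) k : (forall x, x \in i -> dyad rho k <= x < 1) ->
    measurable_fun [set` i] f.
  by move=> /sub1 h; apply: measurable_funS mf.
have step N : (\int[mu]_(x in `](dyad rho N), 1%R[) (f x)%:E <=
    (M + \sum_(k < N) a k * dyad rho k.+1)%:E)%E.
  elim: N => [|N IH].
    rewrite big_ord0 addr0; apply: (@le_trans _ _ (M%:E * mu `](dyad rho 0), 1%R[)%E).
      apply: integral_le_const.
        by apply: (msub _ 0%N) => x; rewrite in_itv/= => /andP[/ltW -> ->].
      move=> x; rewrite in_itv/= {1}/dyad expr0 divr1 => /andP[rx x1].
      by rewrite f0 ?(lt_trans r0)//= fM ?ltW.
    rewrite lebesgue_measure_itv/= lte_fin /dyad expr0 divr1.
    case: ifP => _; rewrite ?mule0 ?lee_fin//.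
    by rewrite ler_piMr// gerBl ltW.
  have lN : dyad rho N.+1 <= dyad rho N by exact: dyad_le.
  have N1 : dyad rho N < 1 by exact: le_lt_trans (d1 N) r1.
  have mU : measurable_fun `](dyad rho N.+1), 1[%classic f.
    by apply: (msub _ N.+1) => x; rewrite in_itv/= => /andP[/ltW -> ->].
  have UE : `](dyad rho N.+1), 1[%classic =
      `](dyad rho N.+1), (dyad rho N)] `|` `](dyad rho N), 1[%classic.
    by apply: itv_bndbnd_setU; rewrite bnd_simp.
  rewrite UE ge0_integral_setU//; last 3 first.
  - by rewrite -UE; exact/measurable_EFinP.
  - by move=> x; rewrite -UE/= in_itv/= => /andP[Nx _]; rewrite lee_fin f0 ?(lt_trans _ Nx).
  - apply/disj_set2P; rewrite -subset0 => x [/=]; rewrite !in_itv/= => /andP[_ xN] /andP[Nx _].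
    by move: (lt_le_trans Nx xN); rewrite ltxx.
  have IA : (\int[mu]_(x in `](dyad rho N.+1), (dyad rho N)]) (f x)%:E <=
      (a N * dyad rho N.+1)%:E)%E.
    apply: (@le_trans _ _ ((a N)%:E * mu `](dyad rho N.+1), (dyad rho N)])%E).
      apply: integral_le_const.
        by apply: measurable_funS mU => //; rewrite UE; exact: subsetUl.
      move=> x; rewrite in_itv/= => /andP[Nx xN].
      by rewrite f0 ?(lt_trans _ Nx)//= fa// ltW.
    rewrite lebesgue_measure_itv/= lte_fin (dyadS rho N) ifT; last first.
      by have := d0 N.+1; lra.
    by rewrite -EFinB -EFinM lee_fin; have := d0 N.+1; lra.
  apply: le_trans (leeD IA IH) _.
  by rewrite big_ord_recr/= lee_fin [leLHS]addrC addrA.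
have UE : `](0 : R), 1[%classic = \bigcup_N `](dyad rho N), 1[%classic.
  apply/seteqP; split => x /=.
    rewrite in_itv/= => /andP[x0 x1].
    have [k kx] := dyad_small r0 (divr_gt0 x0 (ltr0n _ 2)).
    exists k => //=; rewrite in_itv/= x1 andbT (le_lt_trans kx)//.
    by move: x0; lra.
  by move=> [k _ /=]; rewrite !in_itv/= => /andP[kx ->]; rewrite (lt_trans (d0 k)).
have cv : (\int[mu]_(x in `](dyad rho N), 1%R[) (f x)%:E @[N --> \oo] -->
    \int[mu]_(x in \bigcup_N `](dyad rho N), 1%R[%classic) (f x)%:E)%E.
  apply: (ge0_nondecreasing_set_cvg_integral (mu := mu)
    (F := (fun N => `](dyad rho N), 1%R[%classic) : nat -> set (measurableTypeR R))
    (f := EFin \o f)).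
  - move=> k l kl; apply/subsetPset => x /=; rewrite !in_itv/= => /andP[kx ->].
    by rewrite (le_lt_trans _ kx)// dyad_le.
  - by move=> k; exact: measurable_itv.
  - move=> k; have mk : measurable_fun `](dyad rho k), 1%R[%classic f.
      by apply: (msub _ k) => x; rewrite in_itv/= => /andP[/ltW -> ->].
    exact/measurable_EFinP.
  - by move=> k x /=; rewrite in_itv/= => /andP[kx _]; rewrite lee_fin f0// (lt_trans (d0 k)).
rewrite UE; apply: (cvge_to_le cv).
by apply: nearW => N; apply: (le_trans (step N)); rewrite lee_fin lerD2l.
Qed.

End dyadic_integral.

Section modulus_integral.
Context {R : realType}.
Local Notation mu := (@lebesgue_measure R).

Lemma measurable_powR_modulus (omega : R -> R) (e s : R) :
  {within `[0, +oo[, continuous omega} ->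
  measurable_fun `](0 : R), 1[%classic (fun x : R => x `^ e * omega x `^ s).
Proof.
move=> co; apply: measurable_funM.
  by apply: measurable_funS (measurable_powR e).
apply: (@measurableT_comp _ _ _ _ _ _ ((@powR R)^~ s)); first exact: measurable_powR.
apply: (@measurable_funS _ _ _ _ `[(0 : R), +oo[%classic).
- exact: measurable_itv.
- by move=> x /=; rewrite !in_itv/= => /andP[/ltW ->].
- by apply: subspace_continuous_measurable_fun => //; exact: measurable_itv.
Qed.

(** On a dyadic interval [omega ^ (- s)] is largest at the left end point, and the length of the
    interval raises the exponent [e] to [e + 1]. *)
Lemma modulus_integral_finite (omega : R -> R) (e s rho C : R) :
  (forall x y, 0 <= x -> x <= y -> omega x <= omega y) ->
  {within `[0, +oo[, continuous omega} -> (forall x, 0 < x -> 0 < omega x) ->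
  0 <= s -> 0 < rho -> rho < 1 ->
  (forall N, \sum_(k < N) dyad rho k `^ (e + 1) * omega (dyad rho k) `^ (- s) <= C) ->
  (\int[mu]_(x in `]0%R, 1%R[) (x `^ e * omega x `^ (- s))%:E < +oo)%E.
Proof.
move=> omega_nd co o0 s0 r0 r1 HC.
have d0 k := dyad_gt0 k r0.
have os x y : 0 < x -> x <= y -> omega y `^ (- s) <= omega x `^ (- s).
  move=> x0 xy; have y0 := lt_le_trans x0 xy.
  rewrite !powRN lef_pV2 ?posrE ?powR_gt0 ?o0//.
  apply: ge0_ler_powR => //; rewrite ?nnegrE; [exact/ltW/o0|exact/ltW/o0|].
  by apply: omega_nd => //; exact: ltW.
apply: le_lt_trans (ltry _).
apply: (@dyadic_integral_le _ _ rho (rho^-1 `^ `|e| * rho `^ e * omega rho `^ (- s))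
  (2 `^ `|e| * C)
  (fun k => 2 `^ `|e| * dyad rho k.+1 `^ e * omega (dyad rho k.+1) `^ (- s))) => //.
- by rewrite !mulr_ge0 ?powR_ge0.
- exact: measurable_powR_modulus.
- by move=> x x0; rewrite mulr_ge0 ?powR_ge0.
- move=> x rx x1; apply: ler_pM; rewrite ?powR_ge0//; last exact: os.
  by apply: powR_le_scaled => //; rewrite mulVf ?gt_eqF// ltW.
- move=> k x rx xr; apply: ler_pM; rewrite ?powR_ge0//; last exact: os.
  by apply: powR_le_scaled => //; rewrite -dyadS.
- move=> N; under eq_bigr => k _ do rewrite -!mulrA.
  rewrite -mulr_sumr; apply: ler_wpM2l; first exact: powR_ge0.
  (* The bounds are taken at [dyad rho k.+1], so they match the sum of the hypothesis without its
     term of index 0. *)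
  apply: le_trans (HC N.+1); rewrite big_ord_recl/=.
  have -> : \sum_(i < N) dyad rho i.+1 `^ e * (omega (dyad rho i.+1) `^ (- s) * dyad rho i.+1) =
      \sum_(i < N) dyad rho (bump 0 i) `^ (e + 1) * omega (dyad rho (bump 0 i)) `^ (- s).
    apply: eq_bigr => i _; rewrite /bump leq0n add1n powRD ?(gt_eqF (d0 _)) ?implybT//.
    by rewrite powRr1 ?ltW// -mulrA [_ * dyad _ _]mulrC.
  by rewrite lerDr mulr_ge0 ?powR_ge0.
Qed.

Lemma modulus_integral_finite_ge (omega : R -> R) (e s : R) :
  (forall x y, 0 <= x -> x <= y -> omega x <= omega y) ->
  {within `[0, +oo[, continuous omega} -> (forall x, 0 <= x -> 0 <= omega x) ->
  0 <= s -> 0 <= e ->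
  (\int[mu]_(x in `]0%R, 1%R[) (x `^ e * omega x `^ s)%:E < +oo)%E.
Proof.
move=> omega_nd co o0 s0 e0.
apply: (@le_lt_trans _ _ ((omega 1 `^ s)%:E * mu `]0%R, 1%R[)%E).
  apply: integral_le_const; first exact: measurable_powR_modulus.
  move=> x; rewrite in_itv/= => /andP[x0 x1]; rewrite mulr_ge0 ?powR_ge0//=.
  rewrite -[leRHS]mul1r; apply: ler_pM; rewrite ?powR_ge0//.
    have -> : (1 : R) = 1 `^ e by rewrite powR1.
    by apply: ge0_ler_powR; rewrite ?nnegrE ?(ltW x0) ?(ltW x1)//.
  apply: ge0_ler_powR; rewrite ?nnegrE ?o0 ?ler01 ?(ltW x0)//.
  by apply: omega_nd; exact: ltW.
by rewrite lebesgue_measure_itv/= lte_fin ltr01 -EFinB -EFinM ltry.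
Qed.

End modulus_integral.

(** For [x = 0] and [r > 0] the two sides differ: the left one is [+oo], while [powR] gives 0. Hence
    for [p < n] the integrand can be rewritten only once [omega] is known to be positive. *)
Lemma epow_inv (R : realType) (x r : R) : 0 < x \/ 0 <= x /\ r <= 0 ->
  ((epow x r)^-1 = (x `^ (- r))%:E)%E.
Proof.
rewrite /epow => xr.
have [x0|x0] := eqVneq x 0; last first.
  have x1 : 0 < x by case: xr => // -[x1 _]; rewrite lt_neqAle eq_sym x0.
  by rewrite inver gt_eqF ?powR_gt0// powRN.
have r0 : r <= 0 by case: xr => [|[]//]; rewrite x0 ltxx.
rewrite x0 /=; have [r1|r1] := eqVneq r 0.
  by rewrite r1 ltxx oppr0 powRr0 inver oner_eq0 invr1.
by rewrite lt_neqAle r1 r0 invey powR0// oppr_eq0.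
Qed.

Theorem theorem2 (R : realType) (n : nat) (p : R) (omega : R -> R)
    (D : set 'rV[R]_n)
    (hn : (2 <= n)%N)
    (hp : 1 <= p)
    (omega_nd : {in `[0, +oo[ &, {homo omega : x y / x <= y}})
    (omega_cont : {within `[0, +oo[, continuous omega})
    (omega0 : omega 0 = 0)
    (D_domain : domain D)
    (D_bounded : bounded_set D)
    (D_C1omega : C1omega_boundary omega D)
    (int_infty :
      (\int[@lebesgue_measure R]_(delta in `]0%R, 1%R[)
         ((delta `^ (n%:R * (p - 1) - 1))%:E
            / epow (omega delta) (n%:R - p)) = +oo)%E) :
  ~ A_space p%:E (distr_of_fun (char_fun D)).
Proof.
case: n D hn D_domain D_bounded D_C1omega int_infty => [//|d] D n2
  [D0 Do _] Db [D1 [nu [Nn mO]]] ioo Ap.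
set N := d.+1%:R : R in ioo *.
have o_nd x y : 0 <= x -> x <= y -> omega x <= omega y.
  move=> x0 xy; apply: omega_nd => //; rewrite in_itv/= andbT//.
  exact: le_trans xy.
have o_ge0 x : 0 <= x -> 0 <= omega x by move=> x0; rewrite -omega0; exact: o_nd.
have o_cvg : omega x @[x --> 0^'+] --> (0 : R).
  by move/continuous_within_itvcyP : (omega_cont) => [_]; rewrite omega0.
suff : (\int[@lebesgue_measure R]_(delta in `]0%R, 1%R[)
    ((delta `^ (N * (p - 1) - 1))%:E / epow (omega delta) (N - p)) < +oo)%E.
  by rewrite ioo ltxx.
have iE : (forall x, 0 < x -> 0 < omega x) \/ N - p <= 0 ->
    (\int[@lebesgue_measure R]_(delta in `]0%R, 1%R[)
      ((delta `^ (N * (p - 1) - 1))%:E / epow (omega delta) (N - p)) =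
    \int[@lebesgue_measure R]_(delta in `]0%R, 1%R[)
      (delta `^ (N * (p - 1) - 1) * omega delta `^ (- (N - p)))%:E)%E.
  move=> h; apply: eq_integral => x; rewrite inE/= in_itv/= => /andP[x0 _].
  rewrite epow_inv ?EFinM//; case: h => h; [left; exact: h|right; split => //].
  by apply: o_ge0; exact: ltW.
(* For [p >= n] both exponents are nonnegative, and the integrand is bounded on the unit
   interval. *)
have [pn|pn] := leP N p.
  rewrite iE; last by right; rewrite subr_le0.
  apply: modulus_integral_finite_ge => //; first by rewrite oppr_ge0 subr_le0.
  have N2 : 2 <= N by rewrite ler_nat.
  by nra.
have [S [et [et0 HS]]] := A_space_series hp D0 Do Db D1 Nn Ap.
have [Cw [dl0 [Cw0 dl00 HC]]] : exists Cw dl0 : R, [/\ 0 < Cw, 0 < dl0 &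
    forall x, 0 < x < dl0 -> modulus (boundary D) nu x <= Cw * omega x].
  move/eqO_exP : mO => [c c0 /nbhs_ballP[dl dl0 H]].
  exists c, dl; split=> // x /andP[x0 xdl].
  apply: le_trans (ler_norm _) _; rewrite -(ger0_norm (o_ge0 _ (ltW x0))).
  by apply: H => //; rewrite /ball/= sub0r normrN gtr0_norm.
have HS' (M : nat) (r : nat -> R) (q : nat -> nat) :
  (forall k, 0 < r k < dl0) -> (forall k, r k = 2 * r k.+1) ->
  (forall k, (0 < q k)%N) -> (forall k, (q k <= q k.+1)%N) ->
  (forall k, (q k)%:R^-1 <= et) -> (forall k, Cw * omega (r k) <= (q k)%:R^-1) ->
  \sum_(k < M) (q k)%:R ^+ d * (r k ^+ d.+1 / (q k)%:R) `^ (p - 1) <= S.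
  move=> r0 rS q0 qS qet oq; apply: HS => //.
    by move=> k; have /andP[] := r0 k.
  move=> k x y Bx By xy; apply: le_trans (normal_diff_le_modulus Nn Bx By xy) _.
  by apply: le_trans (HC _ (r0 k)) (oq k).
(* If [omega] vanished somewhere the integral would be infinite by convention; here membership in
   [A_p] excludes this. *)
have o_gt0 := omega_gt0 pn Cw0 dl00 et0 o_nd o_cvg o_ge0 HS'.
have [rho [C [rho0 rho1 rhoC]]] := omega_sum_le pn Cw0 dl00 et0 o_nd o_cvg o_ge0 HS'.
rewrite iE; last by left.
apply: (modulus_integral_finite (rho := rho) (C := C)) => //.
- by rewrite subr_ge0 ltW.
- by apply: le_lt_trans rho1 _; lra.
- by move=> M; rewrite subrK opprB.
Qed.
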